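(* Let $k\ge2$ and $J\ge1$ be integers. For all sufficiently small $\delta_0>0$, define the bilinear form $$\mathcal{M}[\vec\lambda;g,\dot g]:=\sum_{j=1}^J\delta_0^{\,j-1}\mathcal{M}_0[\lambda_j;g,\dot g]$$ for $\vec\lambda\in\mathcal{P}_J(1)$ and $\boldsymbol g=(g,\dot g)\in\dot{\mathcal H}^2$. Then the following hold. 1. (Boundedness) For any $\boldsymbol g\in\dot{\mathcal H}^2$ and $\vec\lambda\in\mathcal P_J(1)$, $$|\mathcal M[\vec\lambda;g,\dot g]|\lesssim\big\||g|_{-2}|\dot g|_{-1}\big\|_{L^1}\lesssim\|\boldsymbol g\|_{\dot{\mathcal H}^2}^2.$$ 2. (Monotonicity) There exists $\alpha^*=\alpha^*(\delta_0)\in(0,1)$ such that for all $(\vec\iota,\vec\lambda)\in\mathcal P_J(\alpha^* )$ and any $\boldsymbol g\in\dot{\mathcal H}^2$ satisfying the orthogonality conditions $\langle\mathcal Z_{;i},g\rangle=\langle\mathcal Z_{;i},\dot g\rangle=0$ for all $i\in\{1,\dots,J\}$, we have $$-\big\{\mathcal M[\vec\lambda;g,-H_{\mathcal Q(\vec\iota,\vec\lambda)}g]+\mathcal M[\vec\lambda;\dot g,\dot g]\big\}\ge c\sum_{j=1}^J\delta_0^{\,j-1}\|\boldsymbol g\|_{\mathrm{Mor}(\lambda_j)}^2=:c\|\boldsymbol g\|_{\mathrm{Mor}}^2$$ for some $c>0$ independent of $\delta_0$. 3. ($\lambda\partial_\lambda$-estimates) For any $\boldsymbol g\in\dot{\mathcal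 H}^2$ and $\vec\lambda\in\mathcal P_J(1)$, $$|\lambda_j\partial_{\lambda_j}\mathcal M[\vec\lambda;g,\dot g]|\lesssim\lambda_j^{1/2}\|\boldsymbol g\|_{\dot{\mathcal H}^2}\|\boldsymbol g\|_{\mathrm{Mor}},\qquad\forall j\in\{1,\dots,J\}.$$ 4. (Smallness for modulation vectors) For all $\alpha\in(0,\alpha^*]$ and $(\vec\iota,\vec\lambda)\in\mathcal P_J(\alpha)$ (and any $\boldsymbol g\in\dot{\mathcal H}^2$), $$|\mathcal M[\vec\lambda;g,\Lambda Q_{\underline{;j}}]|\lesssim\{\delta_0+o_{\alpha\to0}(1)\,\delta_0^{-J}\}\cdot\lambda_j^{-1/2}\delta_0^{(j-1)/2}\|\boldsymbol g\|_{\mathrm{Mor}},\qquad\forall j\in\{1,\dots,J\}.$$ Implicit constants in $\lesssim$ depend only on $k$ and $J$, and $o_{\alpha\to0}(1)$ denotes a quantity tending to $0$ as $\alpha\to0$.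
   Context: Functions are real functions of $r\in(0,\infty)$; integrals $\int$, $L^p$ norms and $\langle f,g\rangle=\int fg$ use the measure $r\,dr$. Notation: $|g|_{-m}^2=|\partial_r^mg|^2+|r^{-1}\partial_r^{m-1}g|^2+\dots+|r^{-m}g|^2$; $\|\boldsymbol g\|_{\dot{\mathcal H}^2}^2=\int\{|\partial_{rr}g|^2+|\frac1r\partial_rg|^2+|\frac1{r^2}g|^2\}+\{|\partial_r\dot g|^2+|\frac1r\dot g|^2\}$ for $\boldsymbol g=(g,\dot g)$, and $\dot{\mathcal H}^2$ is the corresponding space. Profiles: $Q(r)=2\arctan(r^k)$, $\Lambda Q=r\partial_rQ$, $\mathcal Z=\frac{\chi\Lambda Q}{\int\chi(\Lambda Q)^2}$, where $\chi$ is a fixed smooth cutoff with $0\le\chi\le1$, $\chi(r)=1$ for $r\le1$, $\chi(r)=0$ for $r\ge2$. For $\lambda>0$: $f_\lambda(r)=f(r/\lambda)$. Multi-bubbles: $\mathcal P_J(\alpha)=\{(\vec\iota,\vec\lambda)\in\{\pm1\}^J\times(0,\infty)^J:\max_{2\le j\le J}\lambda_j/\lambda_{j-1}<\alpha\}$ (no condition on $\vec\lambda$ if $J=1$); $\vec\lambda\in\mathcal P_J(\alpha)$ means the condition on $\vec\lambda$. For a function $\phi$, $\phi_{;j}(r)=\iota_j\phi(r/\lambda_j)$ and $\phi_{\underline{;j}}=\lambda_j^{-1}\phi_{;j}$. $\mathcal Q(\vec\iota,\vec\lambda)=\sum_{j=1}^J\iota_jQ_{\lambda_j}$. Operators: $H_U=-\partial_{rr}-\frac1r\partial_r+k^2\frac{\cos2U}{r^2}$,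 $H_\lambda=H_{Q_\lambda}$, $A_\lambda=-\partial_r+\frac{k\cos Q_\lambda}{r}$, $A=A_1$, $A^*=\partial_r+\frac{1+k\cos Q}{r}$, $\widetilde H=AA^*$. Function $\psi$: a fixed smooth function $\psi:(0,\infty)\to\mathbb R$ (depending only on $k$) such that $\psi=\partial_y\phi$ for some $\phi$ admitting a smooth radial extension to $\mathbb R^2$, $0\le\psi\le1$, $\psi\simeq\frac{y}{1+y}$, and, with $\psi_\lambda(r)=\psi(r/\lambda)$, $y=r/\lambda$ and $$\Lambda_{\psi,\lambda}g=\psi_\lambda\partial_rg+\tfrac12(\partial_r\psi_\lambda+r^{-1}\psi_\lambda)g,\qquad \Lambda_\psi=\Lambda_{\psi,1},$$ one has $|\Lambda_{\psi,\lambda}g|\lesssim\frac{y}{1+y}|g|_{-1}$, $|(\lambda\partial_\lambda\Lambda_{\psi,\lambda})g|\lesssim\frac{y}{(1+y)^2}|g|_{-1}$, and $\langle\widetilde Hf,\Lambda_\psi f\rangle\gtrsim\int\big(\frac{|\partial_yf|^2}{(1+y)^2}+\frac{|y^{-1}f|^2}{1+y}\big)$. (One may take $\psi(y)=\frac{y}{\langle y\rangle}-\delta'\frac{y}{\langle y\rangle^2}$, $\langle y\rangle=(1+y^2)^{1/2}$, with $\delta'>0$ small fixed.) Single-bubble Morawetz form: for $\lambda>0$, $$\mathcal M_0[\lambda;g,\dot g]=\langle A_\lambda\dot g,\Lambda_{\psi,\lambda}(A_\lambda g)\rangle-\delta\langle A_\lambda\dot g,\lambda(r+\lambda)^{-2}A_\lambda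 g\rangle,$$ where $\delta>0$ is a fixed sufficiently small constant depending only on $k$ and $\psi$, chosen so that for some constants $c_0,C_0>0$, for all $\lambda>0$ and $\boldsymbol g\in\dot{\mathcal H}^2$, $-\{\mathcal M_0[\lambda;g,-H_\lambda g]+\mathcal M_0[\lambda;\dot g,\dot g]\}\ge c_0\|\boldsymbol g\|_{\mathrm{Mor}(\lambda)}^2-C_0\{\lambda^{-7}\langle\mathcal Z_\lambda,g\rangle^2+\lambda^{-5}\langle\mathcal Z_\lambda,\dot g\rangle^2\}$. Here, with $y=r/\lambda$, $$\|\boldsymbol g\|_{\mathrm{Mor}(\lambda)}^2=\int\Big\{\frac{|\partial_{rr}g|^2+|\dot g|_{-1}^2}{(\lambda+r)(1+y)}+\frac{r^{-2}|g|_{-1}^2}{\lambda+r}\Big\}.$$ The norm $\|\boldsymbol g\|_{\mathrm{Mor}}^2=\sum_{j=1}^J\delta_0^{j-1}\|\boldsymbol g\|_{\mathrm{Mor}(\lambda_j)}^2$ depends on $\delta_0$ and $\vec\lambda$. The expressions $\mathcal M[\vec\lambda;g,-H_{\mathcal Q}g]$ and $\mathcal M[\vec\lambda;\dot g,\dot g]$ are understood after integration by parts, i.e. as the continuous extensions from $C_c^\infty(0,\infty)$ of the corresponding quadratic forms; in particular, $\langle f,\Lambda_{\psi,\lambda}f\rangle=0$ by anti-symmetry of $\Lambda_{\psi,\lambda}$. *)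

(* Defs.v *)
From HB Require Import structures.
From mathcomp Require Import all_boot all_order all_algebra.
From mathcomp Require Import all_classical all_reals all_analysis.

Set Implicit Arguments.
Unset Strict Implicit.
Unset Printing Implicit Defensive.

Import Order.TTheory GRing.Theory Num.Theory.
Import numFieldNormedType.Exports.

Local Open Scope classical_set_scope.
Local Open Scope ring_scope.

(* A function of r in (0, +oo) is represented by a total function R -> R.
   Its values at r <= 0 are never used: every integral is over ]0, +oo[ and
   every pointwise condition is at some r > 0. *)

(* ** Integration against r dr *)

Definition rint (R : realType) (f : R -> R) : R :=
  \int[lebesgue_measure]_(r in `]0, +oo[) (f r * r).

Definition rintegrable (R : realType) (f : R -> R) : Prop :=
  lebesgue_measure.-integrable `]0, +oo[ (fun r : R => (f r * r)%:E).

Definition rL1norm (R : realType) (f : R -> R) : \bar R :=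
  (\int[lebesgue_measure]_(r in `]0%R, +oo[) (`|f r| * r)%:E)%E.

Definition rdot (R : realType) (f g : R -> R) : R := rint (fun r => f r * g r).

(* ** Regularity classes on (0, +oo) *)

Definition smooth_pos (R : realType) (f : R -> R) : Prop :=
  forall (n : nat) (r : R), 0 < r -> derivable (derive1n n f) r 1.

(* C_c^oo(0, +oo) *)
Definition test_fun (R : realType) (f : R -> R) : Prop :=
  smooth_pos f /\
  exists a b : R, [/\ 0 < a, a < b &
    forall r, 0 < r -> r < a \/ b < r -> f r = 0].

(* Local absolute continuity on (0, +oo): f is differentiable almost
   everywhere and is the primitive of its (locally integrable) derivative.
   Equivalently, f is the continuous representative of a W^{1,1}_loc function.
   (derive1 takes the value 0 where the derivative does not exist, which is a
   null set of points here.) *)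
Definition loc_abs_continuous (R : realType) (f : R -> R) : Prop :=
  forall a b : R, 0 < a -> a < b ->
    lebesgue_measure.-integrable `[a, b] (EFin \o derive1 f) /\
    f b - f a = \int[lebesgue_measure]_(r in `[a, b]) derive1 f r.

(* C^oo functions on a normed space: all iterated directional derivatives
   exist and are continuous. *)
Definition smooth_map (R : realType) (V : normedModType R) (f : V -> R) : Prop :=
  forall s : seq V,
    let Df := foldr (fun v h => fun x => 'D_v h x) f s in
    continuous Df /\ forall x v, derivable Df x v.

Definition smooth_radial_extension (R : realType) (phi : R -> R) : Prop :=
  exists Phi : 'rV[R]_2 -> R, smooth_map Phi /\
    forall x : 'rV[R]_2, x != 0 ->
      Phi x = phi (Num.sqrt (\sum_(i < 2) (x 0 i) ^+ 2)).

(* ** The jet norms |g|_{-m} and the space dot H^2 *)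

Definition jet_sq (R : realType) (m : nat) (g : R -> R) (r : R) : R :=
  \sum_(l < m.+1) (r ^- l * derive1n (m - l) g r) ^+ 2.

Definition jet (R : realType) (m : nat) (g : R -> R) (r : R) : R :=
  Num.sqrt (jet_sq m g r).

Definition H2_density (R : realType) (g : (R -> R) * (R -> R)) (r : R) : R :=
  jet_sq 2 g.1 r + jet_sq 1 g.2 r.

Definition H2norm (R : realType) (g : (R -> R) * (R -> R)) : R :=
  Num.sqrt (rint (H2_density g)).

(* Pairs (g, dot g) with g in W^{2,1}_loc, dot g in W^{1,1}_loc, and finite
   norm.  The norm contains the scale-invariant Hardy terms, so (logarithmic
   cut-off and mollification) pairs of C_c^oo(0, +oo) functions are dense: this
   is also the completion of C_c^oo(0, +oo)^2. *)
Definition in_H2 (R : realType) (g : (R -> R) * (R -> R)) : Prop :=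
  [/\ loc_abs_continuous g.1, loc_abs_continuous (derive1 g.1),
      loc_abs_continuous g.2 & rintegrable (H2_density g)].

(* L is the value at g of the extension, continuous for the dot H^2 norm, of
   the functional q from pairs of test functions; by density there is at most
   one such L for g in dot H^2. *)
Definition extension_value (R : realType) (q : (R -> R) * (R -> R) -> R)
    (g : (R -> R) * (R -> R)) (L : R) : Prop :=
  forall e : R, 0 < e -> exists2 d : R, 0 < d &
    forall phi : (R -> R) * (R -> R), test_fun phi.1 -> test_fun phi.2 ->
      H2norm (phi.1 \- g.1, phi.2 \- g.2) < d -> `|q phi - L| < e.

(* ** Profiles *)

Definition scale (R : realType) (lam : R) (f : R -> R) : R -> R :=
  fun r => f (r / lam).

Definition Q (R : realType) (k : nat) : R -> R := fun r => 2 * atan (r ^+ k).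

Definition LambdaQ (R : realType) (k : nat) : R -> R :=
  fun r => r * derive1 (Q k) r.

Definition is_cutoff (R : realType) (chi : R -> R) : Prop :=
  [/\ smooth_pos chi,
      forall r, 0 < r -> 0 <= chi r <= 1,
      forall r, 0 < r -> r <= 1 -> chi r = 1 &
      forall r, 2 <= r -> chi r = 0].

Definition Zprofile (R : realType) (k : nat) (chi : R -> R) : R -> R :=
  fun r => chi r * LambdaQ k r / rint (fun s => chi s * LambdaQ k s ^+ 2).

(* ** Multi-bubbles (indices run over 0, ..., J-1) *)

(* The scales part of P_J(alpha). *)
Definition scales (R : realType) (J : nat) (alpha : R) (lam : 'I_J -> R) : Prop :=
  (forall j, 0 < lam j) /\
  (forall i j : 'I_J, j = i.+1 :> nat -> lam j / lam i < alpha).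

Definition P_J (R : realType) (J : nat) (alpha : R) (iota lam : 'I_J -> R) : Prop :=
  (forall j, iota j = 1 \/ iota j = -1) /\ scales alpha lam.

Definition bubble (R : realType) (J : nat) (iota lam : 'I_J -> R)
    (phi : R -> R) (j : 'I_J) : R -> R :=
  fun r => iota j * phi (r / lam j).

Definition bubble_underline (R : realType) (J : nat) (iota lam : 'I_J -> R)
    (phi : R -> R) (j : 'I_J) : R -> R :=
  fun r => (lam j)^-1 * bubble iota lam phi j r.

Definition multiQ (R : realType) (k J : nat) (iota lam : 'I_J -> R) : R -> R :=
  fun r => \sum_(j < J) iota j * scale (lam j) (Q k) r.

(* ** Operators *)

Definition Hop (R : realType) (k : nat) (U g : R -> R) : R -> R :=
  fun r => - derive1n 2 g r - r^-1 * derive1 g r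
           + k%:R ^+ 2 * (cos (2 * U r) / r ^+ 2) * g r.

Definition Aop (R : realType) (k : nat) (lam : R) (g : R -> R) : R -> R :=
  fun r => - derive1 g r + k%:R * cos (scale lam (Q k) r) / r * g r.

Definition Astar (R : realType) (k : nat) (g : R -> R) : R -> R :=
  fun r => derive1 g r + (1 + k%:R * cos (Q k r)) / r * g r.

Definition Htilde (R : realType) (k : nat) (g : R -> R) : R -> R :=
  Aop k 1 (Astar k g).

Definition Lambda_psi (R : realType) (psi : R -> R) (lam : R) (g : R -> R) : R -> R :=
  fun r => scale lam psi r * derive1 g r
           + 2^-1 * (derive1 (scale lam psi) r + r^-1 * scale lam psi r) * g r.

Definition is_morawetz_weight (R : realType) (k : nat) (psi : R -> R) : Prop :=
  smooth_pos psi /\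
  (exists phi : R -> R, smooth_radial_extension phi /\
     forall y : R, 0 < y -> is_derive y (1 : R) phi (psi y)) /\
  (forall y, 0 < y -> 0 <= psi y <= 1) /\
  (exists c C : R, [/\ 0 < c, 0 < C & forall y, 0 < y ->
     c * (y / (1 + y)) <= psi y <= C * (y / (1 + y))]) /\
  (exists2 C : R, 0 < C & forall (lam : R) (g : R -> R) (r : R),
     0 < lam -> 0 < r -> derivable g r 1 ->
     let y := r / lam in
     `|Lambda_psi psi lam g r| <= C * (y / (1 + y)) * jet 1 g r) /\
  (exists2 C : R, 0 < C & forall (lam : R) (g : R -> R) (r : R),
     0 < lam -> 0 < r -> derivable g r 1 ->
     let y := r / lam in
     `|lam * derive1 (fun l => Lambda_psi psi l g r) lam|
       <= C * (y / (1 + y) ^+ 2) * jet 1 g r) /\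
  (exists2 c : R, 0 < c & forall f : R -> R, test_fun f ->
     c * rint (fun y => derive1 f y ^+ 2 / (1 + y) ^+ 2 + (y^-1 * f y) ^+ 2 / (1 + y))
       <= rdot (Htilde k f) (Lambda_psi psi 1 f)).

(* ** Morawetz functionals *)

(* dg stands for dot g. *)
Definition M0 (R : realType) (k : nat) (psi : R -> R) (delta lam : R)
    (g dg : R -> R) : R :=
  rdot (Aop k lam dg) (Lambda_psi psi lam (Aop k lam g))
  - delta * rdot (Aop k lam dg) (fun r => lam * (r + lam) ^- 2 * Aop k lam g r).

Definition Mor_sq (R : realType) (lam : R) (g : (R -> R) * (R -> R)) : R :=
  rint (fun r =>
    let y := r / lam in
    (derive1n 2 g.1 r ^+ 2 + jet_sq 1 g.2 r) / ((lam + r) * (1 + y))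
    + r ^- 2 * jet_sq 1 g.1 r / (lam + r)).

(* The coercivity property through which delta is chosen.  The two forms on
   dot H^2 are the continuous extensions from test functions. *)
Definition is_morawetz_constant (R : realType) (k : nat) (chi psi : R -> R)
    (delta : R) : Prop :=
  0 < delta /\
  exists c0 C0 : R, [/\ 0 < c0, 0 < C0 &
    forall (lam : R) (g : (R -> R) * (R -> R)), 0 < lam -> in_H2 g ->
    forall E1 E2 : R,
      extension_value (fun h =>
        M0 k psi delta lam h.1 (\- Hop k (scale lam (Q k)) h.1)) g E1 ->
      extension_value (fun h => M0 k psi delta lam h.2 h.2) g E2 ->
      c0 * Mor_sq lam g
        - C0 * (lam ^- 7 * rdot (scale lam (Zprofile k chi)) g.1 ^+ 2
                + lam ^- 5 * rdot (scale lam (Zprofile k chi)) g.2 ^+ 2)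
      <= - (E1 + E2)].

Definition Mform (R : realType) (k J : nat) (psi : R -> R) (delta delta0 : R)
    (lam : 'I_J -> R) (g dg : R -> R) : R :=
  \sum_(j < J) delta0 ^+ j * M0 k psi delta (lam j) g dg.

Definition Mor_multi_sq (R : realType) (J : nat) (delta0 : R) (lam : 'I_J -> R)
    (g : (R -> R) * (R -> R)) : R :=
  \sum_(j < J) delta0 ^+ j * Mor_sq (lam j) g.

Definition Mor_norm (R : realType) (J : nat) (delta0 : R) (lam : 'I_J -> R)
    (g : (R -> R) * (R -> R)) : R :=
  Num.sqrt (Mor_multi_sq delta0 lam g).

(* Main.v *)
Require Import Defs.
From HB Require Import structures.
From mathcomp Require Import all_boot all_order all_algebra.
From mathcomp Require Import all_classical all_reals all_analysis.
From mathcomp Require Import measurable_realfun ring lra.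

Set Implicit Arguments.
Unset Strict Implicit.
Unset Printing Implicit Defensive.

Import Order.TTheory GRing.Theory Num.Theory.
Import numFieldNormedType.Exports.

Local Open Scope classical_set_scope.
Local Open Scope ring_scope.

(* With v = A_lambda g, the form M_0[lambda; g, dg] is the integral of A_lambda dg
   against a multiplier psi v' + sigma v bounded by r / (lambda + r) |g|_{-2}.
   Boundedness and the estimate of the scale derivative are then weighted
   Cauchy-Schwarz inequalities.  Since A_lambda annihilates Lambda Q_lambda, a
   modulation vector at scale lambda_j only meets the forms at the scales
   lambda_i with i <> j; these terms gain sqrt alpha when lambda_j is the smaller
   scale, and otherwise one uses delta_0^i <= delta_0 delta_0^j.

   For the monotonicity, H_Q - H_{lambda_j} is multiplication by a potential
   controlled by the sum of the sin Q_{lambda_i}, i <> j.  On test functions its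
   contribution to the j-th form is therefore a small multiple of the Morawetz
   norm (with the same dichotomy between the scales), absorbed by the coercivity
   of the single-bubble forms.  After integration by parts these forms are
   integrals of densities quadratic in the jet, so they are Cauchy along test
   functions converging to g; this gives the extended values, and the inequality
   passes to the limit because the pairings with Z then tend to 0. *)

(** * Integrals against r dr *)

(** For [g] in the energy space, [A_lambda H g] involves third derivatives of [g], and the velocity
    form two derivatives of [dg], none of which the norm controls. The monotonicity therefore has no
    direct integral for [g]: every identity is proved for test functions and only estimates are
    carried to the limit. Parts 1, 3 and 4 concern [g] itself, but a locally absolutely continuous
    function has its derivative only almost everywhere, and [derive1] has default values elsewhere.
    Hence the explicit expressions in the jet ([dAop], [multiplier], [dist_density]), which agree
    with the true derivatives off a null set and obey pointwise bounds everywhere.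

    The interactions cost [delta0 + alpha * delta0 ^- J]: the first term comes from pairs without
    gain from the separation of scales, the second from pairs that gain [alpha] (its square root for
    modulation vectors) but have the powers of [delta0] in the wrong order. So [delta0] is made
    small first, by constants of the single-bubble problem, and [alpha_star] afterwards, of size
    [delta0 ^+ J]. The constant [c0] is halved by absorbing the interactions and once more in the
    limit. *)

Lemma eq_ge (R : realType) (x y : R) : x = y -> x <= y. Proof. by move=> ->. Qed.

Section RadialIntegral.
Variable R : realType.
Implicit Types f g u w : R -> R.

Local Notation mu := (@lebesgue_measure R).
Local Notation pos := (`]0%R, +oo[%classic : set R).

Lemma posP (r : R) : pos r <-> 0 < r.
Proof. by rewrite /= in_itv /= andbT. Qed.

Lemma in_posP (r : R) : (r \in pos) = (0 < r).
Proof. by apply/idP/idP; rewrite inE /= in_itv /= andbT. Qed.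

Definition pos_measurable f := measurable_fun pos f.

Lemma rint_eq f g : (forall r, 0 < r -> f r = g r) -> rint f = rint g.
Proof.
by move=> fg; apply: eq_Rintegral => r; rewrite in_posP => /fg ->.
Qed.

Lemma rintegrable_eq f g : (forall r, 0 < r -> f r = g r) ->
  rintegrable f -> rintegrable g.
Proof.
move=> fg; apply: eq_integrable => // r; rewrite in_posP => /fg -> //.
Qed.

Lemma rintegrable_dom f g : pos_measurable f ->
  (forall r, 0 < r -> `|f r| <= g r) -> rintegrable g -> rintegrable f.
Proof.
move=> mf fg; apply: le_integrable => //.
  by apply/measurable_EFinP/measurable_funM => //; exact: measurable_id.
move=> r /posP r0; rewrite /= !normrM lee_fin ler_pM2r ?normr_gt0 ?gt_eqF//.
by rewrite (le_trans (fg _ r0))// ler_norm.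
Qed.

Lemma rint_ge0 f : (forall r, 0 < r -> 0 <= f r) -> 0 <= rint f.
Proof.
by move=> f0; apply: Rintegral_ge0 => r /posP r0; rewrite mulr_ge0 ?f0// ltW.
Qed.

Lemma rint_le f g : rintegrable f -> rintegrable g ->
  (forall r, 0 < r -> f r <= g r) -> rint f <= rint g.
Proof.
move=> fi gi fg; apply: le_Rintegral => // r /posP r0.
by rewrite ler_pM2r// fg.
Qed.

Lemma rintegrableD f g : rintegrable f -> rintegrable g ->
  rintegrable (fun r => f r + g r).
Proof.
move=> fi gi; have h : measurable (pos : set (measurableTypeR R)) by exact: measurable_itv.
have := integrableD h fi gi.
by apply: eq_integrable => // r _ /=; rewrite -EFinD mulrDl.
Qed.

Lemma rintegrableZ (c : R) f : rintegrable f -> rintegrable (fun r => c * f r).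
Proof.
move=> fi; have h : measurable (pos : set (measurableTypeR R)) by exact: measurable_itv.
have := integrableZl h c fi.
by apply: eq_integrable => // r _ /=; rewrite -EFinM mulrA.
Qed.

Lemma rintegrableB f g : rintegrable f -> rintegrable g ->
  rintegrable (fun r => f r - g r).
Proof.
move=> fi /(rintegrableZ (-1)) gi; have := rintegrableD fi gi.
by apply: rintegrable_eq => r _; rewrite mulN1r.
Qed.

Lemma rintD f g : rintegrable f -> rintegrable g ->
  rint (fun r => f r + g r) = rint f + rint g.
Proof.
move=> fi gi; rewrite /rint -RintegralD//.
by apply: eq_Rintegral => r _; rewrite mulrDl.
Qed.

Lemma rintZ (c : R) f : rintegrable f -> rint (fun r => c * f r) = c * rint f.
Proof.
move=> fi; rewrite /rint -RintegralZl//.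
by apply: eq_Rintegral => r _; rewrite mulrA.
Qed.

Lemma rintB f g : rintegrable f -> rintegrable g ->
  rint (fun r => f r - g r) = rint f - rint g.
Proof.
move=> fi gi; rewrite /rint -RintegralB//.
by apply: eq_Rintegral => r _; rewrite mulrBl.
Qed.

Lemma rint0 : rint (fun=> 0 : R) = 0.
Proof. by rewrite /rint; under eq_Rintegral do rewrite mul0r; rewrite Rintegral_cst ?mul0r. Qed.

Lemma rintegrable0 : rintegrable (fun=> 0 : R).
Proof.
have := integrable0 mu (pos : set (measurableTypeR R)).
by apply: eq_integrable => // r _ /=; rewrite mul0r.
Qed.

Lemma rintegrable_sum (I : Type) (s : seq I) (P : pred I) (F : I -> R -> R) :
  (forall i, P i -> rintegrable (F i)) ->
  rintegrable (fun r => \sum_(i <- s | P i) F i r).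
Proof.
move=> Fi; elim: s => [|i s ih].
  by apply: rintegrable_eq rintegrable0 => r _; rewrite big_nil.
have [Pi|nPi] := boolP (P i).
  by have := rintegrableD (Fi _ Pi) ih; apply: rintegrable_eq => r _; rewrite big_cons Pi.
by move: ih; apply: rintegrable_eq => r _; rewrite big_cons (negbTE nPi).
Qed.

Lemma rint_sum (I : Type) (s : seq I) (P : pred I) (F : I -> R -> R) :
  (forall i, P i -> rintegrable (F i)) ->
  rint (fun r => \sum_(i <- s | P i) F i r) = \sum_(i <- s | P i) rint (F i).
Proof.
move=> Fi; elim: s => [|i s ih].
  by rewrite big_nil -[RHS]rint0; apply: rint_eq => r _; rewrite big_nil.
rewrite big_cons -ih; case: ifPn => Pi.
  rewrite -(rintD (Fi _ Pi) (rintegrable_sum s Fi)).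
  by apply: rint_eq => r _; rewrite big_cons Pi.
by apply: rint_eq => r _; rewrite big_cons (negbTE Pi).
Qed.

Lemma rint_norm_le f g : rintegrable f -> rintegrable g ->
  (forall r, 0 < r -> `|f r| <= g r) -> `|rint f| <= rint g.
Proof.
move=> fi gi fg; apply: (le_trans (le_normr_Rintegral _ _)) => //.
apply: le_Rintegral => //; first exact: integrable_norm.
by move=> r /posP r0; rewrite normrM (gtr0_norm r0) ler_pM2r// fg.
Qed.

Lemma amgm_param (x u w t : R) : 0 <= u -> 0 <= w -> 0 < t ->
  x ^+ 2 <= u * w -> `|x| <= t * u + t^-1 * w.
Proof.
move=> u0 w0 t0 xuw.
have s0 : 0 <= t * u + t^-1 * w.
  by rewrite addr_ge0// mulr_ge0// ltW// invr_gt0.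
rewrite -ler_sqr ?nnegrE// real_normK ?num_real//.
apply: (le_trans xuw).
have tt : t * t^-1 = 1 by rewrite divff ?gt_eqF.
rewrite [leRHS](_ : _ = (t * u) ^+ 2 + (t^-1 * w) ^+ 2 + (t * t^-1) * (2 * (u * w))); last by ring.
rewrite tt mul1r.
have : 0 <= u * w by exact: mulr_ge0.
have := sqr_ge0 (t * u); have := sqr_ge0 (t^-1 * w); lra.
Qed.

(* Cauchy-Schwarz, from the weighted inequality between arithmetic and
   geometric means with an optimised weight; the constant 4 is harmless. *)
Lemma rint_cauchy_schwarz f u w : rintegrable f -> rintegrable u ->
  rintegrable w -> (forall r, 0 < r -> 0 <= u r) -> (forall r, 0 < r -> 0 <= w r) ->
  (forall r, 0 < r -> f r ^+ 2 <= u r * w r) ->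
  rint f ^+ 2 <= 4 * (rint u * rint w).
Proof.
move=> fi ui wi u0 w0 fuw.
have U0 := rint_ge0 u0; have W0 := rint_ge0 w0.
have bnd t : 0 < t -> `|rint f| <= t * rint u + t^-1 * rint w.
  move=> t0; rewrite -!rintZ// -rintD; try exact: rintegrableZ.
  apply: rint_norm_le => //; first by apply: rintegrableD; exact: rintegrableZ.
  by move=> r r0; apply: amgm_param => //; [exact: u0|exact: w0|exact: fuw].
move: U0 W0 bnd; set U := rint u; set W := rint w; set x := rint f => U0 W0 bnd.
have [x0|x0] := eqVneq x 0.
  by rewrite x0 expr0n /= mulr_ge0// mulr_ge0.
have nx : 0 < `|x| by rewrite normr_gt0.
have x2 : x ^+ 2 = `|x| ^+ 2 by rewrite real_normK ?num_real.
move: U0; rewrite le_eqVlt => /predU1P[U00|U0].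
  (* When [U = 0], this weight makes the bound smaller than [|x| / 2], a contradiction. *)
  have t0 : 0 < 2 * (W + 1) / `|x| by rewrite divr_gt0// mulr_gt0// ltr_wpDl.
  have := bnd _ t0; rewrite -U00 mulr0 add0r invf_div mulrAC.
  rewrite ler_pdivlMr; last by rewrite mulr_gt0// ltr_wpDl.
  rewrite ler_pM2l// => ?; lra.
(* This weight turns [t * U] into [|x| / 2], which is absorbed on the left; the constant 4 arises
   here. *)
have t0 : 0 < `|x| / (2 * U) by rewrite divr_gt0// mulr_gt0.
have := bnd _ t0; rewrite invf_div.
have -> : `|x| / (2 * U) * U = `|x| / 2 by field; rewrite gt_eqF.
have -> : 2 * U / `|x| * W = (2 * U * W) / `|x| by ring.
move=> h; have : `|x| / 2 <= 2 * U * W / `|x| by lra.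
rewrite ler_pdivlMr// x2 => h2; rewrite expr2; lra.
Qed.

End RadialIntegral.

(** * Smooth functions and test functions *)

Section AlmostEverywhere.
Context d (T : measurableType d) (R : realType).
Variable mu : {measure set T -> \bar R}.
Local Open Scope ereal_scope.
Import HBNNSimple.

(* The library versions of these lemmas ask both functions to be measurable,
   which is inconvenient for junk values of derivatives on null sets. *)
Lemma ge0_le_integral_off_null (f g : T -> \bar R) (N : set T) :
  measurable N -> mu N = 0 ->
  (forall x, 0 <= f x) -> (forall x, 0 <= g x) ->
  (forall x, ~ N x -> f x <= g x) -> \int[mu]_x f x <= \int[mu]_x g x.
Proof.
move=> mN N0 f0 g0 fg; rewrite !ge0_integralTE//.
apply: ge_ereal_sup => _ [h /= hf <-].
have mNC : measurable (~` N) by exact: measurableC.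
(* Cutting the simple function off on [N] puts it below [g] everywhere and leaves its integral
   unchanged. *)
pose h' : {nnsfun T >-> R} := proj_nnsfun h mNC.
apply: ereal_sup_ubound; exists h' => /=.
  move=> x; rewrite /h' /= /proj_nnsfun /=.
  rewrite /mindic /= indicE in_setC.
  have [/set_mem xN|/negP xN] := boolP (x \in N); first by rewrite mulr0.
  rewrite mulr1 (le_trans (hf x))// fg// => /mem_set; exact: xN.
rewrite -!integralT_nnsfun; apply: ge0_ae_eq_integral => //.
- exact/measurable_EFinP.
- exact/measurable_EFinP.
- by move=> x _; rewrite lee_fin.
- by move=> x _; rewrite lee_fin.
exists N; split => // x /=; apply: contra_notP => xN _.
by rewrite /h' /= /mindic indicE in_setC memNset//= mulr1.
Qed.

Lemma integral_off_null (D N : set T) (f g : T -> \bar R) :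
  measurable N -> mu N = 0 -> (forall x, D x -> ~ N x -> f x = g x) ->
  \int[mu]_(x in D) f x = \int[mu]_(x in D) g x.
Proof.
move=> mN N0 fg.
have aux (u v : T -> \bar R) : (forall x, D x -> ~ N x -> u x = v x) ->
    (forall x, 0 <= u x) -> (forall x, 0 <= v x) ->
    \int[mu]_(x in D) u x = \int[mu]_(x in D) v x.
  move=> uv u0 v0; rewrite integral_mkcond [RHS]integral_mkcond.
  have uD x : 0 <= (u \_ D) x by rewrite patchE; case: ifP.
  have vD x : 0 <= (v \_ D) x by rewrite patchE; case: ifP.
  apply/eqP; rewrite eq_le; apply/andP; split;
    apply: (ge0_le_integral_off_null mN N0) => // x xN;
    rewrite !patchE; case: ifPn => // /set_mem xD; rewrite uv//.
rewrite integralE [RHS]integralE; congr (_ - _); apply: aux => // x Dx Nx.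
- by rewrite !funeposE fg.
- by rewrite !funenegE fg.
Qed.

End AlmostEverywhere.

Lemma rint_ae_eq (R : realType) (f g : R -> R) :
  {ae @lebesgue_measure R, forall r : R, 0 < r -> f r = g r} -> rint f = rint g.
Proof.
move=> [N [mN N0 fg]]; rewrite /rint /Rintegral; congr fine.
apply: (integral_off_null mN N0) => r /posP r0 Nr.
by congr EFin; congr (_ * _); apply: contrapT => h; apply: Nr; apply: fg => /= /(_ r0).
Qed.

(** * Calculus of smooth functions on the half-line *)

Section SmoothFunctions.
Variable R : realType.
Implicit Types (f g : R -> R) (n : nat).

Lemma near_pos (P : R -> Prop) (r : R) : 0 < r ->
  (forall s : R, 0 < s -> P s) -> \forall s \near r, P s.
Proof. by move=> r0 h; near=> s; apply: h; near: s; exact: lt_nbhsr. Unshelve. all: by end_near. Qed.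

Lemma is_derive_pos f g (r l : R) : 0 < r -> (forall s : R, 0 < s -> f s = g s) ->
  is_derive r (1 : R) f l -> is_derive r (1 : R) g l.
Proof. by move=> r0 fg; apply: near_eq_is_derive; exact: near_pos. Qed.

Lemma derivable_pos f g (r : R) : 0 < r -> (forall s : R, 0 < s -> f s = g s) ->
  derivable f r 1 -> derivable g r 1.
Proof. by move=> r0 fg; apply: near_eq_derivable; exact: near_pos. Qed.

Lemma derive1_pos f g (r : R) : 0 < r -> (forall s : R, 0 < s -> f s = g s) ->
  derive1 f r = derive1 g r.
Proof. by move=> r0 fg; rewrite !derive1E; apply: near_eq_derive; exact: near_pos. Qed.

Lemma derivable_is_derive1 f (r : R) : derivable f r 1 ->
  is_derive r (1 : R) f (derive1 f r).
Proof. by move=> h; rewrite derive1E; exact: derivableP. Qed.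

Lemma is_derive1E f (r l : R) : is_derive r (1 : R) f l -> derive1 f r = l.
Proof. by move=> h; rewrite derive1E derive_val. Qed.

Lemma is_derive_derivable f (r l : R) : is_derive r (1 : R) f l -> derivable f r 1.
Proof. by move=> h; exact: ex_derive. Qed.

(** Smoothness of finite order, by recursion on the derivative, so that product and chain rules go
    by induction on [n]. The count is shifted: [ndiff n] asks for [n + 1] derivatives, and [ndiff 0]
    already gives derivability. *)
Fixpoint ndiff n f : Prop :=
  (forall r : R, 0 < r -> derivable f r 1) /\
  (if n is m.+1 then ndiff m (derive1 f) else True).

Lemma ndiff0 n f : ndiff n f -> forall r : R, 0 < r -> derivable f r 1.
Proof. by case: n => [|n] []. Qed.

Lemma ndiff_eq n f g : (forall r : R, 0 < r -> f r = g r) -> ndiff n f -> ndiff n g.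
Proof.
elim: n f g => [|n ih] f g fg [df d2f]; split.
- by move=> r r0; apply: derivable_pos (df _ r0).
- by [].
- by move=> r r0; apply: derivable_pos (df _ r0).
- by apply: ih d2f => r r0; exact: derive1_pos.
Qed.

Lemma ndiffW n f : ndiff n.+1 f -> ndiff n f.
Proof. by elim: n f => [|n ih] f [df d2f]; split => //; apply: ih. Qed.

(** Replaces [derive1 f] by a closed formula, to which the closure lemmas of order [n] apply. *)
Lemma ndiffS n f g : (forall r : R, 0 < r -> is_derive r (1 : R) f (g r)) ->
  ndiff n g -> ndiff n.+1 f.
Proof.
move=> fg dg; split; first by move=> r /fg; exact: is_derive_derivable.
by apply: ndiff_eq dg => r r0; rewrite (is_derive1E (fg _ r0)).
Qed.

Lemma ndiff_is_derive n f (r : R) : ndiff n f -> 0 < r ->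
  is_derive r (1 : R) f (derive1 f r).
Proof. by move=> /ndiff0 df /df; exact: derivable_is_derive1. Qed.

Lemma smooth_posP f : smooth_pos f <-> forall n, ndiff n f.
Proof.
split=> [fs n|fn].
  elim: n f fs => [|n ih] f fs /=; split => //; [exact: (fs 0)|exact: (fs 0)|].
  apply: ih => m r r0; have := fs m.+1 r r0.
  by rewrite /derive1n iterSr.
move=> n; elim: n f fn => [|n ih] f fn r r0; first exact: (ndiff0 (fn 0)).
rewrite /derive1n iterSr; apply: ih => // m.
by have [] := fn m.+1.
Qed.

Lemma smooth_pos_derive1 f : smooth_pos f -> smooth_pos (derive1 f).
Proof.
move=> fs n r r0; have := fs n.+1 r r0; by rewrite /derive1n iterSr.
Qed.

Lemma smooth_pos_is_derive f (r : R) : smooth_pos f -> 0 < r ->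
  is_derive r (1 : R) f (derive1 f r).
Proof. by move=> fs r0; apply: derivable_is_derive1; exact: (fs 0). Qed.

Lemma smooth_pos_eq f g : (forall r : R, 0 < r -> f r = g r) ->
  smooth_pos f -> smooth_pos g.
Proof. by move=> fg /smooth_posP h; apply/smooth_posP => n; exact: ndiff_eq (h n). Qed.

Lemma ndiff_cst n (c : R) : ndiff n (fun=> c).
Proof.
elim: n c => [|n ih] c; first by split.
by apply: ndiffS (ih 0) => r _; exact: is_derive_cst.
Qed.

Lemma ndiffD n f g : ndiff n f -> ndiff n g -> ndiff n (fun r => f r + g r).
Proof.
elim: n f g => [|n ih] f g fn gn.
  by split => // r r0; apply: derivableD; [exact: ndiff0 fn _ r0|exact: ndiff0 gn _ r0].
refine (@ndiffS _ _ (fun r => derive1 f r + derive1 g r) _ _).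
  by move=> r r0; apply: is_deriveD; [exact: (ndiff_is_derive fn r0)|exact: (ndiff_is_derive gn r0)].
by apply: ih; [case: fn|case: gn].
Qed.

Lemma ndiffM n f g : ndiff n f -> ndiff n g -> ndiff n (fun r => f r * g r).
Proof.
elim: n f g => [|n ih] f g fn gn.
  by split => // r r0; apply: derivableM; [exact: ndiff0 fn _ r0|exact: ndiff0 gn _ r0].
refine (@ndiffS _ _ (fun r => f r * derive1 g r + g r * derive1 f r) _ _).
  move=> r r0; have h1 := ndiff_is_derive fn r0; have h2 := ndiff_is_derive gn r0.
  exact: is_deriveM.
by apply: ndiffD; apply: ih; try exact: ndiffW; [case: gn|case: fn].
Qed.

Lemma ndiffN n f : ndiff n f -> ndiff n (fun r => - f r).
Proof.
move=> fn; apply: ndiff_eq (ndiffM (ndiff_cst n (-1)) fn) => r _.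
by rewrite mulN1r.
Qed.

Lemma ndiffV n f : (forall r : R, 0 < r -> f r != 0) -> ndiff n f ->
  ndiff n (fun r => (f r)^-1).
Proof.
move=> f0; elim: n => [|n ih] fn.
  by split => // r r0; apply: derivableV; [exact: f0|exact: ndiff0 fn _ r0].
refine (@ndiffS _ _ (fun r => - ((f r)^-1 * (f r)^-1 * derive1 f r)) _ _).
  move=> r r0; have h1 := ndiff_is_derive fn r0.
  apply: is_derive_eq; first exact: is_deriveV (f0 _ r0) h1.
  by rewrite /GRing.scale /= -exprVn expr2 mulNr.
apply: ndiffN; apply: ndiffM; first by apply: ndiffM; apply: ih; exact: ndiffW.
by case: fn.
Qed.

Lemma ndiff_id n : ndiff n (@id R).
Proof.
case: n => [|n]; first by split.
by apply: ndiffS (ndiff_cst n 1) => r _; exact: is_derive_id.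
Qed.

Lemma is_derive_rescale f (lam r l : R) :
  is_derive (r / lam) (1 : R) f l -> is_derive r (1 : R) (fun s => f (s / lam)) (l / lam).
Proof.
move=> h; apply: (@is_derive1_comp _ f (fun s => s / lam) r l lam^-1 h).
by apply: is_derive_eq; rewrite /GRing.scale /= mulr0 add0r mulr1.
Qed.

Lemma ndiff_rescale n f (lam : R) : 0 < lam -> ndiff n f ->
  ndiff n (fun r => f (r / lam)).
Proof.
move=> l0; elim: n f => [|n ih] f fn.
  split => // r r0; have h := ndiff_is_derive fn (divr_gt0 r0 l0).
  exact: is_derive_derivable (is_derive_rescale h).
refine (@ndiffS _ _ (fun r => derive1 f (r / lam) * lam^-1) _ _).
  move=> r r0; apply: is_derive_rescale.
  exact: ndiff_is_derive fn (divr_gt0 r0 l0).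
by apply: ndiffM; [apply: ih; case: fn|exact: ndiff_cst].
Qed.

Lemma is_derive_cos_comp f (r l : R) : is_derive r (1 : R) f l ->
  is_derive r (1 : R) (fun s => cos (f s)) (- sin (f r) * l).
Proof. by move=> h; apply: is_derive1_comp. Qed.

Lemma is_derive_sin_comp f (r l : R) : is_derive r (1 : R) f l ->
  is_derive r (1 : R) (fun s => sin (f s)) (cos (f r) * l).
Proof. by move=> h; apply: is_derive1_comp. Qed.

(** Both functions are treated at once because each is the derivative of the other up to sign. *)
Lemma ndiff_cos_sin n f : ndiff n f ->
  ndiff n (fun r => cos (f r)) /\ ndiff n (fun r => sin (f r)).
Proof.
elim: n f => [|n ih] f fn.
  split; split=> // r r0; have h := ndiff_is_derive fn r0.
    exact: is_derive_derivable (is_derive_cos_comp h).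
  exact: is_derive_derivable (is_derive_sin_comp h).
have [hc hs] := ih f (ndiffW fn).
have f'n : ndiff n (derive1 f) by case: fn.
split.
  refine (ndiffS (g := fun r => - sin (f r) * derive1 f r) _ _).
    by move=> r r0; apply: is_derive_cos_comp; exact: (ndiff_is_derive fn r0).
  by apply: ndiffM => //; exact: ndiffN.
refine (ndiffS (g := fun r => cos (f r) * derive1 f r) _ _).
  by move=> r r0; apply: is_derive_sin_comp; exact: (ndiff_is_derive fn r0).
exact: ndiffM.
Qed.

Lemma smooth_pos_cst (c : R) : smooth_pos (fun=> c).
Proof. by apply/smooth_posP => n; exact: ndiff_cst. Qed.

Lemma smooth_pos_id : smooth_pos (fun r : R => r).
Proof. by apply/smooth_posP => n; exact: ndiff_id. Qed.

Lemma smooth_posD f g : smooth_pos f -> smooth_pos g -> smooth_pos (fun r => f r + g r).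
Proof. by move=> /smooth_posP fs /smooth_posP gs; apply/smooth_posP => n; exact: ndiffD. Qed.

Lemma smooth_posN f : smooth_pos f -> smooth_pos (fun r => - f r).
Proof. by move=> /smooth_posP fs; apply/smooth_posP => n; exact: ndiffN. Qed.

Lemma smooth_posM f g : smooth_pos f -> smooth_pos g -> smooth_pos (fun r => f r * g r).
Proof. by move=> /smooth_posP fs /smooth_posP gs; apply/smooth_posP => n; exact: ndiffM. Qed.

Lemma smooth_posX f n : smooth_pos f -> smooth_pos (fun r => f r ^+ n).
Proof.
move=> fs; elim: n => [|n ih]; first exact: smooth_pos_cst.
by apply: smooth_pos_eq (smooth_posM fs ih) => r _; rewrite exprS.
Qed.

Lemma smooth_posV f : (forall r : R, 0 < r -> f r != 0) -> smooth_pos f ->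
  smooth_pos (fun r => (f r)^-1).
Proof. by move=> f0 /smooth_posP fs; apply/smooth_posP => n; exact: ndiffV. Qed.

Lemma smooth_pos_inv : smooth_pos (fun r : R => r^-1).
Proof. by apply: smooth_posV smooth_pos_id => r; exact: lt0r_neq0. Qed.

Lemma smooth_pos_rescale f (lam : R) : 0 < lam -> smooth_pos f ->
  smooth_pos (fun r => f (r / lam)).
Proof. by move=> l0 /smooth_posP fs; apply/smooth_posP => n; exact: ndiff_rescale. Qed.

Lemma smooth_pos_cos f : smooth_pos f -> smooth_pos (fun r => cos (f r)).
Proof. by move=> /smooth_posP fs; apply/smooth_posP => n; have [] := ndiff_cos_sin (fs n). Qed.

Lemma smooth_pos_sum (I : Type) (s : seq I) (P : pred I) (F : I -> R -> R) :
  (forall i, P i -> smooth_pos (F i)) -> smooth_pos (fun r => \sum_(i <- s | P i) F i r).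
Proof.
move=> Fi; elim: s => [|i s ih].
  by apply: (smooth_pos_eq _ (@smooth_pos_cst 0)) => r _; rewrite big_nil.
case Pi : (P i).
  by apply: (smooth_pos_eq _ (smooth_posD (Fi _ Pi) ih)) => r _; rewrite big_cons Pi.
by apply: (smooth_pos_eq _ ih) => r _; rewrite big_cons Pi.
Qed.

Lemma derivable_pos_measurable f : (forall r : R, 0 < r -> derivable f r 1) ->
  pos_measurable f.
Proof.
move=> df; apply: open_continuous_measurable_fun; first exact: interval_open.
by move=> r; rewrite in_posP => /df /derivable1_diffP; exact: differentiable_continuous.
Qed.

Lemma smooth_pos_measurable f : smooth_pos f -> pos_measurable f.
Proof. by move=> fs; apply: derivable_pos_measurable => r; exact: (fs 0). Qed.

End SmoothFunctions.

(** * Test functions and the fundamental theorem of calculus *)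

Section TestFunctions.
Variable R : realType.
Implicit Types f g u : R -> R.
Local Notation mu := (@lebesgue_measure R).
Local Notation pos := (`]0%R, +oo[%classic : set R).

Lemma test_fun_eq f g : (forall r : R, 0 < r -> f r = g r) -> test_fun f -> test_fun g.
Proof.
move=> fg [fs [a [b [a0 ab f0]]]]; split; first exact: smooth_pos_eq fs.
by exists a, b; split => // r r0 rab; rewrite -fg// f0.
Qed.

Lemma test_funD f g : test_fun f -> test_fun g -> test_fun (fun r => f r + g r).
Proof.
move=> [fs [a [b [a0 ab f0]]]] [gs [c [d [c0 cd g0]]]]; split.
  exact: smooth_posD.
exists (Num.min a c), (Num.max b d); split.
- by rewrite lt_min a0.
- by rewrite gt_min !lt_max ab.
- move=> r r0; rewrite lt_min gt_max => h.
  rewrite f0// ?g0 ?addr0//; by case: h => /andP[? ?]; [left|right].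
Qed.

Lemma test_funMr f g : test_fun f -> smooth_pos g -> test_fun (fun r => f r * g r).
Proof.
move=> [fs [a [b [a0 ab f0]]]] gs; split; first exact: smooth_posM.
by exists a, b; split => // r r0 rab; rewrite f0// mul0r.
Qed.

Lemma test_funMl f g : smooth_pos f -> test_fun g -> test_fun (fun r => f r * g r).
Proof. by move=> fs gt; apply: test_fun_eq (test_funMr gt fs) => r _; rewrite mulrC. Qed.

Lemma test_funN f : test_fun f -> test_fun (fun r => - f r).
Proof.
move=> ft; apply: test_fun_eq (test_funMl (@smooth_pos_cst R (-1)) ft) => r _.
by rewrite mulN1r.
Qed.

Lemma test_fun_derive1 f : test_fun f -> test_fun (derive1 f).
Proof.
move=> [fs [a [b [a0 ab f0]]]]; split; first exact: smooth_pos_derive1.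
exists a, b; split => // r r0 rab.
suff h : is_derive r (1 : R) f 0 by exact: is_derive1E h.
apply: (@near_eq_is_derive R R R (cst 0) f r 1 0).
case: rab => [ra|br].
  near=> s; rewrite /cst f0//; first by near: s; exact: lt_nbhsr.
  by left; near: s; exact: lt_nbhsl.
near=> s; rewrite /cst f0//; first by near: s; exact: lt_nbhsr.
by right; near: s; exact: lt_nbhsr.
Unshelve. all: by end_near. Qed.

Lemma test_fun_is_derive f (r : R) : test_fun f -> 0 < r ->
  is_derive r (1 : R) f (derive1 f r).
Proof. by move=> [fs _]; exact: smooth_pos_is_derive. Qed.

Lemma smooth_pos_within f (a b : R) : smooth_pos f -> 0 < a ->
  {within `[a, b], continuous f}.
Proof.
move=> fs a0; apply: derivable_within_continuous => r.
by rewrite in_itv /= => /andP[ar _]; apply: (fs 0); exact: lt_le_trans ar.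
Qed.

Lemma smooth_pos_itv_integrable f (a b : R) : smooth_pos f -> 0 < a ->
  mu.-integrable `[a, b] (EFin \o f).
Proof.
move=> fs a0; apply: continuous_compact_integrable; first exact: segment_compact.
exact: smooth_pos_within.
Qed.

Lemma pos_itv_restrict f (a b : R) : 0 < a ->
  (forall r : R, 0 < r -> r < a \/ b < r -> f r = 0) ->
  (EFin \o f) \_ pos = (EFin \o f) \_ `[a, b].
Proof.
move=> a0 f0; apply/funext => r; rewrite !patchE in_posP.
have [r0|r0] := ltP 0 r.
  have [rab|/negP] := boolP (r \in `[a, b]%classic); first by [].
  rewrite inE /= in_itv /= => /negP; rewrite negb_and -!ltNge => /orP h.
  by rewrite /= f0.
case: ifPn => //; rewrite inE /= in_itv /= => /andP[ar _].
by move: (lt_le_trans a0 ar); rewrite ltNge r0.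
Qed.

Lemma test_fun_pos_integrable f : test_fun f -> mu.-integrable pos (EFin \o f).
Proof.
move=> [fs [a [b [a0 ab f0]]]].
have mp : measurable (pos : set (measurableTypeR R)) by exact: measurable_itv.
have mi : measurable (`[a, b]%classic : set (measurableTypeR R)) by exact: measurable_itv.
apply/(integrable_mkcond _ mp); rewrite (pos_itv_restrict a0 f0).
by apply/(integrable_mkcond _ mi); exact: smooth_pos_itv_integrable.
Qed.

Lemma test_fun_rintegrable f : test_fun f -> rintegrable f.
Proof.
by move=> ft; exact: (test_fun_pos_integrable (test_funMr ft (@smooth_pos_id R))).
Qed.

Lemma smooth_pos_FTC f (a b : R) : smooth_pos f -> 0 < a -> a < b ->
  (\int[mu]_(r in `[a, b]) (derive1 f r)%:E = (f b - f a)%:E)%E.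
Proof.
move=> fs a0 ab.
rewrite (@continuous_FTC2 _ (derive1 f) f a b ab) ?EFinB//.
  exact: smooth_pos_within (smooth_pos_derive1 fs) a0.
by have /continuous_within_itvP-/(_ ab)[? ? ?] := @smooth_pos_within f a b fs a0;
  split => // r; rewrite in_itv /= => /andP[ar _]; apply: (fs 0); exact: lt_trans ar.
Qed.

(** The division cancels the factor [r] of the measure and leaves the integral of an exact
    derivative. All integrations by parts rest on this identity. *)
Lemma test_fun_rint_derive1 f : test_fun f -> rint (fun r => derive1 f r / r) = 0.
Proof.
move=> ft; have [_ [c [d [c0 cd f'0]]]] := test_fun_derive1 ft.
case: ft => fs [a [b [a0 ab f0]]].
(* The segment extends strictly beyond the supports of both [f] and [derive1 f], so that [f]
   vanishes at its end points. *)
pose A := Num.min a c / 2; pose B := Num.max b d + 1.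
have m0 : 0 < Num.min a c by rewrite lt_min a0.
have A0 : 0 < A by rewrite divr_gt0.
have Am : A < Num.min a c by rewrite ltr_pdivrMr// ltr_pMr// ltr1n.
have mB : Num.max b d < B by rewrite ltrDl.
have [Aa Ac] : A < a /\ A < c by move: Am; rewrite lt_min => /andP.
have [bB dB] : b < B /\ d < B by move: mB; rewrite gt_max => /andP.
have AB : A < B by rewrite (lt_trans Aa)// (lt_trans ab).
have out r : 0 < r -> r < A \/ B < r -> derive1 f r = 0.
  move=> r0 rAB; apply: f'0 => //; case: rAB => [rA|Br].
    by left; exact: lt_trans Ac.
  by right; exact: lt_trans Br.
rewrite /rint (_ : Rintegral _ _ _ = Rintegral mu pos (derive1 f)); last first.
  by apply: eq_Rintegral => r; rewrite in_posP => r0; rewrite divfK// gt_eqF.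
rewrite /Rintegral integral_mkcond (pos_itv_restrict A0 out) -integral_mkcond.
rewrite smooth_pos_FTC//= (f0 B) ?(f0 A) ?subrr//; [by left|exact: lt_trans AB|by right].
Qed.

Lemma smooth_pos_loc_abs_continuous f : smooth_pos f -> loc_abs_continuous f.
Proof.
move=> fs a b a0 ab; split.
  exact: smooth_pos_itv_integrable (smooth_pos_derive1 fs) a0.
by rewrite /Rintegral smooth_pos_FTC.
Qed.

(** With the factor [r] of the measure the integrand is the derivative of [- (lam + r)^-1]. This
    weight is the second factor in the Cauchy-Schwarz inequality for modulation vectors, and its
    mass is the origin of the power [lam_j^(-1/2)] there. *)
Lemma rint_weight (lam : R) : 0 < lam ->
  rintegrable (fun r => (r * (lam + r) ^+ 2)^-1) /\
  rint (fun r => (r * (lam + r) ^+ 2)^-1) = lam^-1.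
Proof.
move=> l0; pose f r : R := (lam + r) ^- 2; pose F r : R := - (lam + r)^-1.
have fE r : 0 < r -> (r * (lam + r) ^+ 2)^-1 * r = f r.
  by move=> r0; rewrite invfM mulrAC mulVf ?mul1r// gt_eqF.
have lr r : 0 <= r -> 0 < lam + r by move=> r0; rewrite ltr_pwDl.
have dF r : - lam < r -> is_derive r 1 F (f r).
  move=> r0; have h : lam + r != 0 by rewrite gt_eqF// -ltrBlDl sub0r.
  apply: is_derive_eq.
  by rewrite /GRing.scale /= add0r mulr1 opprK.
have cf r : - lam < r -> {for r, continuous f}.
  move=> r0; have h : lam + r != 0 by rewrite gt_eqF// -ltrBlDl sub0r.
  apply: differentiable_continuous; apply/derivable1_diffP.
  by apply: derivableV => //; rewrite expf_neq0.
have I : (\int[mu]_(r in `[0%R, +oo[) (f r)%:E = 0%:E - (F 0%R)%:E)%E.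
  apply: ge0_continuous_FTC2y.
  - by move=> r r0; rewrite /f invr_ge0 exprn_ge0// ltW// lr.
  - apply/continuous_within_itvcyP; split.
      move=> r; rewrite in_itv /= andbT => r0; apply: cf.
      by rewrite (lt_trans _ r0)// oppr_lt0.
    apply: cvg_at_right_filter; apply: cf; by rewrite oppr_lt0.
  - rewrite -[X in _ --> X]oppr0; apply: cvgN.
    have lpos : \forall x \near +oo%R, 0 < lam + x.
      by near=> x; apply: lr; near: x; apply: nbhs_pinfty_ge; exact: num_real.
    apply/(gtr0_cvgV0 (f := fun x => lam + x) lpos)/cvgryPge => A; near=> x.
    have : A <= x by near: x; apply: nbhs_pinfty_ge; exact: num_real.
    by move=> /le_trans; apply; rewrite lerDr ltW.
  - by move=> x x0; apply: is_derive_derivable (dF _ _); rewrite (lt_trans _ x0)// oppr_lt0.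
  - apply: cvg_at_right_filter; apply: differentiable_continuous; apply/derivable1_diffP.
    by apply: is_derive_derivable (dF _ _); rewrite oppr_lt0.
  - move=> x; rewrite in_itv /= andbT => x0; apply: is_derive1E; apply: dF.
    by rewrite (lt_trans _ x0)// oppr_lt0.
have mf : pos_measurable f.
  apply: open_continuous_measurable_fun; first exact: interval_open.
  by move=> r; rewrite in_posP => r0; apply: cf; rewrite (lt_trans _ r0)// oppr_lt0.
have I' : (\int[mu]_(r in pos) (f r)%:E = (lam^-1)%:E)%E.
  rewrite (integral_itv_obnd_cbnd) ?I; last by apply/measurable_EFinP.
  by rewrite -EFinB /F sub0r opprK addr0.
have fi : rintegrable (fun r => (r * (lam + r) ^+ 2)^-1).
  rewrite /rintegrable; apply: (@eq_integrable _ _ _ mu _ _ (EFin \o f)) => //.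
    by move=> r; rewrite in_posP => r0 /=; rewrite fE.
  apply/integrableP; split; first exact/measurable_EFinP.
  rewrite (_ : integral _ _ _ = (lam^-1)%:E) ?ltry// -I'.
  apply: eq_integral => r; rewrite in_posP => r0 /=.
  by rewrite ger0_norm// /f invr_ge0 exprn_ge0// ltW// lr// ltW.
split=> //; rewrite /rint /Rintegral.
rewrite (_ : integral _ _ _ = (lam^-1)%:E)// -I'.
by apply: eq_integral => r; rewrite in_posP => r0; rewrite fE.
Unshelve. all: by end_near. Qed.

End TestFunctions.

(** * Locally absolutely continuous functions *)

Section LocallyAbsolutelyContinuous.
Variable R : realType.
Implicit Types f : R -> R.
Local Notation mu := (@lebesgue_measure R).
Local Notation pos := (`]0%R, +oo[%classic : set R).

Lemma lac_primitive f (a x b : R) : loc_abs_continuous f -> 0 < a -> a < x -> x < b ->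
  {near x, (fun y => f a + parameterized_integral mu a y (derive1 f)) =1 f}.
Proof.
move=> fac a0 ax xb; near=> y.
have ay : a < y by near: y; exact: lt_nbhsr.
have [_ h] := fac a y a0 ay.
by rewrite /parameterized_integral -h addrC subrK.
Unshelve. all: by end_near. Qed.

Lemma lac_continuous f (r : R) : loc_abs_continuous f -> 0 < r -> {for r, continuous f}.
Proof.
move=> fac r0; have r20 : 0 < r / 2 by rewrite divr_gt0.
have r2r : r / 2 < r by rewrite ltr_pdivrMr// ltr_pMr// ltr1n.
have rr2 : r < r * 2 by rewrite ltr_pMr// ltr1n.
have [fi _] := fac (r / 2) (r * 2) r20 (lt_trans r2r rr2).
have /= := parameterized_integral_continuous (ltW (lt_trans r2r rr2)) fi.
move=> /(continuous_within_itvP _ (lt_trans r2r rr2))[h _ _].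
have {}h := h r; rewrite in_itv /= r2r rr2 in h; have {}h := h isT.
have h2 : {for r, continuous (fun y => f (r / 2) + parameterized_integral mu (r / 2) y (derive1 f))}.
  by apply: cvgD => //; exact: cvg_cst.
rewrite /prop_for /continuous_at in h2 *.
have nf := lac_primitive fac r20 r2r rr2.
rewrite -[X in _ --> X](nbhs_singleton nf); apply: cvg_trans h2.
by exact: near_eq_cvg nf.
Qed.

(** The derivative is continuous by the second hypothesis, so the primitive is derivable at every
    point and not merely at almost every one. *)
Lemma lac_derivable f (r : R) : loc_abs_continuous f ->
  loc_abs_continuous (derive1 f) -> 0 < r -> derivable f r 1.
Proof.
move=> fac f'ac r0; have r20 : 0 < r / 2 by rewrite divr_gt0.
have r2r : r / 2 < r by rewrite ltr_pdivrMr// ltr_pMr// ltr1n.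
have rr2 : r < r * 2 by rewrite ltr_pMr// ltr1n.
have [fi _] := fac (r / 2) (r * 2) r20 (lt_trans r2r rr2).
have [dF _] := continuous_FTC1_closed rr2 fi r2r (lac_continuous f'ac r0).
apply: near_eq_derivable (lac_primitive fac r20 r2r rr2) _.
exact: (derivableD (derivable_cst (f (r / 2)) r 1) dF).
Qed.

Let exhaust n : set R := `[n.+1%:R^-1, n.+1%:R].

Let exhaustE : pos = \bigcup_n exhaust n.
Proof.
apply/seteqP; split => r /=.
  rewrite in_itv /= andbT => r0.
  exists (Num.truncn (Num.max r r^-1)) => //=; rewrite /exhaust /= in_itv /=.
  have h := truncnS_gt (Num.max r r^-1); rewrite gt_max in h.
  have /andP[h1 h2] := h.
  rewrite (ltW h1) andbT -[leRHS]invrK lef_pV2 ?posrE ?invr_gt0//; first exact: ltW.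
move=> [n _]; rewrite /exhaust /= !in_itv /= => /andP[h _]; rewrite andbT.
by apply: lt_le_trans h; rewrite invr_gt0.
Qed.

Lemma lac_measurable_derive1 f : loc_abs_continuous f -> pos_measurable (derive1 f).
Proof.
move=> fac; rewrite /pos_measurable exhaustE.
apply/measurable_fun_bigcup => [n|n]; first exact: measurable_itv.
have n0 : (0 : R) < n.+1%:R^-1 by rewrite invr_gt0.
(* For [n = 0] the segment degenerates to the point 1, where the hypothesis on [f] says nothing. *)
case: n n0 => [|n] n0; first by rewrite /exhaust invr1 set_itv1; exact: measurable_fun_set1.
have [|fi _] := fac _ n.+2%:R n0.
  by rewrite (@lt_trans _ _ 1)// ?invf_lt1 ?ltr1n.
by move/integrableP : fi => [/measurable_EFinP].
Qed.

Lemma lac_measurable f : loc_abs_continuous f -> pos_measurable f.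
Proof.
move=> fac; apply: open_continuous_measurable_fun; first exact: interval_open.
by move=> r; rewrite in_posP; exact: lac_continuous.
Qed.

(** Near a Lebesgue point of the derivative cut off to a segment, [f] is a constant plus the
    primitive of that cut-off function, hence derivable there. Countably many segments cover the
    half-line. *)
Lemma lac_derivable_ae f : loc_abs_continuous f ->
  {ae mu, forall r, 0 < r -> derivable f r 1}.
Proof.
move=> fac.
(* Shifted by one from [exhaust], so that each closed segment of the exhaustion lies in the open
   interval []a n, b n[]. *)
pose a n : R := n.+2%:R^-1; pose b n : R := n.+2%:R.
have a0 n : 0 < a n by rewrite invr_gt0.
have ab n : a n < b n by rewrite (@lt_trans _ _ 1)// ?invf_lt1 ?ltr1n.
pose g n := derive1 f \_ `[a n, b n].
have fi n := (fac (a n) (b n) (a0 n) (ab n)).1.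
have key n : {ae mu, forall r, r \in `]a n, b n[ -> derivable f r 1}.
  have loc : locally_integrable setT (g n).
    by apply: integrable_locally (fi n); exact: measurable_itv.
  have := lebesgue_differentiation loc; apply: filterS; first exact: (ae_filter_ringOfSetsType mu).
  move=> r rg.
  rewrite in_itv /= => /andP[ar rb].
  have gi : mu.-integrable `[a n, b n] (EFin \o g n).
    rewrite /g -restrict_EFin; apply/integrable_restrict => //=; rewrite setIid; exact: fi.
  have [|dF _] := @FTC1_lebesgue_pt R (g n) (BLeft (a n)) r (b n) rb gi _ rg.
    by rewrite lte_fin.
  apply: near_eq_derivable (derivableD (derivable_cst (f (a n)) r 1) dF).
  near=> y; have ay : a n < y by near: y; exact: lt_nbhsr.
  have yb : y < b n by near: y; exact: lt_nbhsl.
  rewrite /GRing.add /=.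
  have [_ h] := fac (a n) y (a0 n) ay; rewrite -[RHS](subrK (f (a n))) h addrC; congr (_ + _).
  apply: eq_Rintegral => z; rewrite inE /= in_itv /= => /andP[az zy].
  by rewrite /g patchE ifT// inE /= in_itv /= az (le_trans zy)// ltW.
have := ae_foralln key; apply: filterS.
move=> r h r0; have : pos r by apply/posP.
rewrite exhaustE => -[n _]; rewrite /exhaust /= in_itv /= => /andP[h1 h2].
apply: (h n); rewrite in_itv /= (lt_le_trans _ h1) ?(le_lt_trans h2) ?ltr_nat//.
by rewrite ltf_pV2 ?posrE// ltr_nat.
Unshelve. all: by end_near. Qed.

End LocallyAbsolutelyContinuous.

(** * The profile *)

Section NormBounds.
Variable R : realType.
Implicit Types x y a b c : R.

Lemma normD_le x y a b : `|x| <= a -> `|y| <= b -> `|x + y| <= a + b.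
Proof. by move=> xa yb; apply: le_trans (ler_normD _ _) _; exact: lerD. Qed.

Lemma normB_le x y a b : `|x| <= a -> `|y| <= b -> `|x - y| <= a + b.
Proof. by move=> xa yb; apply: normD_le; rewrite ?normrN. Qed.

Lemma normM_le x y a b : `|x| <= a -> `|y| <= b -> `|x * y| <= a * b.
Proof. by move=> xa yb; rewrite normrM; exact: ler_pM. Qed.

Lemma normN_le x a : `|x| <= a -> `|- x| <= a.
Proof. by rewrite normrN. Qed.

Lemma norm_sqr_le x a : `|x| <= a -> x ^+ 2 <= a ^+ 2.
Proof.
move=> xa; have a0 : 0 <= a := le_trans (normr_ge0 x) xa.
by rewrite -[x ^+ 2]real_normK ?num_real// ler_sqr ?nnegrE.
Qed.

End NormBounds.

Section Profile.
Variable R : realType.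
Variable k : nat.
Implicit Types lam r y : R.

Definition cosQ lam r : R := cos (Q k (r / lam)).
Definition sinQ lam r : R := sin (Q k (r / lam)).

Lemma sinQ_rational lam r :
  sinQ lam r = 2 * (r / lam) ^+ k / (1 + (r / lam) ^+ k ^+ 2).
Proof.
set x := (r / lam) ^+ k.
have x1 : 0 < 1 + x ^+ 2 by rewrite ltr_pwDl// sqr_ge0.
have c0 : cos (atan x) != 0.
  by rewrite cos_atan invr_neq0// gt_eqF// sqrtr_gt0.
have sE : sin (atan x) = x * cos (atan x).
  by rewrite -{2}[x]atanK /tan divfK.
rewrite /sinQ /Q -/x mulr_natl sin_mulr2n sE.
rewrite (_ : _ *+ 2 = 2 * x * cos (atan x) ^+ 2); last by rewrite -mulr_natl; ring.
by rewrite cos_atan exprVn sqr_sqrtr ?(ltW x1).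
Qed.

Lemma cosQ_sqr lam r : cosQ lam r ^+ 2 = 1 - sinQ lam r ^+ 2.
Proof. by rewrite /cosQ /sinQ cos2sin2. Qed.

Lemma norm_cosQ lam r : `|cosQ lam r| <= 1.
Proof. by rewrite ler_norml cos_geN1 cos_le1. Qed.

Lemma norm_sinQ lam r : `|sinQ lam r| <= 1.
Proof. by rewrite ler_norml sin_geN1 sin_le1. Qed.

Lemma sinQ_ge0 lam r : 0 < lam -> 0 < r -> 0 <= sinQ lam r.
Proof.
move=> l0 r0; rewrite sinQ_rational divr_ge0 ?mulr_ge0 ?exprn_ge0 ?divr_ge0 ?ltW//.
by rewrite ltr_pwDl// sqr_ge0.
Qed.

Hypothesis hk : (2 <= k)%N.

(** With [x = y ^+ k], the assumption [2 <= k] gives [x <= y ^+ 2] for [y <= 1] and [y ^+ 2 <= x]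
    for [y > 1]: the profile is at least as concentrated at its scale as the one with [k = 2]. The
    constant is 2 times 16, from [(1 + y) ^+ 4 <= 16 * max(1, y) ^+ 4]. *)
Lemma sinQ_le lam r : 0 < lam -> 0 < r ->
  sinQ lam r <= 32 * (r ^+ 2 * lam ^+ 2 / (lam + r) ^+ 4).
Proof.
move=> l0 r0; rewrite sinQ_rational; set y := r / lam.
have y0 : 0 < y by rewrite divr_gt0.
have -> : r ^+ 2 * lam ^+ 2 / (lam + r) ^+ 4 = y ^+ 2 / (1 + y) ^+ 4.
  by rewrite /y; field; rewrite !gt_eqF ?addr_gt0.
have y1 : 0 < (1 + y) ^+ 4 by rewrite exprn_gt0// addr_gt0.
have x0 : 0 < y ^+ k by rewrite exprn_gt0.
have x1 : 0 < 1 + y ^+ k ^+ 2 by rewrite ltr_pwDl// sqr_ge0.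
rewrite ler_pdivrMr//; set x := y ^+ k in x0 x1 *.
rewrite -[leRHS]mulrA mulrAC mulrA ler_pdivlMr//.
have [yle|ygt] := leP y 1.
  have xy : x <= y ^+ 2 by rewrite /x -(subnK hk) exprD ler_piMl ?exprn_ge0 ?exprn_ile1// ltW.
  have h4 : (1 + y) ^+ 4 <= 16.
    rewrite (_ : 16 = (1 + 1) ^+ 4); last by ring.
    by rewrite lerXn2r ?nnegrE ?addr_ge0 ?lerD2l// ltW.
  apply: (@le_trans _ _ (2 * y ^+ 2 * 16)).
    by apply: ler_pM => //; [rewrite mulr_ge0// ltW|exact: ltW|rewrite ler_pM2l].
  have : 0 <= y ^+ 2 * x ^+ 2 by rewrite mulr_ge0// exprn_ge0 ?ltW.
  lra.
have xy : y ^+ 2 <= x by rewrite /x -(subnK hk) exprD ler_peMl ?exprn_ge0 ?exprn_ege1// ltW.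
have h4 : (1 + y) ^+ 4 <= 16 * y ^+ 4.
  rewrite (_ : 16 * y ^+ 4 = (y + y) ^+ 4); last by ring.
  by rewrite lerXn2r ?nnegrE ?addr_ge0 ?lerD2r// ltW.
apply: (@le_trans _ _ (2 * x * (16 * y ^+ 4))).
  by rewrite ler_pM2l// mulr_gt0.
have e4 : y ^+ 4 = y ^+ 2 * y ^+ 2 by ring.
have y20 : 0 < y ^+ 2 by rewrite exprn_gt0.
have : x * (y ^+ 2 * y ^+ 2) <= x * (y ^+ 2 * x).
  by rewrite ler_pM2l// ler_pM2l.
rewrite e4 => ?; lra.
Qed.

Lemma is_derive_pow (n : nat) y :
  is_derive y (1 : R) (fun x : R => x ^+ n) (n%:R * y ^+ n.-1).
Proof.
elim: n => [|n ih]; first by rewrite mul0r; exact: is_derive_cst.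
rewrite (_ : (fun x : R => x ^+ n.+1) = id * (fun x => x ^+ n)); last first.
  by apply/funext => x; rewrite exprS.
apply: is_derive_eq (is_deriveM (is_derive_id y 1) ih) _.
rewrite /GRing.scale /= mulr1 -natr1 mulrDl mul1r mulrCA; congr (_ + _).
by case: n {ih} => [|n]; rewrite ?mul0r//= exprS.
Qed.

(** The first-order equation [r Q' = k sin Q] of the harmonic map. It keeps all derivatives of the
    profile, in [r] and in the scale, polynomial in [sinQ] and [cosQ]. *)
Lemma is_derive_Q y : 0 < y -> is_derive y (1 : R) (Q k) (k%:R * sin (Q k y) / y).
Proof.
move=> y0; have := sinQ_rational 1 y; rewrite /sinQ divr1 => ->.
have x1 : 1 + y ^+ k ^+ 2 != 0 by rewrite gt_eqF// ltr_pwDl// sqr_ge0.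
have h : is_derive y (1 : R) (fun y : R => atan (y ^+ k)) ((1 + y ^+ k ^+ 2)^-1 * (k%:R * y ^+ k.-1)).
  exact: (@is_derive1_comp _ atan (fun x => x ^+ k) y _ _ (is_derive1_atan (y ^+ k)) (is_derive_pow k y)).
apply: is_derive_eq; rewrite /GRing.scale /=.
have yk : y ^+ k = y * y ^+ k.-1 by rewrite -exprS prednK// (leq_trans _ hk).
by rewrite yk in x1 *; field; rewrite x1 gt_eqF.
Qed.

Lemma is_derive_Q_rescale lam r : 0 < lam -> 0 < r ->
  is_derive r (1 : R) (fun s => Q k (s / lam)) (k%:R * sinQ lam r / r).
Proof.
move=> l0 r0; have h := is_derive_rescale (is_derive_Q (divr_gt0 r0 l0)).
apply: (is_derive_eq h).
rewrite /sinQ; field; by rewrite !gt_eqF.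
Qed.

Lemma is_derive_Q_scale lam r : 0 < lam -> 0 < r ->
  is_derive lam (1 : R) (fun l => Q k (r / l)) (- (k%:R * sinQ lam r / lam)).
Proof.
move=> l0 r0; have y0 := divr_gt0 r0 l0.
have h1 : is_derive lam (1 : R) (fun l : R => r / l) (- (r / lam ^+ 2)).
  have ln : lam != 0 by rewrite gt_eqF.
  have hV := is_deriveV ln (is_derive_id lam (1 : R)).
  apply: (is_derive_eq (is_deriveM (is_derive_cst r lam 1) hV)).
  by rewrite /GRing.scale /=; field.
apply: (is_derive_eq (@is_derive1_comp _ (Q k) (fun l => r / l) lam _ _ (is_derive_Q y0) h1)).
rewrite /sinQ; field; by rewrite !gt_eqF.
Qed.

Lemma is_derive_cosQ lam r : 0 < lam -> 0 < r ->
  is_derive r (1 : R) (cosQ lam) (- (k%:R * sinQ lam r ^+ 2 / r)).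
Proof.
move=> l0 r0; apply: (is_derive_eq (is_derive_cos_comp (is_derive_Q_rescale l0 r0))).
by rewrite -/(sinQ lam r); ring.
Qed.

Lemma is_derive_sinQ lam r : 0 < lam -> 0 < r ->
  is_derive r (1 : R) (sinQ lam) (k%:R * sinQ lam r * cosQ lam r / r).
Proof.
move=> l0 r0; apply: (is_derive_eq (is_derive_sin_comp (is_derive_Q_rescale l0 r0))).
by rewrite -/(cosQ lam r); ring.
Qed.

Lemma is_derive_cosQ_scale lam r : 0 < lam -> 0 < r ->
  is_derive lam (1 : R) (cosQ^~ r) (k%:R * sinQ lam r ^+ 2 / lam).
Proof.
move=> l0 r0; apply: (is_derive_eq (is_derive_cos_comp (is_derive_Q_scale l0 r0))).
by rewrite -/(sinQ lam r); ring.
Qed.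

Lemma is_derive_sinQ_scale lam r : 0 < lam -> 0 < r ->
  is_derive lam (1 : R) (sinQ^~ r) (- (k%:R * sinQ lam r * cosQ lam r / lam)).
Proof.
move=> l0 r0; apply: (is_derive_eq (is_derive_sin_comp (is_derive_Q_scale l0 r0))).
by rewrite -/(cosQ lam r); ring.
Qed.

(** The rational form of the derivative avoids a circle: [k sin Q / r] is known to be smooth only
    once [Q] is. *)
Lemma smooth_pos_Q : smooth_pos (Q k : R -> R).
Proof.
have d (r : R) : 0 < r -> is_derive r (1 : R) (Q k : R -> R)
    (k%:R * (2 * r ^+ k * (1 + r ^+ k * r ^+ k)^-1) * r^-1).
  move=> r0; apply: (is_derive_eq (is_derive_Q r0)).
  by have := sinQ_rational 1 r; rewrite /sinQ divr1 => ->; rewrite (expr2 (r ^+ k)).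
have sX : smooth_pos (fun r : R => r ^+ k) := @smooth_posX R id k (@smooth_pos_id R).
have gs : smooth_pos (fun r : R => k%:R * (2 * r ^+ k * (1 + r ^+ k * r ^+ k)^-1) * r^-1).
  apply: smooth_posM (@smooth_pos_inv R).
  apply: smooth_posM; first exact: smooth_pos_cst.
  apply: smooth_posM; first by apply: smooth_posM sX; exact: smooth_pos_cst.
  apply: smooth_posV; first by move=> r r0; rewrite gt_eqF// ltr_pwDl// -expr2 sqr_ge0.
  by apply: smooth_posD; [exact: smooth_pos_cst|exact: smooth_posM].
apply/smooth_posP => -[|n].
  by split => // r r0; exact: is_derive_derivable (d r r0).
exact: ndiffS d ((smooth_posP _).1 gs n).
Qed.

Lemma smooth_pos_cosQ lam : 0 < lam -> smooth_pos (cosQ lam).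
Proof.
by move=> l0; exact: (smooth_pos_cos (smooth_pos_rescale l0 smooth_pos_Q)).
Qed.

Lemma LambdaQE y : 0 < y -> LambdaQ k y = k%:R * sinQ 1 y.
Proof.
move=> y0; rewrite /LambdaQ (is_derive1E (is_derive_Q y0)) /sinQ divr1.
by rewrite mulrC divfK// gt_eqF.
Qed.

End Profile.

(** * Jets and the weight *)

Section Jets.
Variable R : realType.
Implicit Types (g : R -> R) (r : R).

Lemma jet_sq1E g r : jet_sq 1 g r = derive1 g r ^+ 2 + (g r / r) ^+ 2.
Proof.
by rewrite /jet_sq big_ord_recl big_ord1 /= expr0 invr1 mul1r expr1 [_^-1 * _]mulrC.
Qed.

Lemma jet_sq2E g r : jet_sq 2 g r =
  derive1 (derive1 g) r ^+ 2 + (derive1 g r / r) ^+ 2 + (g r / r ^+ 2) ^+ 2.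
Proof.
rewrite /jet_sq !big_ord_recl big_ord0 /= /bump /= expr0 invr1 mul1r expr1 addr0.
by rewrite [r^-1 * _]mulrC [_^-1 * g r]mulrC addrA.
Qed.

Lemma jet_sq_ge0 m g r : 0 <= jet_sq m g r.
Proof. by apply: sumr_ge0 => i _; exact: sqr_ge0. Qed.

Lemma jet_ge0 m g r : 0 <= jet m g r. Proof. exact: sqrtr_ge0. Qed.

Lemma jet_sqr m g r : jet m g r ^+ 2 = jet_sq m g r.
Proof. by rewrite sqr_sqrtr// jet_sq_ge0. Qed.

Lemma norm_le_sqrt (x s : R) : x ^+ 2 <= s -> `|x| <= Num.sqrt s.
Proof. by move=> xs; rewrite -sqrtr_sqr ler_wsqrtr. Qed.

Lemma jet1_derive1 g r : `|derive1 g r| <= jet 1 g r.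
Proof. by apply: norm_le_sqrt; rewrite jet_sq1E lerDl sqr_ge0. Qed.

Lemma jet1_id g r : `|g r / r| <= jet 1 g r.
Proof. by apply: norm_le_sqrt; rewrite jet_sq1E lerDr sqr_ge0. Qed.

Lemma jet2_derive2 g r : `|derive1 (derive1 g) r| <= jet 2 g r.
Proof.
by apply: norm_le_sqrt; rewrite jet_sq2E -addrA lerDl addr_ge0 ?sqr_ge0.
Qed.

Lemma jet2_derive1 g r : `|derive1 g r / r| <= jet 2 g r.
Proof.
apply: norm_le_sqrt; rewrite jet_sq2E.
have := sqr_ge0 (derive1 (derive1 g) r); have := sqr_ge0 (g r / r ^+ 2); lra.
Qed.

Lemma jet2_id g r : `|g r / r ^+ 2| <= jet 2 g r.
Proof. by apply: norm_le_sqrt; rewrite jet_sq2E lerDr addr_ge0 ?sqr_ge0. Qed.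

Lemma jet_sq21 g r : 0 < r ->
  jet_sq 2 g r = derive1 (derive1 g) r ^+ 2 + r ^- 2 * jet_sq 1 g r.
Proof. by move=> r0; rewrite jet_sq2E jet_sq1E; field; rewrite gt_eqF. Qed.

End Jets.

Section Weight.
Variables (R : realType) (k : nat) (psi : R -> R).
Implicit Types (g : R -> R) (r lam y : R).

(** The quantitative information on the weight from which all later estimates are made, apart from
    the coercivity of the single-bubble forms. *)
Definition weight_bound (K : R) := forall y, 0 < y ->
  [/\ `|psi y| <= K * (y / (1 + y)), `|derive1 psi y| <= K / (1 + y) ^+ 2 &
      `|y * derive1 (derive1 psi) y| <= K / (1 + y) ^+ 2].

Lemma derive1_rescale f r lam : smooth_pos f -> 0 < lam -> 0 < r ->
  derive1 (scale lam f) r = derive1 f (r / lam) / lam.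
Proof.
move=> fs l0 r0; apply: is_derive1E; apply: is_derive_rescale.
exact: smooth_pos_is_derive fs (divr_gt0 r0 l0).
Qed.

Lemma is_derive_dilation f r lam : smooth_pos f -> 0 < lam -> 0 < r ->
  is_derive lam (1 : R) (fun l => f (r / l)) (- (r / lam * derive1 f (r / lam) / lam)).
Proof.
move=> fs l0 r0; have y0 := divr_gt0 r0 l0.
have h1 : is_derive lam (1 : R) (fun l : R => r / l) (- (r / lam ^+ 2)).
  have ln : lam != 0 by rewrite gt_eqF.
  have hV := is_deriveV ln (is_derive_id lam (1 : R)).
  apply: (is_derive_eq (is_deriveM (is_derive_cst r lam 1) hV)).
  by rewrite /GRing.scale /=; field.
apply: (is_derive_eq (@is_derive1_comp _ f (fun l => r / l) lam _ _
  (smooth_pos_is_derive fs y0) h1)).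
by field; rewrite gt_eqF.
Qed.

Hypothesis hpsi : is_morawetz_weight k psi.

(* The bounds on the weight and its derivatives are read off from the
   hypothesis on the scaling derivative of [Lambda_psi], applied at scale 1 to
   the functions [x - r] (which vanishes at [r]) and [1]. *)
Lemma weight_bounds : exists2 K : R, 0 < K & weight_bound K.
Proof.
have [ps [_ [_ [[c [C [c0 C0 pC]]] [_ [[C' C'0 hC'] _]]]]]] := hpsi.
(* For [g = x - y] the zeroth-order term of [Lambda_psi] drops out at [y], and what is
   differentiated in the scale is [psi (y / l)]. *)
have aux1 y : 0 < y -> `|y * derive1 psi y| <= C' * (y / (1 + y) ^+ 2).
  move=> y0; pose g (x : R) := x - y.
  have dg : is_derive y (1 : R) g 1.
    by apply: is_derive_eq (is_deriveB (is_derive_id y 1) (is_derive_cst y y 1)) _; rewrite subr0.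
  have := hC' 1 g y ltr01 y0 (is_derive_derivable dg); rewrite /= divr1 mul1r.
  have -> : jet 1 g y = 1.
    by rewrite /jet jet_sq1E (is_derive1E dg) /g subrr mul0r expr1n expr0n addr0 sqrtr1.
  rewrite (_ : (fun l => _) = (fun l : R => psi (y / l))); last first.
    apply/funext => l; rewrite /Lambda_psi (is_derive1E dg) /g subrr mulr0 addr0 mulr1.
    by [].
  have h := is_derive_dilation ps ltr01 y0.
  by rewrite (is_derive1E h) !divr1 normrN mulr1.
(* For [g = 1] only half of [derive1 psi_l + psi_l / y] remains. Its scale derivative at [l = 1] is
   minus half of [y psi'' + 2 psi'], and the jet of [g] is [1 / y]. *)
have aux2 y : 0 < y -> `|y * derive1 (derive1 psi) y + 2 * derive1 psi y| <= 2 * C' / (1 + y) ^+ 2.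
  move=> y0; pose g (x : R) : R := 1.
  have dg : is_derive y (1 : R) g 0 by exact: is_derive_cst.
  have := hC' 1 g y ltr01 y0 (is_derive_derivable dg); rewrite /= divr1 mul1r.
  have -> : jet 1 g y = y^-1.
    rewrite /jet jet_sq1E (is_derive1E dg) /g expr0n add0r mul1r.
    by rewrite sqrtr_sqr ger0_norm// invr_ge0 ltW.
  have h0 := is_derive_dilation ps ltr01 y0.
  have h1 := is_derive_dilation (smooth_pos_derive1 ps) ltr01 y0.
  have hV : is_derive (1 : R) (1 : R) (fun l : R => l^-1) (- 1).
    have n1 : (1 : R) != 0 by exact: oner_neq0.
    apply: (is_derive_eq (is_deriveV n1 (is_derive_id (1 : R) (1 : R)))).
    by rewrite /GRing.scale /= expr1n invr1 mulr1.
  have hM := is_deriveM h1 hV.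
  have hC := is_deriveM (is_derive_cst (y^-1 : R) (1 : R) (1 : R)) h0.
  have hS := is_deriveM (is_derive_cst (2^-1 : R) (1 : R) (1 : R)) (is_deriveD hM hC).
  have h : is_derive (1 : R) (1 : R) (fun l => Lambda_psi psi l g y)
     (- (2^-1 * (y * derive1 (derive1 psi) y + 2 * derive1 psi y))).
    apply: (is_derive_pos ltr01 _ (is_derive_eq hS _)).
      move=> l l0; rewrite /Lambda_psi (is_derive1E dg) mulr0 add0r /g mulr1.
      by rewrite (derive1_rescale ps l0 y0).
    rewrite /GRing.scale /= !divr1 !mulr0 ?addr0 /cst.
    by field; rewrite gt_eqF.
  rewrite (is_derive1E h) normrN normrM ger0_norm ?invr_ge0//.
  have y1 : 0 < 1 + y by rewrite addr_gt0.
  rewrite [X in _ <= X -> _](_ : _ = C' / (1 + y) ^+ 2); last first.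
    by field; rewrite !gt_eqF.
  by rewrite ler_pdivrMl// [X in _ <= X -> _]mulrA.
have dpsi y : 0 < y -> `|derive1 psi y| <= C' / (1 + y) ^+ 2.
  move=> y0; have := aux1 _ y0; rewrite normrM (gtr0_norm y0) [leRHS]mulrCA.
  by rewrite ler_pM2l.
(* [2 * C'] bounds the combination in [aux2], and removing [2 psi'] from it costs another
   [2 * C']. *)
exists (C + 4 * C'); first by rewrite addr_gt0// mulr_gt0.
move=> y y0; have y1 : 0 < 1 + y by rewrite addr_gt0.
have i2 : 0 < ((1 + y) ^+ 2)^-1 by rewrite invr_gt0 exprn_gt0.
split.
- have /andP[h1 h2] := pC _ y0.
  rewrite ger0_norm; last by rewrite (le_trans _ h1)// mulr_ge0 ?divr_ge0// ltW.
  by apply: (le_trans h2); rewrite ler_pM2r ?divr_gt0// lerDl mulr_ge0// ltW.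
- apply: (le_trans (dpsi _ y0)); rewrite ler_pM2r//; lra.
- have h1 := aux2 _ y0; have h2 := dpsi _ y0.
  have -> : y * derive1 (derive1 psi) y =
    (y * derive1 (derive1 psi) y + 2 * derive1 psi y) - 2 * derive1 psi y by ring.
  apply: (le_trans (normB_le h1 (normM_le (lexx _) h2))).
  rewrite ger0_norm//.
  rewrite [leLHS](_ : _ = (4 * C') * ((1 + y) ^+ 2)^-1); last by ring.
  by rewrite ler_pM2r// lerDr ltW.
Qed.

End Weight.

(** * The multiplier *)

Section Measurability.
Variable R : realType.
Implicit Types f g : R -> R.

Lemma pos_measurableD f g : pos_measurable f -> pos_measurable g ->
  pos_measurable (fun r => f r + g r).
Proof. exact: measurable_funD. Qed.

Lemma pos_measurableM f g : pos_measurable f -> pos_measurable g ->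
  pos_measurable (fun r => f r * g r).
Proof. exact: measurable_funM. Qed.

Lemma pos_measurableN f : pos_measurable f -> pos_measurable (fun r => - f r).
Proof. by move=> fm; exact: measurable_funN. Qed.

Lemma pos_measurable_sqr f : pos_measurable f -> pos_measurable (fun r => f r ^+ 2).
Proof. by move=> fm; exact: measurable_funX. Qed.

Lemma pos_measurable_norm f : pos_measurable f -> pos_measurable (fun r => `|f r|).
Proof. by move=> fm; exact: measurableT_comp. Qed.

Lemma pos_measurable_sqrt f : pos_measurable f -> pos_measurable (fun r => Num.sqrt (f r)).
Proof.
move=> fm; apply: measurableT_comp fm; apply: continuous_measurable_fun.
exact: sqrt_continuous.
Qed.

Lemma smooth_pos_sin f : smooth_pos f -> smooth_pos (fun r => sin (f r)).
Proof. by move=> /smooth_posP fs; apply/smooth_posP => n; have [] := ndiff_cos_sin (fs n). Qed.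

Lemma pos_measurable_jet1 g : loc_abs_continuous g -> pos_measurable (jet 1 g).
Proof.
move=> gac; apply: pos_measurable_sqrt.
rewrite (_ : jet_sq 1 g = fun r => derive1 g r ^+ 2 + (g r * r^-1) ^+ 2); last first.
  by apply/funext => r; exact: jet_sq1E.
apply: pos_measurableD; apply: pos_measurable_sqr; first exact: lac_measurable_derive1.
apply: pos_measurableM; first exact: lac_measurable.
exact: smooth_pos_measurable (@smooth_pos_inv R).
Qed.

Lemma pos_measurable_jet2 g : loc_abs_continuous g -> loc_abs_continuous (derive1 g) ->
  pos_measurable (jet 2 g).
Proof.
move=> gac g'ac; apply: pos_measurable_sqrt.
have mi : pos_measurable (fun r : R => r^-1) := smooth_pos_measurable (@smooth_pos_inv R).
rewrite (_ : jet_sq 2 g = fun r => derive1 (derive1 g) r ^+ 2 +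
    (derive1 g r * r^-1) ^+ 2 + (g r * (r^-1 * r^-1)) ^+ 2); last first.
  by apply/funext => r; rewrite jet_sq2E -invfM -expr2.
apply: pos_measurableD; first apply: pos_measurableD; apply: pos_measurable_sqr.
- exact: lac_measurable_derive1.
- by apply: pos_measurableM => //; exact: lac_measurable.
- apply: pos_measurableM; first exact: lac_measurable.
  exact: pos_measurableM.
Qed.

End Measurability.

Section DerivativeRules.
Variable R : realType.
Implicit Types (f g : R -> R) (r a b : R).

Lemma drC c r : is_derive r (1 : R) (fun=> c : R) 0. Proof. exact: is_derive_cst. Qed.

Lemma drI r : is_derive r (1 : R) (fun x => x) 1. Proof. exact: is_derive_id. Qed.

Lemma drD f g r a b : is_derive r (1 : R) f a -> is_derive r (1 : R) g b ->
  is_derive r (1 : R) (fun x => f x + g x) (a + b).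
Proof. exact: is_deriveD. Qed.

Lemma drB f g r a b : is_derive r (1 : R) f a -> is_derive r (1 : R) g b ->
  is_derive r (1 : R) (fun x => f x - g x) (a - b).
Proof. exact: is_deriveB. Qed.

Lemma drN f r a : is_derive r (1 : R) f a -> is_derive r (1 : R) (fun x => - f x) (- a).
Proof. exact: is_deriveN. Qed.

Lemma drM f g r a b : is_derive r (1 : R) f a -> is_derive r (1 : R) g b ->
  is_derive r (1 : R) (fun x => f x * g x) (a * g r + f r * b).
Proof.
by move=> fa gb; apply: is_derive_eq (is_deriveM fa gb) _; rewrite /GRing.scale /= addrC mulrC.
Qed.

Lemma drV f r a : f r != 0 -> is_derive r (1 : R) f a ->
  is_derive r (1 : R) (fun x => (f x)^-1) (- (a / f r ^+ 2)).
Proof.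
move=> f0 fa; apply: is_derive_eq (is_deriveV f0 fa) _.
by rewrite /GRing.scale /= mulNr mulrC.
Qed.

Lemma drX2 f r a : is_derive r (1 : R) f a ->
  is_derive r (1 : R) (fun x => f x ^+ 2) (2 * f r * a).
Proof.
move=> fa; rewrite (_ : (fun _ => _) = fun x => f x * f x); last by apply/funext => x; rewrite expr2.
by apply: is_derive_eq (drM fa fa) _; ring.
Qed.

End DerivativeRules.

(** * The operator A and the multiplier of the Morawetz form *)

Section Operators.
Variables (R : realType) (k : nat) (psi : R -> R) (delta K : R).
Hypotheses (hk : (2 <= k)%N) (psi_smooth : smooth_pos psi) (K0 : 0 < K)
  (hK : weight_bound psi K) (delta0 : 0 < delta).
Implicit Types (g h : R -> R) (r lam : R).

Local Notation k' := (k%:R : R).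

Definition psi_weight lam r : R := psi (r / lam).
Definition psi_weight1 lam r : R := derive1 psi (r / lam) / lam.
Definition psi_weight2 lam r : R := derive1 (derive1 psi) (r / lam) / lam ^+ 2.
Definition wtd lam r : R := lam * (r + lam) ^- 2.
(** The zeroth-order coefficient of [Lambda_psi] with the [delta]-correction of [M0] merged into
    it. *)
Definition zeroth_weight lam r : R := 2^-1 * (psi_weight1 lam r + r^-1 * psi_weight lam r) - delta * wtd lam r.

(* [dAop] is the derivative of [Aop] in [r]. *)
Definition dAop lam g r : R :=
  - derive1 (derive1 g) r + k' * cosQ k lam r / r * derive1 g r
  - k' * (k' * sinQ k lam r ^+ 2 + cosQ k lam r) / r ^+ 2 * g r.

(** Using [dAop] instead of the derivative of [Aop] keeps this an explicit linear expression in the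
    jet of [g], bounded also at points where [Aop k lam g] is not derivable. *)
Definition multiplier lam g r : R := psi_weight lam r * dAop lam g r + zeroth_weight lam r * Aop k lam g r.

Lemma smooth_pos_sinQ lam : 0 < lam -> smooth_pos (sinQ k lam : R -> R).
Proof. by move=> l0; exact: (smooth_pos_sin (smooth_pos_rescale l0 (@smooth_pos_Q R k hk))). Qed.

Lemma is_derive_Aop lam g r : 0 < lam -> 0 < r -> derivable g r 1 ->
  derivable (derive1 g) r 1 -> is_derive r (1 : R) (Aop k lam g) (dAop lam g r).
Proof.
move=> l0 r0 /derivable_is_derive1 dg /derivable_is_derive1 d2g.
have rn : r != 0 by rewrite gt_eqF.
have dC := drM (drM (drC k' r) (is_derive_cosQ hk l0 r0)) (drV rn (drI r)).
apply: is_derive_eq (drD (drN d2g) (drM dC dg)) _.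
by rewrite /dAop; field.
Qed.

End Operators.

Section OperatorBounds.
Variables (R : realType) (k : nat) (psi : R -> R) (delta K : R).
Hypotheses (hk : (2 <= k)%N) (psi_smooth : smooth_pos psi) (K0 : 0 < K)
  (hK : weight_bound psi K) (delta0 : 0 < delta).
Implicit Types (g h dg : R -> R) (r lam : R).

Local Notation k' := (k%:R : R).
Local Notation wt0 := (psi_weight psi). Local Notation wt1 := (psi_weight1 psi).
Local Notation wt2 := (psi_weight2 psi). Local Notation sig := (zeroth_weight psi delta).
Local Notation Xop := (multiplier k psi delta). Local Notation dAop := (dAop k).

Lemma norm_wt0 lam r : 0 < lam -> 0 < r -> `|wt0 lam r| <= K * (r / (lam + r)).
Proof.
move=> l0 r0; have [h _ _] := hK (divr_gt0 r0 l0).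
by apply: (le_trans h); apply: eq_ge; field; rewrite !gt_eqF ?addr_gt0.
Qed.

Lemma norm_wt1 lam r : 0 < lam -> 0 < r -> `|wt1 lam r| <= K * (lam / (lam + r) ^+ 2).
Proof.
move=> l0 r0; have [_ h _] := hK (divr_gt0 r0 l0).
rewrite /wt1 normrM [`|lam^-1|]gtr0_norm ?invr_gt0//.
rewrite ler_pdivrMr//; apply: (le_trans h).
by apply: eq_ge; field; rewrite !gt_eqF ?addr_gt0.
Qed.

Lemma norm_wt2 lam r : 0 < lam -> 0 < r -> `|r * wt2 lam r| <= K * (lam / (lam + r) ^+ 2).
Proof.
move=> l0 r0; have [_ _ h] := hK (divr_gt0 r0 l0).
have -> : r * wt2 lam r = (r / lam * derive1 (derive1 psi) (r / lam)) / lam.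
  by rewrite /wt2; field; rewrite gt_eqF.
rewrite normrM [`|lam^-1|]gtr0_norm ?invr_gt0//.
rewrite ler_pdivrMr//; apply: (le_trans h).
by apply: eq_ge; field; rewrite !gt_eqF ?addr_gt0.
Qed.

Lemma lam_sqr_le lam r : 0 < lam -> 0 < r -> lam / (lam + r) ^+ 2 <= (lam + r)^-1.
Proof.
move=> l0 r0; have s0 : 0 < lam + r by rewrite addr_gt0.
rewrite expr2 invfM mulrA ler_piMl ?invr_ge0 ?ltW//.
by rewrite ltr_pdivrMr// mul1r ltrDl.
Qed.

Lemma wtd_ge0 lam r : 0 < lam -> 0 < r -> 0 <= wtd lam r.
Proof. by move=> l0 r0; rewrite /wtd mulr_ge0 ?invr_ge0 ?exprn_ge0 ?addr_ge0 ?ltW. Qed.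

Lemma wtdE lam r : wtd lam r = lam / (lam + r) ^+ 2.
Proof. by rewrite /wtd [r + lam]addrC. Qed.

Lemma norm_wtd lam r : 0 < lam -> 0 < r -> `|wtd lam r| <= (lam + r)^-1.
Proof. by move=> l0 r0; rewrite ger0_norm ?wtd_ge0// wtdE lam_sqr_le. Qed.

Lemma norm_sig lam r : 0 < lam -> 0 < r -> `|sig lam r| <= (K + delta) * (lam + r)^-1.
Proof.
move=> l0 r0; rewrite mulrDl; apply: normB_le; last first.
  by apply: normM_le (norm_wtd l0 r0); rewrite gtr0_norm.
have rr : `|r^-1| <= r^-1 by rewrite gtr0_norm// invr_gt0.
have h := normD_le (norm_wt1 l0 r0) (normM_le rr (norm_wt0 l0 r0)).
rewrite normrM gtr0_norm ?invr_gt0// ler_pdivrMl//.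
apply: (le_trans h); rewrite [X in _ + X](_ : _ = K * (lam + r)^-1); last first.
  by field; rewrite !gt_eqF ?addr_gt0.
have : K * (lam / (lam + r) ^+ 2) <= K * (lam + r)^-1 by rewrite ler_pM2l// lam_sqr_le.
lra.
Qed.

Lemma norm_kcos lam r : `|k' * cosQ k lam r| <= k'.
Proof. by rewrite -[leRHS]mulr1; apply: normM_le (norm_cosQ k lam r); rewrite ger0_norm. Qed.

Lemma norm_Aop1 lam h r : 0 < r -> `|Aop k lam h r| <= (1 + k') * jet 1 h r.
Proof.
move=> r0; rewrite /Aop mulrDl mul1r; apply: normD_le.
  exact: normN_le (jet1_derive1 h r).
rewrite [X in `|X|](_ : _ = (k' * cosQ k lam r) * (h r / r)); last first.
  by rewrite /cosQ /scale; ring.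
exact: normM_le (norm_kcos lam r) (jet1_id h r).
Qed.

Lemma norm_Aop2 lam g r : 0 < r -> `|Aop k lam g r / r| <= (1 + k') * jet 2 g r.
Proof.
move=> r0.
rewrite [X in `|X|](_ : _ = - (derive1 g r / r) + (k' * cosQ k lam r) * (g r / r ^+ 2)); last first.
  by rewrite /Aop /cosQ /scale; field; rewrite gt_eqF.
rewrite mulrDl mul1r; apply: normD_le; first exact: normN_le (jet2_derive1 g r).
exact: normM_le (norm_kcos lam r) (jet2_id g r).
Qed.

Lemma norm_dAop lam g r : 0 < r -> `|dAop lam g r| <= (1 + k') ^+ 2 * jet 2 g r.
Proof.
move=> r0.
rewrite [X in `|X|](_ : _ = - derive1 (derive1 g) r + (k' * cosQ k lam r) * (derive1 g r / r)
   - k' * (k' * sinQ k lam r ^+ 2 + cosQ k lam r) * (g r / r ^+ 2)); last first.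
  by rewrite /dAop; ring.
rewrite (_ : (1 + k') ^+ 2 * _ = jet 2 g r + k' * jet 2 g r + k' * (k' * 1 + 1) * jet 2 g r); last by ring.
apply: normB_le; first apply: normD_le.
- exact: normN_le (jet2_derive2 g r).
- exact: normM_le (norm_kcos lam r) (jet2_derive1 g r).
apply: normM_le (jet2_id g r); apply: normM_le; first by rewrite ger0_norm.
apply: normD_le (norm_cosQ k lam r); apply: normM_le; first by rewrite ger0_norm.
by rewrite -(expr1n _ 2) normrX lerXn2r ?nnegrE// norm_sinQ.
Qed.

(** [K] bounds the first-order weight and [K + delta] the zeroth-order one, while [(1 + k) ^+ 2]
    bounds [dAop] by the second jet. *)
Definition Cmult : R := (2 * K + delta) * (1 + k') ^+ 2.

Lemma k1_ge1 : 1 <= 1 + k'. Proof. by rewrite lerDl. Qed.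

Lemma Cmult_gt0 : 0 < Cmult.
Proof.
have : 0 < (1 + k') ^+ 2 by rewrite exprn_gt0// (lt_le_trans ltr01)// k1_ge1.
by apply: mulr_gt0; rewrite addr_gt0// mulr_gt0.
Qed.

Lemma norm_Xop lam g r : 0 < lam -> 0 < r ->
  `|Xop lam g r| <= Cmult * (r / (lam + r)) * jet 2 g r.
Proof.
move=> l0 r0; have s0 : 0 < lam + r by rewrite addr_gt0.
rewrite [X in `|X|](_ : _ = wt0 lam r * dAop lam g r + (r * sig lam r) * (Aop k lam g r / r)); last first.
  by rewrite /Xop; field; rewrite gt_eqF.
have h1 := normM_le (norm_wt0 l0 r0) (norm_dAop lam g r0).
have rr : `|r| <= r by rewrite gtr0_norm.
have h2 := normM_le (normM_le rr (norm_sig l0 r0)) (norm_Aop2 lam g r0).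
apply: (le_trans (normD_le h1 h2)).
set J := jet 2 g r; have J0 : 0 <= J := jet_ge0 2 g r.
set t := r / (lam + r); have t0 : 0 <= t by rewrite divr_ge0 ?ltW.
have -> : r * ((K + delta) * (lam + r)^-1) * ((1 + k') * J) = (K + delta) * (t * J) * (1 + k').
  by rewrite /t; ring.
have : (K + delta) * (t * J) * (1 + k') <= (K + delta) * (t * J) * (1 + k') ^+ 2.
  apply: ler_wpM2l; last by rewrite ler_eXnr// k1_ge1.
  by apply: mulr_ge0; [rewrite addr_ge0// ltW|exact: mulr_ge0].
rewrite /Cmult => h; rewrite [leRHS](_ : _ = K * t * ((1 + k') ^+ 2 * J) + (K + delta) * (t * J) * (1 + k') ^+ 2); last by ring.
by rewrite lerD2l.
Qed.

Lemma norm_Xop1 lam g r : 0 < lam -> 0 < r -> `|Xop lam g r| <= Cmult * jet 2 g r.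
Proof.
move=> l0 r0; apply: (le_trans (norm_Xop g l0 r0)).
rewrite -mulrA ler_pM2l ?Cmult_gt0// ler_piMl ?jet_ge0//.
by rewrite ler_pdivrMr ?addr_gt0// mul1r lerDr ltW.
Qed.

Lemma smooth_pos_wt0 lam : 0 < lam -> smooth_pos (wt0 lam).
Proof. by move=> l0; exact: smooth_pos_rescale. Qed.

Lemma smooth_pos_wt1 lam : 0 < lam -> smooth_pos (wt1 lam).
Proof.
move=> l0; apply: smooth_posM (@smooth_pos_cst R lam^-1).
exact: (smooth_pos_rescale l0 (smooth_pos_derive1 psi_smooth)).
Qed.

Lemma smooth_pos_wtd lam : 0 < lam -> smooth_pos (wtd lam : R -> R).
Proof.
move=> l0; apply: smooth_posM; first exact: smooth_pos_cst.
apply: smooth_posV; first by move=> r r0; rewrite expf_neq0// gt_eqF// addr_gt0.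
apply: smooth_posX; apply: smooth_posD; [exact: smooth_pos_id|exact: smooth_pos_cst].
Qed.

Lemma smooth_pos_sig lam : 0 < lam -> smooth_pos (sig lam).
Proof.
move=> l0; apply: smooth_posD.
  apply: smooth_posM; first exact: smooth_pos_cst.
  apply: smooth_posD (smooth_pos_wt1 l0) _.
  exact: smooth_posM (@smooth_pos_inv R) (smooth_pos_wt0 l0).
apply: smooth_posN; apply: smooth_posM (smooth_pos_wtd l0).
exact: smooth_pos_cst.
Qed.

Lemma pos_measurable_Aop lam g : 0 < lam -> loc_abs_continuous g ->
  pos_measurable (Aop k lam g).
Proof.
move=> l0 gac; apply: pos_measurableD.
  by apply: pos_measurableN; exact: lac_measurable_derive1.
apply: pos_measurableM (lac_measurable gac); apply: smooth_pos_measurable.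
apply: smooth_posM (@smooth_pos_inv R); apply: smooth_posM; first exact: smooth_pos_cst.
exact: smooth_pos_cosQ.
Qed.

Lemma pos_measurable_dAop lam g : 0 < lam -> loc_abs_continuous g ->
  loc_abs_continuous (derive1 g) -> pos_measurable (dAop lam g).
Proof.
move=> l0 gac g'ac; have sC := smooth_pos_cosQ hk l0; have sS := @smooth_pos_sinQ R k hk lam l0.
have sV := @smooth_pos_inv R.
apply: pos_measurableD; first apply: pos_measurableD.
- by apply: pos_measurableN; exact: lac_measurable_derive1.
- apply: pos_measurableM (lac_measurable g'ac); apply: smooth_pos_measurable.
  by apply: smooth_posM sV; apply: smooth_posM sC; exact: smooth_pos_cst.
apply: pos_measurableN; apply: pos_measurableM (lac_measurable gac); apply: smooth_pos_measurable.
apply: smooth_posM.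
  apply: smooth_posM; first exact: smooth_pos_cst.
  apply: smooth_posD sC; apply: smooth_posM (smooth_posX sS); exact: smooth_pos_cst.
apply: smooth_posV; first by move=> r r0; rewrite expf_neq0// gt_eqF.
by apply: smooth_posX; exact: smooth_pos_id.
Qed.

Lemma pos_measurable_Xop lam g : 0 < lam -> loc_abs_continuous g ->
  loc_abs_continuous (derive1 g) -> pos_measurable (Xop lam g).
Proof.
move=> l0 gac g'ac; apply: pos_measurableD; apply: pos_measurableM.
- exact: smooth_pos_measurable (smooth_pos_wt0 l0).
- exact: pos_measurable_dAop.
- exact: smooth_pos_measurable (smooth_pos_sig l0).
- exact: pos_measurable_Aop.
Qed.

(** Almost everywhere the derivative taken in [Lambda_psi] is [dAop], and the zeroth-order terms
    then combine. The two pairings of [M0] are shown to be integrable separately, since [rint] is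
    additive only on integrable functions. *)
Lemma M0E lam g dg : 0 < lam -> loc_abs_continuous g -> loc_abs_continuous (derive1 g) ->
  pos_measurable (Aop k lam dg) ->
  rintegrable (fun r => `|Aop k lam dg r| * jet 2 g r) ->
  rintegrable (fun r => Aop k lam dg r * Xop lam g r) /\
  M0 k psi delta lam g dg = rint (fun r => Aop k lam dg r * Xop lam g r).
Proof.
move=> l0 gac g'ac mA iA.
have mX := pos_measurable_Xop l0 gac g'ac.
have mAg := pos_measurable_Aop l0 gac.
pose Y r := wtd lam r * Aop k lam g r.
have mY : pos_measurable Y.
  by apply: pos_measurableM mAg; exact: smooth_pos_measurable (smooth_pos_wtd l0).
have iX : rintegrable (fun r => Aop k lam dg r * Xop lam g r).
  apply: (rintegrable_dom _ _ (rintegrableZ Cmult iA)); first exact: pos_measurableM.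
  move=> r r0; rewrite normrM mulrCA; apply: ler_wpM2l => //.
  exact: norm_Xop1.
have iY : rintegrable (fun r => Aop k lam dg r * Y r).
  apply: (rintegrable_dom _ _ (rintegrableZ (1 + k') iA)); first exact: pos_measurableM.
  move=> r r0; rewrite normrM mulrCA; apply: ler_wpM2l => //.
  have -> : Y r = (r * wtd lam r) * (Aop k lam g r / r) by rewrite /Y; field; rewrite gt_eqF.
  rewrite -[leRHS]mul1r; apply: normM_le; last exact: norm_Aop2.
  rewrite normrM gtr0_norm//; apply: (le_trans (ler_wpM2l (ltW r0) (norm_wtd l0 r0))).
  by rewrite ler_pdivrMr ?addr_gt0// mul1r lerDr ltW.
split => //; rewrite /M0.
have iZ := rintegrableZ delta iY.
have -> : rdot (Aop k lam dg) (fun r => lam * (r + lam) ^- 2 * Aop k lam g r) =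
    rint (fun r => Aop k lam dg r * Y r) by [].
have -> : rdot (Aop k lam dg) (Lambda_psi psi lam (Aop k lam g)) =
    rint (fun r => Aop k lam dg r * Xop lam g r + delta * (Aop k lam dg r * Y r)).
  apply: rint_ae_eq; have := lac_derivable_ae g'ac; apply: filterS.
    exact: (ae_filter_ringOfSetsType (@lebesgue_measure R)).
  move=> r h r0; have d2g := h r0; have d1g := lac_derivable gac g'ac r0.
  have hA := is_derive_Aop hk l0 r0 d1g d2g.
  rewrite /Lambda_psi (is_derive1E hA) (derive1_rescale psi_smooth l0 r0).
  by rewrite /Xop /sig /Y /psi_weight /psi_weight1 /scale; ring.
rewrite rintD// -rintZ//; ring.
Qed.

End OperatorBounds.

(** * Boundedness *)

Section MorawetzDensity.
Variable R : realType.
Implicit Types (g : (R -> R) * (R -> R)) (r lam : R).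

Definition mor_density lam g r : R :=
  (derive1n 2 g.1 r ^+ 2 + jet_sq 1 g.2 r) / ((lam + r) * (1 + r / lam))
  + r ^- 2 * jet_sq 1 g.1 r / (lam + r).

Lemma Mor_sqE lam g : Mor_sq lam g = rint (mor_density lam g).
Proof. by []. Qed.

Lemma mor_densityE lam g r : 0 < lam -> 0 < r -> mor_density lam g r =
  (derive1 (derive1 g.1) r ^+ 2 + jet_sq 1 g.2 r) * (lam / (lam + r) ^+ 2)
  + r ^- 2 * jet_sq 1 g.1 r * (lam + r)^-1.
Proof.
move=> l0 r0; rewrite /mor_density /=; congr (_ * _ + _).
by field; rewrite !gt_eqF ?addr_gt0.
Qed.

Lemma jet_div_ge0 (f : R -> R) r : 0 <= r ^- 2 * jet_sq 1 f r.
Proof. by rewrite mulr_ge0 ?jet_sq_ge0// invr_ge0 sqr_ge0. Qed.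

Lemma lam_ratio_ge0 lam r : 0 < lam -> 0 < r -> 0 <= lam / (lam + r) ^+ 2.
Proof. by move=> l0 r0; rewrite divr_ge0 ?exprn_ge0 ?addr_ge0 ?ltW. Qed.

Lemma mor_density_ge0 lam g r : 0 < lam -> 0 < r -> 0 <= mor_density lam g r.
Proof.
move=> l0 r0; rewrite mor_densityE// addr_ge0//.
  by rewrite mulr_ge0 ?lam_ratio_ge0// addr_ge0 ?sqr_ge0 ?jet_sq_ge0.
by rewrite mulr_ge0 ?jet_div_ge0// invr_ge0 addr_ge0 ?ltW.
Qed.

(** The weight [lam / (lam + r) ^+ 2] is the smaller of the two in the density, so it serves for
    both complete jets. *)
Lemma mor_density_ge lam g r : 0 < lam -> 0 < r ->
  (jet_sq 2 g.1 r + jet_sq 1 g.2 r) * (lam / (lam + r) ^+ 2) <= mor_density lam g r.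
Proof.
move=> l0 r0; rewrite mor_densityE// jet_sq21//.
have h := ler_wpM2l (jet_div_ge0 g.1 r) (lam_sqr_le l0 r0).
rewrite !mulrDl; lra.
Qed.

Lemma mor_density_ge2 lam g r : 0 < lam -> 0 < r ->
  jet_sq 2 g.1 r * (lam / (lam + r) ^+ 2) <= mor_density lam g r.
Proof.
move=> l0 r0; apply: le_trans (mor_density_ge g l0 r0).
by rewrite ler_wpM2r ?lam_ratio_ge0// lerDl jet_sq_ge0.
Qed.

Lemma mor_density_ge1 lam g r : 0 < lam -> 0 < r ->
  jet_sq 1 g.2 r * (lam / (lam + r) ^+ 2) <= mor_density lam g r.
Proof.
move=> l0 r0; apply: le_trans (mor_density_ge g l0 r0).
by rewrite ler_wpM2r ?lam_ratio_ge0// lerDr jet_sq_ge0.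
Qed.

Lemma mor_density_le lam g r : 0 < lam -> 0 < r ->
  mor_density lam g r <= lam^-1 * H2_density g r.
Proof.
move=> l0 r0; rewrite mor_densityE// /H2_density jet_sq21//.
have s0 : 0 < lam + r by rewrite addr_gt0.
have h1 : (lam + r)^-1 <= lam^-1 by rewrite lef_pV2 ?posrE// lerDl ltW.
have h2 := le_trans (lam_sqr_le l0 r0) h1.
have a0 : 0 <= derive1 (derive1 g.1) r ^+ 2 + jet_sq 1 g.2 r by rewrite addr_ge0 ?sqr_ge0 ?jet_sq_ge0.
have := ler_wpM2l a0 h2; have := ler_wpM2l (jet_div_ge0 g.1 r) h1.
set a := derive1 (derive1 g.1) r ^+ 2 + _; set b := r ^- 2 * _ => hb ha.
rewrite [leRHS](_ : _ = a * lam^-1 + b * lam^-1); last by rewrite /a /b; ring.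
lra.
Qed.

Lemma H2_density_ge0 g r : 0 <= H2_density g r.
Proof. by rewrite addr_ge0 ?jet_sq_ge0. Qed.

Lemma jet_prod_le g r : jet 2 g.1 r * jet 1 g.2 r <= H2_density g r.
Proof.
rewrite /H2_density -!jet_sqr.
have := sqr_ge0 (jet 2 g.1 r - jet 1 g.2 r).
have := mulr_ge0 (jet_ge0 2 g.1 r) (jet_ge0 1 g.2 r).
rewrite sqrrB -mulr_natl; lra.
Qed.

Lemma H2norm_sqr g : H2norm g ^+ 2 = rint (H2_density g).
Proof. by rewrite sqr_sqrtr// rint_ge0// => r _; exact: H2_density_ge0. Qed.

Lemma Mor_sq_ge0 lam g : 0 < lam -> 0 <= Mor_sq lam g.
Proof. by move=> l0; rewrite Mor_sqE; apply: rint_ge0 => r r0; exact: mor_density_ge0. Qed.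

Section InH2.
Variable g : (R -> R) * (R -> R).
Hypothesis gH : in_H2 g.

Lemma in_H2_measurable_jet2 : pos_measurable (jet 2 g.1).
Proof. by case: gH => h1 h2 _ _; exact: pos_measurable_jet2. Qed.

Lemma in_H2_measurable_jet1 : pos_measurable (jet 1 g.2).
Proof. by case: gH => _ _ h _; exact: pos_measurable_jet1. Qed.

Lemma pos_measurable_mor_density lam : 0 < lam -> pos_measurable (mor_density lam g).
Proof.
move=> l0; case: gH => h1 h2 h3 _.
have s r : 0 < r -> lam + r != 0 by move=> r0; rewrite gt_eqF// addr_gt0.
have sL : smooth_pos (fun r => lam + r).
  by apply: smooth_posD; [exact: smooth_pos_cst|exact: smooth_pos_id].
have m1 : pos_measurable (fun r => (lam + r)^-1) := smooth_pos_measurable (smooth_posV s sL).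
have m2 : pos_measurable (fun r => ((lam + r) * (1 + r / lam))^-1).
  apply: smooth_pos_measurable; apply: smooth_posV.
    by move=> r r0; rewrite mulf_neq0 ?s// gt_eqF// addr_gt0 ?divr_gt0.
  apply: smooth_posM sL _; apply: smooth_posD; first exact: smooth_pos_cst.
  by apply: smooth_posM; [exact: smooth_pos_id|exact: smooth_pos_cst].
have m3 : pos_measurable (fun r : R => r ^- 2).
  apply: smooth_pos_measurable; apply: smooth_posV.
    by move=> r r0; rewrite expf_neq0// gt_eqF.
  by apply: smooth_posX; exact: smooth_pos_id.
have j1 : pos_measurable (jet_sq 1 g.2).
  rewrite (_ : jet_sq 1 g.2 = fun r => jet 1 g.2 r ^+ 2); last first.
    by apply/funext => r; rewrite jet_sqr.
  by apply: pos_measurable_sqr; exact: pos_measurable_jet1.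
have j2 : pos_measurable (jet_sq 1 g.1).
  rewrite (_ : jet_sq 1 g.1 = fun r => jet 1 g.1 r ^+ 2); last first.
    by apply/funext => r; rewrite jet_sqr.
  by apply: pos_measurable_sqr; exact: pos_measurable_jet1.
apply: pos_measurableD.
  apply: pos_measurableM m2; apply: pos_measurableD j1.
  by apply: pos_measurable_sqr; exact: lac_measurable_derive1.
by apply: pos_measurableM m1; exact: pos_measurableM.
Qed.

Lemma in_H2_rintegrable : rintegrable (H2_density g). Proof. by case: gH. Qed.

Lemma rintegrable_mor_density lam : 0 < lam -> rintegrable (mor_density lam g).
Proof.
move=> l0; apply: (rintegrable_dom (pos_measurable_mor_density l0) _
  (rintegrableZ lam^-1 in_H2_rintegrable)) => r r0.
by rewrite ger0_norm ?mor_density_ge0// mor_density_le.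
Qed.

Lemma rintegrable_jet_prod : rintegrable (fun r => jet 2 g.1 r * jet 1 g.2 r).
Proof.
apply: (rintegrable_dom _ _ in_H2_rintegrable).
  apply: pos_measurableM; [exact: in_H2_measurable_jet2|exact: in_H2_measurable_jet1].
by move=> r _; rewrite ger0_norm ?mulr_ge0 ?jet_ge0// jet_prod_le.
Qed.

Lemma rint_jet_prod_le : rint (fun r => jet 2 g.1 r * jet 1 g.2 r) <= H2norm g ^+ 2.
Proof.
rewrite H2norm_sqr; apply: rint_le; [exact: rintegrable_jet_prod|exact: in_H2_rintegrable|].
by move=> r _; exact: jet_prod_le.
Qed.

Lemma rL1norm_jet_prod : rL1norm (fun r => jet 2 g.1 r * jet 1 g.2 r) =
  (rint (fun r => jet 2 g.1 r * jet 1 g.2 r))%:E.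
Proof.
rewrite /rint /Rintegral fineK; last first.
  by have := integrable_fin_num _ rintegrable_jet_prod; apply; exact: measurable_itv.
apply: eq_integral => r _.
by rewrite ger0_norm// mulr_ge0 ?jet_ge0.
Qed.

End InH2.
End MorawetzDensity.

Section Boundedness.
Variables (R : realType) (k : nat) (psi : R -> R) (delta K : R).
Hypotheses (hk : (2 <= k)%N) (psi_smooth : smooth_pos psi) (K0 : 0 < K)
  (hK : weight_bound psi K) (delta0 : 0 < delta).
Variable g : (R -> R) * (R -> R).
Hypothesis gH : in_H2 g.

Lemma M0_in_H2E lam : 0 < lam ->
  rintegrable (fun r => Aop k lam g.2 r * multiplier k psi delta lam g.1 r) /\
  M0 k psi delta lam g.1 g.2 =
    rint (fun r => Aop k lam g.2 r * multiplier k psi delta lam g.1 r).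
Proof.
move=> l0; case: (gH) => h1 h2 h3 _; apply: (M0E hk psi_smooth K0 hK delta0) => //.
  exact: pos_measurable_Aop.
apply: (rintegrable_dom _ _ (rintegrableZ (1 + k%:R) (rintegrable_jet_prod gH))).
  apply: pos_measurableM; last exact: in_H2_measurable_jet2.
  by apply: pos_measurable_norm; exact: pos_measurable_Aop.
move=> r r0; rewrite ger0_norm ?mulr_ge0 ?jet_ge0// [jet 2 _ _ * _]mulrC mulrA.
by apply: ler_wpM2r; [exact: jet_ge0|exact: norm_Aop1].
Qed.

Lemma M0_bounded lam : 0 < lam -> `|M0 k psi delta lam g.1 g.2| <=
  (1 + k%:R) * Cmult k delta K * rint (fun r => jet 2 g.1 r * jet 1 g.2 r).
Proof.
move=> l0; have [Ni ->] := M0_in_H2E l0.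
rewrite -rintZ; last exact: rintegrable_jet_prod.
apply: rint_norm_le => //; first by apply: rintegrableZ; exact: rintegrable_jet_prod.
move=> r r0; apply: (le_trans (normM_le (norm_Aop1 k lam g.2 r0) (norm_Xop1 k K0 hK delta0 g.1 l0 r0))).
by apply: eq_ge; ring.
Qed.

End Boundedness.

(** * Modulation vectors *)

Section ModulationVectors.
Variables (R : realType) (k : nat) (psi : R -> R) (delta K : R).
Hypotheses (hk : (2 <= k)%N) (psi_smooth : smooth_pos psi) (K0 : 0 < K)
  (hK : weight_bound psi K) (delta0 : 0 < delta).
Variable g : (R -> R) * (R -> R).
Hypothesis gH : in_H2 g.
Implicit Types (r li lj c kappa : R).

Local Notation k' := (k%:R : R).

(** The modulation vector at scale [lj]; it is used with [c = iota_j / lam_j]. *)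
Definition LQ c lj : R -> R := fun r => c * LambdaQ k (r / lj).

Lemma LQE c lj r : 0 < lj -> 0 < r -> LQ c lj r = c * (k' * sinQ k lj r).
Proof.
by move=> l0 r0; rewrite /LQ LambdaQE ?divr_gt0// /sinQ divr1.
Qed.

Lemma smooth_pos_LQ c lj : 0 < lj -> smooth_pos (LQ c lj).
Proof.
move=> l0; apply: (@smooth_pos_eq _ (fun r => c * (k' * sinQ k lj r))).
  by move=> r r0; rewrite LQE.
apply: smooth_posM; first exact: smooth_pos_cst.
by apply: smooth_posM; [exact: smooth_pos_cst|exact: smooth_pos_sinQ].
Qed.

(* [A_lambda] annihilates the profile [Lambda Q_lambda] of the same scale. *)
Lemma Aop_LQ c li lj r : 0 < lj -> 0 < r ->
  Aop k li (LQ c lj) r = c * k' ^+ 2 * sinQ k lj r * (cosQ k li r - cosQ k lj r) / r.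
Proof.
move=> l0 r0; rewrite /Aop LQE//.
have d : is_derive r (1 : R) (LQ c lj) (c * (k' * (k' * sinQ k lj r * cosQ k lj r / r))).
  apply: (@is_derive_pos _ (fun r => c * (k' * sinQ k lj r)) _ _ _ r0).
    by move=> s s0; rewrite LQE.
  apply: is_derive_eq (drM (drC c r) (drM (drC k' r) (is_derive_sinQ hk l0 r0))) _.
  by ring.
by rewrite (is_derive1E d) /cosQ /scale; field; rewrite gt_eqF.
Qed.

Lemma norm_Aop_LQ c li lj r : 0 < lj -> 0 < r ->
  `|Aop k li (LQ c lj) r| <= 64 * k' ^+ 2 * (`|c| * (r * lj ^+ 2 / (lj + r) ^+ 4)).
Proof.
move=> l0 r0; rewrite Aop_LQ//.
rewrite [X in `|X|](_ : _ = c * k' ^+ 2 * (sinQ k lj r / r) * (cosQ k li r - cosQ k lj r)); last by ring.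
have hC := normB_le (norm_cosQ k li r) (norm_cosQ k lj r).
have hS : `|sinQ k lj r / r| <= 32 * (r * lj ^+ 2 / (lj + r) ^+ 4).
  have S0 := sinQ_ge0 k l0 r0.
  rewrite ger0_norm; last by rewrite divr_ge0// ltW.
  rewrite ler_pdivrMr//.
  apply: (le_trans (sinQ_le hk l0 r0)); apply: eq_ge.
  by field; rewrite gt_eqF// addr_gt0.
have hc : `|c * k' ^+ 2| <= `|c| * k' ^+ 2 by rewrite normrM [`|k' ^+ 2|]ger0_norm// exprn_ge0.
apply: (le_trans (normM_le (normM_le hc hS) hC)).
by apply: eq_ge; ring.
Qed.

Definition Cmod : R := 64 * k' ^+ 2 * Cmult k delta K.

(** The comparison of weights left by Cauchy-Schwarz. For [kappa = 1] it only uses [lj <= lj + r]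
    and [r <= li + r]; when [lj <= kappa * li], the factor [lj] is traded for [kappa * li] and
    [li * r <= (li + r) ^+ 2] absorbs the rest. *)
Lemma weight_off_diagonal li lj kappa r : 0 < li -> 0 < lj -> 0 < r ->
  kappa = 1 \/ lj <= kappa * li -> 0 < kappa ->
  lj * r ^+ 5 <= kappa * ((lj + r) ^+ 4 * (li + r) ^+ 2).
Proof.
move=> li0 lj0 r0 hkap kap0.
have s0 : 0 < lj + r by rewrite addr_gt0.
have t0 : 0 < li + r by rewrite addr_gt0.
have r4 : r ^+ 4 <= (lj + r) ^+ 4 by rewrite lerXn2r ?nnegrE ?lerDr ?ltW.
case: hkap => [->|hl].
  rewrite mul1r (_ : r ^+ 5 = r ^+ 3 * r ^+ 2); last by ring.
  rewrite mulrA; apply: ler_pM; rewrite ?mulr_ge0 ?exprn_ge0 ?ltW//; last first.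
    by rewrite ltrXn2r ?nnegrE ?ltrDr ?ltW.
  rewrite (_ : (lj + r) ^+ 4 = (lj + r) * (lj + r) ^+ 3); last by ring.
  apply: ltr_pM; rewrite ?exprn_ge0 ?ltW// ?ltrDl//.
  by rewrite ltrXn2r ?nnegrE ?ltrDr ?ltW.
apply: (@le_trans _ _ (kappa * li * r ^+ 5)).
  by rewrite ler_pM2r// exprn_gt0.
rewrite -mulrA ler_pM2l// (_ : li * r ^+ 5 = r ^+ 4 * (li * r)); last by ring.
apply: ler_pM => //; rewrite ?exprn_ge0 ?mulr_ge0 ?ltW//.
have := mulr_gt0 li0 r0; have := sqr_ge0 li; have := sqr_ge0 r => *.
rewrite sqrrD -mulr_natl; lra.
Qed.

(** Although the form lives at scale [li], Cauchy-Schwarz is applied with the Morawetz density of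
    scale [lj], where the modulation vector is concentrated. The other factor is [kappa] times the
    weight of mass [lj^-1]. *)
Lemma M0_LQ c li lj kappa : 0 < li -> 0 < lj -> `|c| = lj^-1 ->
  kappa = 1 \/ lj <= kappa * li -> 0 < kappa ->
  M0 k psi delta li g.1 (LQ c lj) ^+ 2 <= 4 * Cmod ^+ 2 * kappa * (lj^-1 * Mor_sq lj g).
Proof.
move=> li0 lj0 hc hkap kap0; case: (gH) => h1 h2 h3 _.
have [wi wE] := rint_weight lj0.
have mi := rintegrable_mor_density gH lj0.
have sLQ := @smooth_pos_LQ c lj lj0.
have mA : pos_measurable (Aop k li (LQ c lj)).
  by apply: pos_measurable_Aop => //; exact: smooth_pos_loc_abs_continuous.
pose B : R := 64 * k' ^+ 2.
have B0 : 0 <= B by rewrite mulr_ge0 ?exprn_ge0.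
have hA2 r : 0 < r -> `|Aop k li (LQ c lj) r| ^+ 2 <=
    (B * (lj^-1 * (r * lj ^+ 2 / (lj + r) ^+ 4))) ^+ 2.
  move=> r0; apply: norm_sqr_le; rewrite normr_id /B -hc; exact: norm_Aop_LQ.
have key r : 0 < r ->
    (`|Aop k li (LQ c lj) r| * jet 2 g.1 r) ^+ 2 * (r / (li + r)) ^+ 2 <=
    mor_density lj g r * (B ^+ 2 * kappa * (r * (lj + r) ^+ 2)^-1).
  move=> r0; have s0 : 0 < lj + r by rewrite addr_gt0.
  have t0 : 0 < li + r by rewrite addr_gt0.
  have J0 : 0 <= jet_sq 2 g.1 r := jet_sq_ge0 2 g.1 r.
  have W0 : 0 <= B ^+ 2 * kappa * (r * (lj + r) ^+ 2)^-1.
    have p : 0 <= r * (lj + r) ^+ 2 by rewrite mulr_ge0 ?exprn_ge0// ltW.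
    by apply: mulr_ge0; [rewrite mulr_ge0 ?exprn_ge0// ltW|rewrite invr_ge0].
  apply: le_trans (ler_wpM2r W0 (mor_density_ge2 g lj0 r0)).
  rewrite exprMn jet_sqr mulrAC [X in _ <= X]mulrAC [jet_sq _ _ _ * _]mulrC.
  rewrite [X in _ <= X]mulrC [X in _ <= X]mulrA; apply: ler_wpM2r => //.
  apply: (le_trans (ler_wpM2r (sqr_ge0 (r / (li + r))) (hA2 r r0))).
  have hw := weight_off_diagonal li0 lj0 r0 hkap kap0.
  (* The common factor that turns the polynomial inequality [hw] into the comparison of weights
     wanted here. *)
  pose P := B ^+ 2 * (lj / (r * (lj + r) ^+ 8 * (li + r) ^+ 2)).
  have P0 : 0 <= P.
    apply: mulr_ge0; first by rewrite exprn_ge0.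
    by apply: divr_ge0; [exact: ltW|rewrite !mulr_ge0 ?exprn_ge0//; exact: ltW].
  have := ler_wpM2l P0 hw.
  rewrite [leLHS](_ : _ = (B * (lj^-1 * (r * lj ^+ 2 / (lj + r) ^+ 4))) ^+ 2 * (r / (li + r)) ^+ 2); last first.
    by rewrite /P; field; rewrite !gt_eqF.
  rewrite [leRHS](_ : _ = B ^+ 2 * kappa / (r * (lj + r) ^+ 2) * (lj / (lj + r) ^+ 2)); last first.
    by rewrite /P; field; rewrite !gt_eqF.
  by move=> hh; rewrite [leRHS]mulrC.
have [Ni ->] : rintegrable (fun r => Aop k li (LQ c lj) r * multiplier k psi delta li g.1 r) /\
    M0 k psi delta li g.1 (LQ c lj) =
    rint (fun r => Aop k li (LQ c lj) r * multiplier k psi delta li g.1 r).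
  apply: (M0E hk psi_smooth K0 hK delta0) => //.
  have wi' := rintegrableZ (B ^+ 2) wi.
  apply: (rintegrable_dom _ _ (rintegrableD mi wi')).
    apply: pos_measurableM; last exact: in_H2_measurable_jet2.
    exact: pos_measurable_norm.
  move=> r r0; have s0 : 0 < lj + r by rewrite addr_gt0.
  (* Integrability needs no gain: the arithmetic-geometric mean inequality with weight 1 dominates
     the product by a sum of two integrable functions. *)
  have := @amgm_param R (`|Aop k li (LQ c lj) r| * jet 2 g.1 r) (mor_density lj g r)
    (B ^+ 2 * (r * (lj + r) ^+ 2)^-1) 1.
  rewrite invr1 !mul1r; apply => //; first exact: mor_density_ge0.
    by rewrite mulr_ge0 ?exprn_ge0// invr_ge0 mulr_ge0 ?exprn_ge0// ltW.
  have W0 : 0 <= B ^+ 2 * (r * (lj + r) ^+ 2)^-1.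
    by rewrite mulr_ge0 ?exprn_ge0// invr_ge0 mulr_ge0 ?exprn_ge0// ltW.
  apply: le_trans (ler_wpM2r W0 (mor_density_ge2 g lj0 r0)).
  rewrite exprMn jet_sqr mulrC -mulrA; apply: ler_wpM2l; first exact: jet_sq_ge0.
  apply: (le_trans (hA2 r r0)).
  pose P := B ^+ 2 * (lj / (r * (lj + r) ^+ 8)).
  have P0 : 0 <= P.
    by rewrite mulr_ge0 ?exprn_ge0// divr_ge0 ?mulr_ge0 ?exprn_ge0// ltW.
  have hw : lj * r ^+ 3 <= (lj + r) ^+ 4.
    rewrite (_ : (lj + r) ^+ 4 = (lj + r) * (lj + r) ^+ 3); last by ring.
    apply: ler_pM; rewrite ?lerDl//; try exact: ltW; first by rewrite exprn_ge0// ltW.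
    by rewrite lerXn2r ?nnegrE ?lerDr//; exact: ltW.
  have := ler_wpM2l P0 hw.
  rewrite [leLHS](_ : _ = (B * (lj^-1 * (r * lj ^+ 2 / (lj + r) ^+ 4))) ^+ 2); last first.
    by rewrite /P; field; rewrite !gt_eqF.
  rewrite [leRHS](_ : _ = lj / (lj + r) ^+ 2 * (B ^+ 2 / (r * (lj + r) ^+ 2))); last first.
    by rewrite /P; field; rewrite !gt_eqF.
  by [].
have wi' := rintegrableZ (Cmult k delta K ^+ 2 * (B ^+ 2 * kappa)) wi.
have CX0 := Cmult_gt0 k K0 delta0.
apply: (le_trans (rint_cauchy_schwarz Ni mi wi' _ _ _)).
- by move=> r r0; exact: mor_density_ge0.
- move=> r r0; have s0 : 0 < lj + r by rewrite addr_gt0.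
  apply: mulr_ge0; first by rewrite mulr_ge0 ?sqr_ge0// mulr_ge0 ?sqr_ge0// ltW.
  by rewrite invr_ge0 mulr_ge0 ?sqr_ge0// ltW.
- move=> r r0; rewrite exprMn.
  have hX := norm_sqr_le (norm_Xop k K0 hK delta0 g.1 li0 r0).
  apply: (le_trans (ler_wpM2l (sqr_ge0 _) hX)).
  have := ler_wpM2l (sqr_ge0 (Cmult k delta K)) (key r r0).
  rewrite [leLHS](_ : _ = `|Aop k li (LQ c lj) r| ^+ 2 * (Cmult k delta K * (r / (li + r)) * jet 2 g.1 r) ^+ 2); last by ring.
  rewrite real_normK ?num_real// => /le_trans; apply.
  by apply: eq_ge; ring.
rewrite rintZ// wE -Mor_sqE /Cmod -/B; apply: eq_ge; ring.
Qed.

End ModulationVectors.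

(** * Derivative in the scale *)

Section ScaleDerivative.
Variables (R : realType) (k : nat) (psi : R -> R) (delta K : R).
Hypotheses (hk : (2 <= k)%N) (psi_smooth : smooth_pos psi) (K0 : 0 < K)
  (hK : weight_bound psi K) (delta0 : 0 < delta).
Implicit Types (f : R -> R) (r l lam : R).

Local Notation k' := (k%:R : R).
Local Notation wt0 := (psi_weight psi). Local Notation wt1 := (psi_weight1 psi).
Local Notation wt2 := (psi_weight2 psi). Local Notation sig := (zeroth_weight psi delta).
Local Notation Xop := (multiplier k psi delta). Local Notation dAop := (dAop k).

(* The prefix [l] stands for [lambda d/dlambda]. *)
Definition lA l f r : R := k' ^+ 2 * sinQ k l r ^+ 2 * (f r / r).
Definition ldA l f r : R :=
  k' ^+ 2 * sinQ k l r ^+ 2 * (derive1 f r / r) +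
  k' ^+ 2 * sinQ k l r ^+ 2 * (2 * k' * cosQ k l r - 1) * (f r / r ^+ 2).
Definition lsig l r : R := - (2^-1 * (r * wt2 l r + 2 * wt1 l r)) -
  delta * (l * (r - l) / (r + l) ^+ 3).
Definition lX l f r : R :=
  - (r * wt1 l r) * dAop l f r + wt0 l r * ldA l f r + lsig l r * Aop k l f r + sig l r * lA l f r.

Lemma is_derive_Aop_scale l f r : 0 < l -> 0 < r ->
  is_derive l (1 : R) (fun l => Aop k l f r) (lA l f r / l).
Proof.
move=> l0 r0.
have h := drM (drM (drM (drC k' l) (is_derive_cosQ_scale hk l0 r0)) (drC r^-1 l)) (drC (f r) l).
apply: is_derive_eq (drD (drC (- derive1 f r) l) h) _.
by rewrite /lA; field; rewrite !gt_eqF.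
Qed.

Lemma is_derive_dAop_scale l f r : 0 < l -> 0 < r ->
  is_derive l (1 : R) (fun l => dAop l f r) (ldA l f r / l).
Proof.
move=> l0 r0; have dC := is_derive_cosQ_scale hk l0 r0; have dS := is_derive_sinQ_scale hk l0 r0.
have h1 := drM (drM (drM (drC k' l) dC) (drC r^-1 l)) (drC (derive1 f r) l).
have h2 := drM (drM (drM (drC k' l) (drD (drM (drC k' l) (drX2 dS)) dC)) (drC (r ^- 2) l)) (drC (f r) l).
apply: is_derive_eq (drB (drD (drC (- derive1 (derive1 f) r) l) h1) h2) _.
by rewrite /ldA; field; rewrite !gt_eqF.
Qed.

Lemma is_derive_wt0_scale l r : 0 < l -> 0 < r ->
  is_derive l (1 : R) (fun l => wt0 l r) (- (r * wt1 l r) / l).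
Proof.
move=> l0 r0; apply: is_derive_eq (is_derive_dilation psi_smooth l0 r0) _.
by rewrite /psi_weight1; field; rewrite gt_eqF.
Qed.

Lemma is_derive_wt1_scale l r : 0 < l -> 0 < r ->
  is_derive l (1 : R) (fun l => wt1 l r) (- (r * wt2 l r + wt1 l r) / l).
Proof.
move=> l0 r0; have ln : l != 0 by rewrite gt_eqF.
have h := is_derive_dilation (smooth_pos_derive1 psi_smooth) l0 r0.
apply: is_derive_eq (drM h (drV ln (drI l))) _.
by rewrite /psi_weight1 /psi_weight2; field.
Qed.

Lemma is_derive_wtd_scale l r : 0 < l -> 0 < r ->
  is_derive l (1 : R) (fun l => wtd l r) ((l * (r - l) / (r + l) ^+ 3) / l).
Proof.
move=> l0 r0; have sn : (r + l) != 0 by rewrite gt_eqF// addr_gt0.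
have sn2 : (r + l) ^+ 2 != 0 by rewrite expf_neq0.
have h := drV (f := fun l => (r + l) ^+ 2) sn2 (drX2 (drD (drC r l) (drI l))).
apply: is_derive_eq (drM (drI l) h) _.
by field; rewrite sn gt_eqF.
Qed.

Lemma is_derive_sig_scale l r : 0 < l -> 0 < r ->
  is_derive l (1 : R) (fun l => sig l r) (lsig l r / l).
Proof.
move=> l0 r0.
have h := drM (drC 2^-1 l) (drD (is_derive_wt1_scale l0 r0)
  (drM (drC r^-1 l) (is_derive_wt0_scale l0 r0))).
apply: is_derive_eq (drB h (drM (drC delta l) (is_derive_wtd_scale l0 r0))) _.
by rewrite /lsig; field; rewrite !gt_eqF ?addr_gt0.
Qed.

Lemma is_derive_Xop_scale l f r : 0 < l -> 0 < r ->
  is_derive l (1 : R) (fun l => Xop l f r) (lX l f r / l).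
Proof.
move=> l0 r0.
have h1 := drM (is_derive_wt0_scale l0 r0) (is_derive_dAop_scale f l0 r0).
have h2 := drM (is_derive_sig_scale l0 r0) (is_derive_Aop_scale f l0 r0).
apply: is_derive_eq (drD h1 h2) _.
by rewrite /lX; field; rewrite gt_eqF.
Qed.

Lemma sinQ_sqr_le l r : 0 < l -> 0 < r -> `|sinQ k l r ^+ 2| <= 32 * (l / (l + r)).
Proof.
move=> l0 r0; have S0 := sinQ_ge0 k l0 r0; have s0 : 0 < l + r by rewrite addr_gt0.
have S1 : sinQ k l r <= 1 := le_trans (ler_norm _) (norm_sinQ k l r).
rewrite ger0_norm ?sqr_ge0//; apply: (@le_trans _ _ (sinQ k l r)).
  by rewrite expr2 ler_piMl.
apply: (le_trans (sinQ_le hk l0 r0)); rewrite ler_pM2l//.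
rewrite ler_pdivrMr ?exprn_gt0// [leRHS](_ : _ = l * (l + r) ^+ 3); last first.
  by field; rewrite gt_eqF.
rewrite (_ : r ^+ 2 * l ^+ 2 = l * (l * r ^+ 2)); last by ring.
rewrite ler_pM2l// (_ : (l + r) ^+ 3 = (l + r) * (l + r) ^+ 2); last by ring.
apply: ler_pM; rewrite ?sqr_ge0 ?lerDl//; try exact: ltW.
by rewrite lerXn2r ?nnegrE ?lerDr//; exact: ltW.
Qed.

Definition Cscale : R := 32 * k' ^+ 2 * Cmult k delta K +
  (1 + k') * (K * (1 + k') ^+ 2 + K * (32 * k' ^+ 2 * (2 + 2 * k')) +
   (2 * K + delta) * (1 + k') + (K + delta) * (32 * k' ^+ 2)).

Lemma norm_lA1 l f r : 0 < l -> 0 < r ->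
  `|lA l f r| <= 32 * k' ^+ 2 * (l / (l + r)) * jet 1 f r.
Proof.
move=> l0 r0; apply: normM_le (jet1_id f r); rewrite (_ : 32 * k' ^+ 2 * (l / (l + r)) = k' ^+ 2 * (32 * (l / (l + r)))); last by ring.
apply: normM_le.
  by rewrite ger0_norm ?exprn_ge0.
exact: sinQ_sqr_le.
Qed.

Lemma norm_lA2 l f r : 0 < l -> 0 < r ->
  `|lA l f r / r| <= 32 * k' ^+ 2 * (l / (l + r)) * jet 2 f r.
Proof.
move=> l0 r0.
rewrite (_ : lA l f r / r = k' ^+ 2 * sinQ k l r ^+ 2 * (f r / r ^+ 2)); last first.
  by rewrite /lA; field; rewrite gt_eqF.
apply: normM_le (jet2_id f r); rewrite (_ : 32 * k' ^+ 2 * (l / (l + r)) = k' ^+ 2 * (32 * (l / (l + r)))); last by ring.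
apply: normM_le.
  by rewrite ger0_norm ?exprn_ge0.
exact: sinQ_sqr_le.
Qed.

Lemma norm_ldA l f r : 0 < l -> 0 < r ->
  `|ldA l f r| <= 32 * k' ^+ 2 * (2 + 2 * k') * (l / (l + r)) * jet 2 f r.
Proof.
move=> l0 r0.
have hS : `|k' ^+ 2 * sinQ k l r ^+ 2| <= k' ^+ 2 * (32 * (l / (l + r))).
  by apply: normM_le (sinQ_sqr_le l0 r0); rewrite ger0_norm ?exprn_ge0.
have hC : `|2 * k' * cosQ k l r - 1| <= 2 * k' * 1 + 1.
  apply: normB_le; last by rewrite normr1.
  by apply: normM_le (norm_cosQ k l r); rewrite ger0_norm ?mulr_ge0.
have h1 := normM_le hS (jet2_derive1 f r).
have h2 := normM_le (normM_le hS hC) (jet2_id f r).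
apply: (le_trans (normD_le h1 h2)).
by apply: eq_ge; ring.
Qed.

Lemma norm_lsig l r : 0 < l -> 0 < r ->
  `|r * lsig l r| <= (2 * K + delta) * (l / (l + r)).
Proof.
move=> l0 r0; have s0 : 0 < l + r by rewrite addr_gt0.
have h2 : `|2^-1 * (r * wt2 l r + 2 * wt1 l r)| <= 2 * K * (l / (l + r) ^+ 2).
  have n2 : `|2 : R| <= 2 by rewrite ger0_norm.
  have h := normD_le (norm_wt2 hK l0 r0) (normM_le n2 (norm_wt1 hK l0 r0)).
  rewrite normrM ger0_norm ?invr_ge0// ler_pdivrMl//; apply: (le_trans h).
  have : 0 <= K * (l / (l + r) ^+ 2) by rewrite mulr_ge0 ?lam_ratio_ge0// ltW.
  lra.
have h3 : `|delta * (l * (r - l) / (r + l) ^+ 3)| <= delta * (l / (l + r) ^+ 2).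
  apply: normM_le; first by rewrite gtr0_norm.
  rewrite (addrC r l) normrM normrM (gtr0_norm l0) [`|_^-1|]gtr0_norm ?invr_gt0 ?exprn_gt0//.
  have h : `|r - l| <= l + r by rewrite ler_norml; apply/andP; split; lra.
  rewrite ler_pdivrMr ?exprn_gt0//.
  rewrite [leRHS](_ : _ = l * (l + r)); last by field; rewrite gt_eqF.
  by rewrite ler_pM2l.
have rr : `|r| <= r by rewrite gtr0_norm.
have h := normM_le rr (normB_le (normN_le h2) h3).
apply: (le_trans h); rewrite -mulrDl mulrCA ler_pM2l; last by rewrite addr_gt0// mulr_gt0.
rewrite mulrA ler_pdivrMr ?exprn_gt0// expr2 mulrA divfK ?gt_eqF// mulrC ler_pM2l//.
by rewrite lerDr ltW.
Qed.

Lemma norm_lX l f r : 0 < l -> 0 < r ->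
  `|lX l f r| <= (K * (1 + k') ^+ 2 + K * (32 * k' ^+ 2 * (2 + 2 * k')) +
   (2 * K + delta) * (1 + k') + (K + delta) * (32 * k' ^+ 2)) * (l / (l + r)) * jet 2 f r.
Proof.
move=> l0 r0; have s0 : 0 < l + r by rewrite addr_gt0.
rewrite [X in `|X|](_ : _ = - (r * wt1 l r) * dAop l f r + wt0 l r * ldA l f r +
   (r * lsig l r) * (Aop k l f r / r) + (r * sig l r) * (lA l f r / r)); last first.
  by rewrite /lX; field; rewrite gt_eqF.
have rr : `|r| <= r by rewrite gtr0_norm.
have t1 : r / (l + r) <= 1 by rewrite ler_pdivrMr// mul1r lerDr ltW.
have h1 : `|- (r * wt1 l r)| <= K * (l / (l + r)).
  apply: normN_le; apply: (le_trans (normM_le rr (norm_wt1 hK l0 r0))).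
  rewrite mulrCA ler_pM2l// [leLHS](_ : _ = (l / (l + r)) * (r / (l + r))); last first.
    by field; rewrite gt_eqF.
  by rewrite ler_piMr// divr_ge0// ltW.
have h2 : `|wt0 l r| <= K.
  by apply: (le_trans (norm_wt0 hK l0 r0)); rewrite ler_piMr// ltW.
have h4 : `|r * sig l r| <= K + delta.
  apply: (le_trans (normM_le rr (norm_sig K0 hK delta0 l0 r0))).
  by rewrite mulrCA ler_piMr// addr_ge0// ltW.
have h := normD_le (normD_le (normD_le (normM_le h1 (norm_dAop k l f r0))
  (normM_le h2 (norm_ldA f l0 r0))) (normM_le (norm_lsig l0 r0) (norm_Aop2 k l f r0)))
  (normM_le h4 (norm_lA2 f l0 r0)).
apply: (le_trans h).
by apply: eq_ge; ring.
Qed.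

Variable g : (R -> R) * (R -> R).
Hypothesis gH : in_H2 g.

Definition dN l r : R := lA l g.2 r * Xop l g.1 r + Aop k l g.2 r * lX l g.1 r.

(** Differentiation in the scale gains [l / (l + r)] over the original density. The square of this
    gain is [l] times the Morawetz weight [l / (l + r) ^+ 2], so one jet can be measured in the
    Morawetz norm at the price of [l^(1/2)]. *)
Lemma norm_dN l r : 0 < l -> 0 < r ->
  `|dN l r| <= Cscale * (l / (l + r)) * (jet 2 g.1 r * jet 1 g.2 r).
Proof.
move=> l0 r0.
have h1 := normM_le (norm_lA1 g.2 l0 r0) (norm_Xop1 k K0 hK delta0 g.1 l0 r0).
have h2 := normM_le (norm_Aop1 k l g.2 r0) (norm_lX g.1 l0 r0).
apply: (le_trans (normD_le h1 h2)).
by rewrite /Cscale; apply: eq_ge; ring.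
Qed.

End ScaleDerivative.

(** * Differentiation in the scale under the integral sign *)

Section ScaleDerivativeIntegral.
Variables (R : realType) (k : nat) (psi : R -> R) (delta K : R).
Hypotheses (hk : (2 <= k)%N) (psi_smooth : smooth_pos psi) (K0 : 0 < K)
  (hK : weight_bound psi K) (delta0 : 0 < delta).
Variable g : (R -> R) * (R -> R).
Hypothesis gH : in_H2 g.
Implicit Types (r l lam : R).
Local Notation mu := (@lebesgue_measure R).
Local Notation pos := (`]0%R, +oo[%classic : set R).

Let N l r := Aop k l g.2 r * multiplier k psi delta l g.1 r.
Let dNl := dN k psi delta g.

Lemma Cscale_ge0 : 0 <= Cscale k delta K.
Proof.
have k0 : 0 <= k%:R :> R by [].
have := Cmult_gt0 k K0 delta0; rewrite /Cscale => CX0.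
have d0 := ltW delta0; have Kp := ltW K0.
by do ![apply: addr_ge0|apply: mulr_ge0|exact: ltW|apply: exprn_ge0|done].
Qed.

Lemma pos_measurable_lA l (f : R -> R) : 0 < l -> pos_measurable f ->
  pos_measurable (lA k l f).
Proof.
move=> l0 mf; apply: pos_measurableM.
  apply: smooth_pos_measurable; apply: smooth_posM; first exact: smooth_pos_cst.
  exact: smooth_posX (smooth_pos_sinQ hk l0).
by apply: pos_measurableM mf _; exact: smooth_pos_measurable (@smooth_pos_inv R).
Qed.

Lemma is_derive_N l r : 0 < l -> 0 < r ->
  is_derive l (1 : R) (fun l => N l r * r) (dNl l r / l * r).
Proof.
move=> l0 r0.
have h := drM (is_derive_Aop_scale hk g.2 l0 r0)
  (is_derive_Xop_scale delta hk psi_smooth g.1 l0 r0).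
apply: is_derive_eq (drM h (drC r l)) _.
by rewrite /dNl /dN; field; rewrite gt_eqF.
Qed.

Lemma pos_measurable_dN l : 0 < l -> pos_measurable (dNl l).
Proof.
move=> l0; case: gH => h1 h2 h3 _.
have sI := @smooth_pos_id R. have sV := @smooth_pos_inv R.
have sS := smooth_pos_sinQ hk l0. have sC := smooth_pos_cosQ hk l0.
have m1 := lac_measurable h1. have m1' := lac_measurable_derive1 h1.
have mA2 := pos_measurable_Aop hk l0 h3. have mA1 := pos_measurable_Aop hk l0 h1.
have sk : smooth_pos (fun r => k%:R ^+ 2 * sinQ k l r ^+ 2).
  by apply: smooth_posM (smooth_posX sS); exact: smooth_pos_cst.
have s2 : smooth_pos (psi_weight2 psi l).
  apply: smooth_posM; last exact: smooth_pos_cst.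
  exact: (smooth_pos_rescale l0 (smooth_pos_derive1 (smooth_pos_derive1 psi_smooth))).
have mld : pos_measurable (ldA k l g.1).
  apply: pos_measurableD; apply: pos_measurableM.
  - exact: smooth_pos_measurable.
  - by apply: pos_measurableM m1' _; exact: smooth_pos_measurable.
  - apply: smooth_pos_measurable; apply: smooth_posM sk _; apply: smooth_posD.
      by apply: smooth_posM sC; exact: smooth_pos_cst.
    exact: smooth_pos_cst.
  - apply: pos_measurableM m1 _; apply: smooth_pos_measurable; apply: smooth_posV.
      by move=> r r0; rewrite expf_neq0// gt_eqF.
    exact: smooth_posX.
have sls : smooth_pos (lsig psi delta l).
  apply: smooth_posD; apply: smooth_posN.
    apply: smooth_posM; first exact: smooth_pos_cst.
    apply: smooth_posD; first exact: smooth_posM.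
    by apply: smooth_posM (smooth_pos_wt1 psi_smooth l0); exact: smooth_pos_cst.
  apply: smooth_posM; first exact: smooth_pos_cst.
  apply: smooth_posM.
    apply: smooth_posM; first exact: smooth_pos_cst.
    by apply: smooth_posD sI _; exact: smooth_pos_cst.
  apply: smooth_posV; first by move=> r r0; rewrite expf_neq0// gt_eqF// addr_gt0.
  by apply: smooth_posX; apply: smooth_posD sI _; exact: smooth_pos_cst.
have mlX : pos_measurable (lX k psi delta l g.1).
  apply: pos_measurableD; first apply: pos_measurableD; first apply: pos_measurableD.
  - apply: pos_measurableM; last exact: pos_measurable_dAop.
    apply: smooth_pos_measurable; apply: smooth_posN.
    exact: smooth_posM sI (smooth_pos_wt1 psi_smooth l0).
  - by apply: pos_measurableM mld; exact: smooth_pos_measurable (smooth_pos_wt0 psi_smooth l0).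
  - by apply: pos_measurableM mA1; exact: smooth_pos_measurable.
  - apply: pos_measurableM; first exact: smooth_pos_measurable (@smooth_pos_sig R psi delta psi_smooth l l0).
    exact: pos_measurable_lA.
apply: pos_measurableD; last exact: pos_measurableM.
apply: pos_measurableM; last exact: pos_measurable_Xop.
by apply: pos_measurable_lA => //; exact: lac_measurable.
Qed.

Let jj r := jet 2 g.1 r * jet 1 g.2 r.

Lemma jj_ge0 r : 0 <= jj r. Proof. by rewrite mulr_ge0 ?jet_ge0. Qed.

Lemma M0_scale_derivative lam : 0 < lam ->
  is_derive lam (1 : R) (fun l => M0 k psi delta l g.1 g.2) (rint (fun r => dNl lam r / lam)).
Proof.
move=> l0; have l20 : 0 < lam / 2 by rewrite divr_gt0.
have mp : measurable (pos : set (measurableTypeR R)) by exact: measurable_itv.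
have I0 l : `](lam / 2), (lam * 2)[%classic l -> 0 < l.
  by rewrite /= in_itv /= => /andP[h _]; exact: lt_trans h.
have Ia : `](lam / 2), (lam * 2)[%classic lam.
  rewrite /= in_itv /=; apply/andP; split.
    by rewrite ltr_pdivrMr// ltr_pMr// ltr1n.
  by rewrite ltr_pMr// ltr1n.
pose f l r := N l r * r.
have intf l : `](lam / 2), (lam * 2)[%classic l -> mu.-integrable pos (EFin \o f l).
  by move=> /I0 l1; have [h _] := M0_in_H2E hk psi_smooth K0 hK delta0 gH l1.
have derf l r : `](lam / 2), (lam * 2)[%classic l -> pos r -> derivable (f ^~ r) l 1.
  by move=> /I0 l1 /posP r0; exact: is_derive_derivable (is_derive_N l1 r0).
(* On the interval from [lam / 2] to [2 lam] the factor [1 / l] is at most [2 / lam], and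
   [l / (l + r)] is at most 1. *)
pose c := Cscale k delta K * (2 / lam).
have c0 : 0 <= c by apply: mulr_ge0; [exact: Cscale_ge0|rewrite divr_ge0// ltW].
(* The absolute value makes the dominating function nonnegative on the whole line, also where
   [r < 0]. *)
pose G r := c * (jj r * `|r|).
have G0 r : 0 <= G r by apply: mulr_ge0 => //; apply: mulr_ge0 => //; exact: jj_ge0.
have intG : mu.-integrable pos (EFin \o G).
  have := rintegrableZ c (rintegrable_jet_prod gH).
  apply: eq_integrable => // r; rewrite in_posP => r0.
  by rewrite /= /G /jj gtr0_norm//; congr EFin; ring.
have Gub l r : `](lam / 2), (lam * 2)[%classic l -> pos r -> `|partial1of2 f l r| <= G r.
  move=> Il /posP r0; have l1 := I0 _ Il.
  rewrite /partial1of2 (is_derive1E (is_derive_N l1 r0)) /G normrM mulrA.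
  apply: ler_wpM2r => //; rewrite normrM [`|l^-1|]gtr0_norm ?invr_gt0//.
  rewrite ler_pdivrMr//; apply: (le_trans (norm_dN hk K0 hK delta0 g l1 r0)).
  rewrite -/(jj r) [leRHS]mulrAC; apply: ler_wpM2r; first exact: jj_ge0.
  rewrite /c -mulrA; apply: ler_wpM2l; first exact: Cscale_ge0.
  have lle : lam / 2 < l by move: Il; rewrite /= in_itv /= => /andP[].
  apply: (@le_trans _ _ 1).
    by rewrite ler_pdivrMr ?addr_gt0// mul1r lerDl ltW.
  rewrite mulrAC ler_pdivlMr// mul1r; move: lle; rewrite ltr_pdivrMr// mulrC; exact: ltW.
have dF := derivable_under_integral mp Ia intf derf G0 intG Gub.
have vF := differentiation_under_integral mp Ia intf derf G0 intG Gub.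
have FE : \forall l \near lam, (fun l => \int[mu]_(r in pos) f l r) l = M0 k psi delta l g.1 g.2.
  near=> l; have l1 : 0 < l by near: l; exact: lt_nbhsr.
  by have [_ ->] := M0_in_H2E hk psi_smooth K0 hK delta0 gH l1.
have := derivable_is_derive1 dF; rewrite vF => h.
rewrite /rint; apply: (near_eq_is_derive FE); apply: is_derive_eq h _.
apply: eq_Rintegral => r; rewrite in_posP => r0.
exact: is_derive1E (is_derive_N l0 r0).
Unshelve. all: by end_near. Qed.

Lemma M0_scale_derivative_le lam : 0 < lam ->
  (lam * rint (fun r => dNl lam r / lam)) ^+ 2 <=
  4 * Cscale k delta K ^+ 2 * (lam * H2norm g ^+ 2 * Mor_sq lam g).
Proof.
move=> l0.
have mi := rintegrable_mor_density gH l0; have Hi := in_H2_rintegrable gH.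
have ji := rintegrable_jet_prod gH.
have c0 := Cscale_ge0.
have bnd r : 0 < r -> `|dNl lam r| <= Cscale k delta K * (lam / (lam + r)) * jj r.
  by move=> r0; exact: norm_dN.
have di : rintegrable (dNl lam).
  apply: (rintegrable_dom (pos_measurable_dN l0) _ (rintegrableZ (Cscale k delta K) ji)) => r r0.
  apply: (le_trans (bnd r r0)); rewrite -mulrA; apply: ler_wpM2l => //.
  by rewrite ler_piMl ?jj_ge0// ler_pdivrMr ?addr_gt0// mul1r lerDl ltW.
have -> : lam * rint (fun r => dNl lam r / lam) = rint (dNl lam).
  rewrite -rintZ; last by apply: rintegrable_eq (rintegrableZ lam^-1 di) => r _; rewrite mulrC.
  by apply: rint_eq => r _; rewrite mulrCA divff ?mulr1// gt_eqF.
have ui := rintegrableZ (Cscale k delta K ^+ 2) Hi.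
have wi := rintegrableZ lam mi.
apply: (le_trans (rint_cauchy_schwarz di ui wi _ _ _)).
- by move=> r _; rewrite mulr_ge0 ?sqr_ge0 ?H2_density_ge0.
- by move=> r r0; rewrite mulr_ge0 ?mor_density_ge0// ltW.
- move=> r r0; have s0 : 0 < lam + r by rewrite addr_gt0.
  have := norm_sqr_le (bnd r r0) => /le_trans; apply.
  have h1 : lam * (jet_sq 1 g.2 r * (lam / (lam + r) ^+ 2)) <= lam * mor_density lam g r.
    by rewrite ler_pM2l// mor_density_ge1.
  have h2 : jet_sq 2 g.1 r <= H2_density g r by rewrite lerDl jet_sq_ge0.
  rewrite [leLHS](_ : _ = Cscale k delta K ^+ 2 * (jet_sq 2 g.1 r *
     (lam * (jet_sq 1 g.2 r * (lam / (lam + r) ^+ 2))))); last first.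
    by rewrite /jj -!jet_sqr; field; rewrite gt_eqF.
  rewrite -[leRHS]mulrA; apply: ler_wpM2l; first exact: sqr_ge0.
  apply: ler_pM => //; first exact: jet_sq_ge0.
  by apply: mulr_ge0; [exact: ltW|apply: mulr_ge0; [exact: jet_sq_ge0|exact: lam_ratio_ge0]].
rewrite !rintZ// H2norm_sqr -Mor_sqE; apply: eq_ge; ring.
Qed.

End ScaleDerivativeIntegral.

(** * Extension from test functions *)

Section TestPairs.
Variable R : realType.
Local Notation pair := ((R -> R) * (R -> R))%type.
Implicit Types (g h phi : pair) (r lam : R).

Definition test_pair phi := test_fun phi.1 /\ test_fun phi.2.

Definition subp phi g : pair := (phi.1 \- g.1, phi.2 \- g.2).

Lemma test_pairB phi h : test_pair phi -> test_pair h -> test_pair (subp phi h).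
Proof.
move=> [p1 p2] [h1 h2]; split.
  exact: test_funD p1 (test_funN h1).
exact: test_funD p2 (test_funN h2).
Qed.

Lemma test_funX2 (f : R -> R) : test_fun f -> test_fun (fun r => f r ^+ 2).
Proof.
move=> ft; apply: test_fun_eq (test_funMr ft ft.1) => r _; by rewrite expr2.
Qed.

Lemma test_fun_jet1 (f : R -> R) : test_fun f -> test_fun (jet_sq 1 f).
Proof.
move=> ft; apply: (@test_fun_eq _ (fun r => derive1 f r ^+ 2 + (f r * r^-1) ^+ 2)).
  by move=> r _; rewrite jet_sq1E.
apply: test_funD; apply: test_funX2; first exact: test_fun_derive1.
exact: test_funMr ft (@smooth_pos_inv R).
Qed.

Lemma test_fun_jet2 (f : R -> R) : test_fun f -> test_fun (jet_sq 2 f).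
Proof.
move=> ft; have f't := test_fun_derive1 ft; have sV := @smooth_pos_inv R.
apply: (@test_fun_eq _ (fun r => derive1 (derive1 f) r ^+ 2 + (derive1 f r * r^-1) ^+ 2 +
    (f r * (r^-1 * r^-1)) ^+ 2)).
  by move=> r _; rewrite jet_sq2E -invfM -expr2.
apply: test_funD; first apply: test_funD; apply: test_funX2.
- exact: test_fun_derive1.
- exact: test_funMr f't sV.
- exact: test_funMr ft (smooth_posM sV sV).
Qed.

Lemma test_pair_H2_density phi : test_pair phi -> rintegrable (H2_density phi).
Proof.
move=> [p1 p2]; apply: test_fun_rintegrable; apply: test_funD.
  exact: test_fun_jet2.
exact: test_fun_jet1.
Qed.

Lemma test_pair_in_H2 phi : test_pair phi -> in_H2 phi.
Proof.
move=> pt; have [p1 p2] := pt; split; last exact: test_pair_H2_density.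
- exact: smooth_pos_loc_abs_continuous p1.1.
- exact: smooth_pos_loc_abs_continuous (smooth_pos_derive1 p1.1).
- exact: smooth_pos_loc_abs_continuous p2.1.
Qed.

Lemma derive1_sub (f e : R -> R) r : derivable f r 1 -> derivable e r 1 ->
  derive1 (f \- e) r = derive1 f r - derive1 e r.
Proof.
move=> /derivable_is_derive1 df /derivable_is_derive1 de.
exact: is_derive1E (drB df de).
Qed.

(** The density of [subp phi g], written with differences of derivatives. The derivative of a
    difference need not split where [g] is not derivable, so the two agree only almost everywhere;
    pointwise inequalities are proved for this one. *)
Definition dist_density phi g r : R :=
  (derive1 (derive1 phi.1) r - derive1 (derive1 g.1) r) ^+ 2 +
  ((derive1 phi.1 r - derive1 g.1 r) / r) ^+ 2 + ((phi.1 r - g.1 r) / r ^+ 2) ^+ 2 +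
  ((derive1 phi.2 r - derive1 g.2 r) ^+ 2 + ((phi.2 r - g.2 r) / r) ^+ 2).

Lemma dist_density_ge0 phi g r : 0 <= dist_density phi g r.
Proof. by rewrite !addr_ge0 ?sqr_ge0. Qed.

Lemma H2_densityE g r : H2_density g r =
  derive1 (derive1 g.1) r ^+ 2 + (derive1 g.1 r / r) ^+ 2 + (g.1 r / r ^+ 2) ^+ 2 +
  (derive1 g.2 r ^+ 2 + (g.2 r / r) ^+ 2).
Proof. by rewrite /H2_density jet_sq2E jet_sq1E. Qed.

Lemma H2_density_sub phi g r : 0 < r ->
  (forall s, 0 < s -> derivable phi.1 s 1) -> (forall s, 0 < s -> derivable g.1 s 1) ->
  derivable (derive1 phi.1) r 1 -> derivable (derive1 g.1) r 1 ->
  derivable phi.2 r 1 -> derivable g.2 r 1 ->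
  H2_density (subp phi g) r = dist_density phi g r.
Proof.
move=> r0 p1 g1 p1' g1' p2 g2; rewrite H2_densityE /dist_density /=.
rewrite (derive1_sub (p1 _ r0) (g1 _ r0)) (derive1_sub p2 g2).
rewrite (@derive1_pos _ _ (derive1 phi.1 \- derive1 g.1) r r0); last first.
  by move=> s s0; exact: (derive1_sub (p1 s s0) (g1 s s0)).
by rewrite (derive1_sub p1' g1').
Qed.

Lemma test_pair_sub phi h r : test_pair phi -> test_pair h -> 0 < r ->
  H2_density (subp phi h) r = dist_density phi h r.
Proof.
move=> [[p1 _] [p2 _]] [[h1 _] [h2 _]] r0.
exact: (H2_density_sub r0 (p1 0%N) (h1 0%N) (p1 1%N r r0) (h1 1%N r r0) (p2 0%N r r0) (h2 0%N r r0)).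
Qed.

Lemma sqrB_le (x y : R) : (x - y) ^+ 2 <= 2 * (x ^+ 2 + y ^+ 2).
Proof. by rewrite -subr_ge0 (_ : _ - _ = (x + y) ^+ 2) ?sqr_ge0//; ring. Qed.

Lemma sqrB3_le (x y z : R) : (x - y) ^+ 2 <= 2 * ((x - z) ^+ 2 + (y - z) ^+ 2).
Proof. by rewrite (_ : x - y = (x - z) - (y - z)) ?sqrB_le//; ring. Qed.

Lemma le_sum5 (a b c d e a1 b1 c1 d1 e1 a2 b2 c2 d2 e2 : R) :
  a <= 2 * (a1 + a2) -> b <= 2 * (b1 + b2) -> c <= 2 * (c1 + c2) ->
  d <= 2 * (d1 + d2) -> e <= 2 * (e1 + e2) ->
  a + b + c + (d + e) <= 2 * (a1 + b1 + c1 + (d1 + e1) + (a2 + b2 + c2 + (d2 + e2))).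
Proof. lra. Qed.

Lemma le_sum5_weighted (t u l x1 x2 x3 x4 x5 y1 y2 y3 y4 y5 d1 d2 d3 d4 d5 : R) :
  x1 * t <= 2 * (y1 * t + l * d1) -> x2 * u <= 2 * (y2 * u + l * d2) ->
  x3 * u <= 2 * (y3 * u + l * d3) -> x4 * t <= 2 * (y4 * t + l * d4) ->
  x5 * t <= 2 * (y5 * t + l * d5) ->
  (x1 + (x4 + x5)) * t + (x2 + x3) * u <=
  2 * ((y1 + (y4 + y5)) * t + (y2 + y3) * u + l * (d1 + d2 + d3 + (d4 + d5))).
Proof. by rewrite !mulrDl !(mulrDr l); lra. Qed.

Section WithH2.
Variable g : pair.
Hypothesis gH : in_H2 g.

Let g1d r : 0 < r -> derivable g.1 r 1.
Proof. by case: gH => h1 h2 _ _; exact: lac_derivable. Qed.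

Lemma pos_measurable_dist phi : test_pair phi -> pos_measurable (dist_density phi g).
Proof.
move=> [p1 p2]; case: gH => h1 h2 h3 _.
have sV : smooth_pos (fun r : R => r^-1) := @smooth_pos_inv R.
have mB (f e : R -> R) : test_fun f -> pos_measurable e -> pos_measurable (fun r => f r - e r).
  move=> ft me; apply: pos_measurableD; last exact: pos_measurableN.
  exact: smooth_pos_measurable ft.1.
have mV := smooth_pos_measurable sV.
have mV2 : pos_measurable (fun r : R => r ^- 2).
  apply: smooth_pos_measurable; apply: smooth_posV.
    by move=> r r0; rewrite expf_neq0// gt_eqF.
  by apply: smooth_posX; exact: smooth_pos_id.
have t1 := test_fun_derive1 p1.
apply: pos_measurableD; first apply: pos_measurableD; first apply: pos_measurableD.
- apply: pos_measurable_sqr; apply: mB; first exact: test_fun_derive1.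
  exact: lac_measurable_derive1.
- apply: pos_measurable_sqr; apply: pos_measurableM mV; apply: mB => //.
  exact: lac_measurable.
- apply: pos_measurable_sqr; apply: pos_measurableM mV2; apply: mB => //.
  exact: lac_measurable.
- apply: pos_measurableD; apply: pos_measurable_sqr.
    by apply: mB; [exact: test_fun_derive1|exact: lac_measurable_derive1].
  by apply: pos_measurableM mV; apply: mB => //; exact: lac_measurable.
Qed.

Lemma rintegrable_dist phi : test_pair phi -> rintegrable (dist_density phi g).
Proof.
move=> pt; have pi := test_pair_H2_density pt; have Hi := in_H2_rintegrable gH.
apply: (rintegrable_dom (pos_measurable_dist pt) _ (rintegrableZ 2 (rintegrableD pi Hi))).
move=> r r0; rewrite ger0_norm ?dist_density_ge0// !H2_densityE /dist_density.
rewrite !mulrBl.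
by apply: le_sum5; exact: sqrB_le.
Qed.

Lemma H2norm_sub phi : test_pair phi -> H2norm (subp phi g) ^+ 2 = rint (dist_density phi g).
Proof.
move=> [[p1 _] [p2 _]]; case: (gH) => h1 h2 h3 _; rewrite H2norm_sqr; apply: rint_ae_eq.
have a1 := lac_derivable_ae h2; have a2 := lac_derivable_ae h3.
move: a1 a2; apply: filterS2; first exact: (ae_filter_ringOfSetsType (@lebesgue_measure R)).
move=> r d1 d2 r0.
exact: (H2_density_sub r0 (p1 0%N) g1d (p1 1%N r r0) (d1 r0) (p2 0%N r r0) (d2 r0)).
Qed.

Lemma H2norm_sub_test phi h : test_pair phi -> test_pair h ->
  rint (H2_density (subp phi h)) <=
  2 * (H2norm (subp phi g) ^+ 2 + H2norm (subp h g) ^+ 2).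
Proof.
move=> pt ht; rewrite !H2norm_sub//.
have pi := rintegrable_dist pt; have hi := rintegrable_dist ht.
rewrite -(rintD pi hi) -rintZ; last exact: rintegrableD.
apply: rint_le; first by apply: test_pair_H2_density; exact: test_pairB.
  by apply: rintegrableZ; exact: rintegrableD.
move=> r r0; rewrite (test_pair_sub pt ht r0) /dist_density !mulrBl.
by apply: le_sum5; exact: sqrB3_le.
Qed.

Lemma H2norm_test_le phi : test_pair phi ->
  rint (H2_density phi) <= 2 * (H2norm (subp phi g) ^+ 2 + H2norm g ^+ 2).
Proof.
move=> pt; rewrite H2norm_sub// H2norm_sqr.
have pi := rintegrable_dist pt; have Hi := in_H2_rintegrable gH.
rewrite -(rintD pi Hi) -rintZ; last exact: rintegrableD.
apply: rint_le; first exact: test_pair_H2_density.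
  by apply: rintegrableZ; exact: rintegrableD.
move=> r r0; rewrite !H2_densityE /dist_density !mulrBl.
have aux (x y : R) : x ^+ 2 <= 2 * ((x - y) ^+ 2 + y ^+ 2).
  have := sqrB_le (x - y) (- y); rewrite opprK subrK sqrrN; lra.
by apply: le_sum5; exact: aux.
Qed.

(** Carries the lower bound from test functions back to [g]: all Morawetz weights are at most
    [lam^-1]. The factor 2 of the squared triangle inequality is what reduces [c0 / 2] to [c0 / 4]
    in the end. *)
Lemma Mor_sq_test_le lam phi : 0 < lam -> test_pair phi ->
  Mor_sq lam g <= 2 * (Mor_sq lam phi + lam^-1 * H2norm (subp phi g) ^+ 2).
Proof.
move=> l0 pt; rewrite H2norm_sub// !Mor_sqE.
have di := rintegrableZ lam^-1 (rintegrable_dist pt).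
have pi := rintegrable_mor_density (test_pair_in_H2 pt) l0.
rewrite -rintZ; last exact: rintegrable_dist.
rewrite -(rintD pi di) -rintZ; last exact: rintegrableD.
apply: rint_le; first exact: rintegrable_mor_density.
  by apply: rintegrableZ; exact: rintegrableD.
move=> r r0; rewrite !mor_densityE// !jet_sq1E /dist_density.
have s0 : 0 < lam + r by rewrite addr_gt0.
have h1 : (lam + r)^-1 <= lam^-1 by rewrite lef_pV2 ?posrE// lerDl ltW.
have h2 := le_trans (lam_sqr_le l0 r0) h1.
set t := lam / _ in h2 *; set u := (lam + r)^-1 in h1 *.
have t0 : 0 <= t by exact: lam_ratio_ge0.
have u0 : 0 <= u by rewrite invr_ge0 ltW.
have aux (w x y : R) : 0 <= w -> w <= lam^-1 ->
    x ^+ 2 * w <= 2 * (y ^+ 2 * w + lam^-1 * (y - x) ^+ 2).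
  move=> w0 wl; have := ler_wpM2r w0 (sqrB_le y (y - x)).
  have := ler_wpM2r (sqr_ge0 (y - x)) wl.
  rewrite (_ : y - (y - x) = x); last by ring.
  lra.
have e2 (f : R -> R) : r ^- 2 * (derive1 f r ^+ 2 + (f r / r) ^+ 2) =
    (derive1 f r / r) ^+ 2 + (f r / r ^+ 2) ^+ 2.
  by field; rewrite gt_eqF.
rewrite !e2.
apply: le_sum5_weighted.
- exact: aux t0 h2.
- by rewrite mulrBl; exact: aux u0 h1.
- by rewrite mulrBl; exact: aux u0 h1.
- exact: aux t0 h2.
- by rewrite mulrBl; exact: aux t0 h2.
Qed.

End WithH2.
End TestPairs.

(** * Cauchy criterion and existence of extended values *)

Section Extension.
Variable R : realType.
Local Notation pair := ((R -> R) * (R -> R))%type.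
Implicit Types (g h phi : pair) (r lam : R) (q : pair -> R) (D : pair -> R -> R).

Definition jetN phi r : R := Num.sqrt (H2_density phi r).

Lemma jetN_ge0 phi r : 0 <= jetN phi r. Proof. exact: sqrtr_ge0. Qed.

Lemma jetN_sqr phi r : jetN phi r ^+ 2 = H2_density phi r.
Proof. by rewrite sqr_sqrtr// H2_density_ge0. Qed.

Lemma jet2_jetN phi r : jet 2 phi.1 r <= jetN phi r.
Proof. by apply: ler_wsqrtr; rewrite lerDl jet_sq_ge0. Qed.

Lemma jet1_jetN phi r : jet 1 phi.2 r <= jetN phi r.
Proof. by apply: ler_wsqrtr; rewrite lerDr jet_sq_ge0. Qed.

(** What is kept of being quadratic in the jet: the estimate of [D (h + u) - D h] for [u = phi - h].
    In this form the property passes to sums and holds for products of two linear densities. *)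
Definition quad_density D : Prop := exists2 B : R, 0 <= B &
  forall phi h r, test_pair phi -> test_pair h -> 0 < r ->
    `|D phi r - D h r| <= B * (2 * jetN h r * jetN (subp phi h) r + jetN (subp phi h) r ^+ 2).

Definition linear_density (l : pair -> R -> R) : Prop := exists2 L : R, 0 <= L &
  forall phi h r, test_pair phi -> test_pair h -> 0 < r ->
    l phi r = l h r + l (subp phi h) r /\ `|l phi r| <= L * jetN phi r.

Lemma quad_densityM l m : linear_density l -> linear_density m ->
  quad_density (fun phi r => l phi r * m phi r).
Proof.
move=> [L L0 hl] [M M0 hm]; exists (L * M); first exact: mulr_ge0.
move=> phi h r pt ht r0; have ut := test_pairB pt ht.
have [-> _] := hl _ _ _ pt ht r0; have [-> _] := hm _ _ _ pt ht r0.
have [_ lh] := hl _ _ _ ht ht r0; have [_ mh] := hm _ _ _ ht ht r0.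
have [_ lu] := hl _ _ _ ut ut r0; have [_ mu] := hm _ _ _ ut ut r0.
rewrite [X in `|X|](_ : _ = l h r * m (subp phi h) r + l (subp phi h) r * m h r +
  l (subp phi h) r * m (subp phi h) r); last by ring.
apply: (le_trans (normD_le (normD_le (normM_le lh mu) (normM_le lu mh)) (normM_le lu mu))).
by apply: eq_ge; ring.
Qed.

Lemma quad_densityD D E : quad_density D -> quad_density E ->
  quad_density (fun phi r => D phi r + E phi r).
Proof.
move=> [A A0 hA] [B B0 hB]; exists (A + B); first exact: addr_ge0.
move=> phi h r pt ht r0; rewrite opprD addrACA mulrDl.
by apply: normD_le; [exact: hA|exact: hB].
Qed.

Lemma linear_densityZ (c : R -> R) (B : R) l : (forall r, 0 < r -> `|c r| <= B) ->
  linear_density l -> linear_density (fun phi r => c r * l phi r).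
Proof.
move=> cB [L L0 hl]; have B0 : 0 <= B := le_trans (normr_ge0 _) (cB 1 ltr01).
exists (B * L); first exact: mulr_ge0.
move=> phi h r pt ht r0; have [h1 h2] := hl _ _ _ pt ht r0; split.
  by rewrite h1 mulrDr.
by rewrite -mulrA; apply: normM_le => //; exact: cB.
Qed.

(** Continuity at [g] without naming a limit, since [q] need not be defined by an integral at
    [g]. *)
Definition quad_cauchy q g : Prop := forall e : R, 0 < e -> exists2 d : R, 0 < d &
  forall phi h, test_pair phi -> test_pair h ->
    H2norm (subp phi g) < d -> H2norm (subp h g) < d -> `|q phi - q h| < e.

Lemma quad_cauchy_eq q q' g : (forall phi, test_pair phi -> q phi = q' phi) ->
  quad_cauchy q g -> quad_cauchy q' g.
Proof.
move=> qq' qc e e0; have [d d0 hd] := qc e e0; exists d => // phi h pt ht pg hg.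
by rewrite -!qq'//; exact: hd.
Qed.

Lemma quad_cauchyD q q' g : quad_cauchy q g -> quad_cauchy q' g ->
  quad_cauchy (fun phi => q phi + q' phi) g.
Proof.
move=> qc qc' e e0; have e20 : 0 < e / 2 by rewrite divr_gt0.
have [d d0 hd] := qc _ e20; have [d' d'0 hd'] := qc' _ e20.
exists (Num.min d d'); first by rewrite lt_min d0.
move=> phi h pt ht; rewrite !lt_min => /andP[p1 p2] /andP[h1 h2].
rewrite opprD addrACA (le_lt_trans (ler_normD _ _))// [ltRHS]splitr ltrD//.
  exact: hd.
exact: hd'.
Qed.

Lemma quad_cauchyZ (c : R) q g : quad_cauchy q g -> quad_cauchy (fun phi => c * q phi) g.
Proof.
move=> qc e e0; have c0 : 0 < `|c| + 1 by rewrite ltr_pwDr.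
have [d d0 hd] := qc _ (divr_gt0 e0 c0); exists d => // phi h pt ht p1 h1.
rewrite -mulrBr normrM; have := hd _ _ pt ht p1 h1; rewrite ltr_pdivlMr// => h2.
by apply: le_lt_trans h2; rewrite mulrC ler_wpM2l// lerDl.
Qed.

Lemma quad_cauchy_sum (I : Type) (s : seq I) (q : I -> pair -> R) g :
  (forall i, quad_cauchy (q i) g) -> quad_cauchy (fun phi => \sum_(i <- s) q i phi) g.
Proof.
move=> qc; elim: s => [|i s ih].
  by move=> e e0; exists 1 => // phi h _ _ _ _; rewrite !big_nil subr0 normr0.
by apply: quad_cauchy_eq (quad_cauchyD (qc i) ih) => phi _; rewrite big_cons.
Qed.

Lemma amgm_weighted (s a b : R) : 0 < s -> 2 * a * b <= s * a ^+ 2 + s^-1 * b ^+ 2.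
Proof.
move=> s0; have := mulr_ge0 (ltW s0) (sqr_ge0 (a - s^-1 * b)).
rewrite [leRHS](_ : _ = s * a ^+ 2 + s^-1 * b ^+ 2 - 2 * a * b) ?subr_ge0//.
by field; rewrite gt_eqF.
Qed.

Lemma quad_density_cauchy q D g : in_H2 g -> quad_density D ->
  (forall phi, test_pair phi -> rintegrable (D phi) /\ q phi = rint (D phi)) ->
  quad_cauchy q g.
Proof.
move=> gH [B B0 hB] qD e e0.
pose G := H2norm g ^+ 2; have G0 : 0 <= G := sqr_ge0 _.
pose M := B + 1; have M0 : 0 < M by rewrite ltr_wpDl.
(* The cross term is split with weight [s]. The energy of [h] is at most [2 * (1 + G)], so its share
   is at most [e / (4 * M)]; the difference then carries the coefficient [T = 1 + s^-1], against
   which [d] is chosen so that its share has the same bound. *)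
pose s := e / (8 * M * (1 + G)).
have s0 : 0 < s by rewrite divr_gt0// !mulr_gt0// ltr_pwDl.
pose T := 1 + s^-1; have T0 : 0 < T by rewrite addr_gt0// invr_gt0.
pose d := Num.min 1 (e / (16 * M * T)).
have d0 : 0 < d by rewrite lt_min ltr01 divr_gt0// !mulr_gt0.
exists d => // phi h pt ht pg hg; have ut := test_pairB pt ht.
have [pi ->] := qD _ pt; have [hi ->] := qD _ ht.
rewrite -rintB//.
have Hh := test_pair_H2_density ht; have Hu := test_pair_H2_density ut.
have di := rintegrableB pi hi.
have si := rintegrableZ s Hh; have ti := rintegrableZ T Hu.
have bi := rintegrableZ M (rintegrableD si ti).
have := rint_norm_le di bi.
rewrite (rintZ M (rintegrableD si ti)) (rintD si ti) (rintZ s Hh) (rintZ T Hu) => key.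
apply: (le_lt_trans (key _)).
  move=> r r0; apply: (le_trans (hB _ _ _ pt ht r0)).
  set a := jetN h r; set b := jetN (subp phi h) r.
  have a0 : 0 <= a := jetN_ge0 _ _. have b0 : 0 <= b := jetN_ge0 _ _.
  have ab : 2 * a * b <= s * a ^+ 2 + s^-1 * b ^+ 2.
    exact: amgm_weighted.
  apply: ler_pM => //; first by rewrite addr_ge0 ?mulr_ge0 ?sqr_ge0.
    by rewrite lerDl.
  rewrite -!jetN_sqr -/a -/b /T mulrDl mul1r; lra.
have sq x : 0 <= x -> x < d -> x ^+ 2 <= d.
  move=> x0 xd; rewrite expr2; have x1 : x <= 1.
    by rewrite (le_trans (ltW xd))// ge_min lexx.
  by rewrite (le_trans (ler_piMr x0 x1))// ltW.
have p2 := sq _ (sqrtr_ge0 _) pg; have h2 := sq _ (sqrtr_ge0 _) hg.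
have U := H2norm_sub_test gH pt ht; have V := H2norm_test_le gH ht.
rewrite -/(H2norm _) in p2 h2.
have d1 : d <= 1 by rewrite ge_min lexx.
have V' : rint (H2_density h) <= 2 * (1 + G).
  by apply: (le_trans V); rewrite ler_pM2l// lerD2r (le_trans h2).
have U' : rint (H2_density (subp phi h)) <= 4 * d.
  by apply: (le_trans U); rewrite (_ : 4 * d = 2 * (d + d)) ?ler_pM2l ?lerD//; ring.
have h3 : s * rint (H2_density h) <= e / (4 * M).
  apply: (le_trans (ler_wpM2l (ltW s0) V')); rewrite /s; apply: eq_ge.
  by field; rewrite !gt_eqF// ltr_pwDl.
have h4 : T * rint (H2_density (subp phi h)) <= e / (4 * M).
  apply: (le_trans (ler_wpM2l (ltW T0) U')).
  apply: (@le_trans _ _ (T * (4 * (e / (16 * M * T))))).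
    by rewrite !ler_pM2l// ge_min lexx orbT.
  by apply: eq_ge; field; rewrite !gt_eqF.
have : M * (s * rint (H2_density h) + T * rint (H2_density (subp phi h))) <=
    M * (e / (4 * M) + e / (4 * M)) by rewrite ler_pM2l// lerD.
move=> /le_lt_trans; apply.
rewrite [ltLHS](_ : _ = e / 2); last by field; rewrite gt_eqF.
by rewrite ltr_pdivrMr// ltr_pMr// ltr1n.
Qed.

Definition approximable g : Prop :=
  forall d : R, 0 < d -> exists2 phi, test_pair phi & H2norm (subp phi g) < d.

Lemma extension_exists q g : quad_cauchy q g -> approximable g ->
  exists E : R, extension_value q g E.
Proof.
move=> qc ga.
have /choice[f hf] (n : nat) : exists phi, test_pair phi /\ H2norm (subp phi g) < n.+1%:R^-1.
  by have [|phi h1 h2] := ga n.+1%:R^-1; [rewrite invr_gt0|exists phi].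
have fd (d : R) : 0 < d -> \forall n \near \oo, H2norm (subp (f n) g) < d.
  move=> d0; near=> n; have [_ h] := hf n; apply: (lt_trans h).
  by near: n; exact: near_infty_natSinv_lt (PosNum d0).
have : cauchy (q \o f @ \oo).
  apply: cauchy_exP => e e0; have [d d0 hd] := qc e e0.
  have [n hn] : exists n, H2norm (subp (f n) g) < d.
    by near \oo => n; exists n; near: n; exact: fd.
  exists (q (f n)).
  suff : \forall m \near \oo, ball (q (f n)) e (q (f m)) by [].
  near=> m; rewrite -ball_normE /=; apply: hd => //.
  - by have [] := hf n.
  - by have [] := hf m.
  - by near: m; exact: fd.
move=> /cauchy_cvg/cvg_ex[/= E fE]; exists E => e e0.
have e20 : 0 < e / 2 by rewrite divr_gt0.
have [d d0 hd] := qc _ e20; exists d => // phi p1 p2 pg.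
have [n [h1 h2]] : exists n, H2norm (subp (f n) g) < d /\ `|E - q (f n)| < e / 2.
  near \oo => n; exists n; split; first by near: n; exact: fd.
  by near: n; move/cvgrPdist_lt : fE => /(_ _ e20).
rewrite (_ : q phi - E = (q phi - q (f n)) - (E - q (f n))); last by ring.
rewrite (le_lt_trans (ler_normB _ _))// [ltRHS]splitr ltrD//.
by apply: hd => //; have [] := hf n.
Unshelve. all: by end_near. Qed.

Lemma H2norm_self h : test_pair h -> H2norm (subp h h) = 0.
Proof.
move=> ht; apply/eqP; rewrite -sqrf_eq0 H2norm_sub//; last exact: test_pair_in_H2.
rewrite (@rint_eq _ _ (fun=> 0)) ?rint0// => r _.
by rewrite /dist_density !subrr !mul0r !expr0n /= !addr0.
Qed.

(** Makes the coercivity hypothesis, which speaks of extended values, available for the forms of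
    test pairs. *)
Lemma extension_test q h : test_pair h -> quad_cauchy q h -> extension_value q h (q h).
Proof.
move=> ht qc e e0; have [d d0 hd] := qc e e0; exists d => // phi p1 p2 ph.
by apply: hd => //; rewrite H2norm_self.
Qed.

(** Pairing with a bounded function vanishing beyond [L] is continuous for the energy norm, by
    Cauchy-Schwarz against the weight of [rint_weight] at scale 1. The exponent [m] is that of the
    Hardy term controlling [f]: 2 for the field, 1 for the velocity. *)
Lemma rint_pairing (z f dens : R -> R) (A L : R) (m : nat) :
  pos_measurable z -> pos_measurable f -> rintegrable dens -> 0 < L ->
  (forall r, 0 < r -> 0 <= dens r) ->
  (forall r, 0 < r -> `|z r| <= A) -> (forall r, L <= r -> z r = 0) ->
  (forall r, 0 < r -> (f r / r ^+ m) ^+ 2 <= dens r) ->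
  rintegrable (fun r => z r * f r) /\
  rint (fun r => z r * f r) ^+ 2 <=
    4 * (A ^+ 2 * L ^+ (2 * m).+1 * (1 + L) ^+ 2) * rint dens.
Proof.
move=> mz mf di L0 d0 zA z0 fd.
have [wi wE] := rint_weight (ltr01 : 0 < 1 :> R).
pose c : R := A ^+ 2 * L ^+ (2 * m).+1 * (1 + L) ^+ 2.
have wi' := rintegrableZ c wi.
have Lm : 0 <= L ^+ (2 * m).+1 by rewrite exprn_ge0// ltW.
have c0 : 0 <= c by rewrite /c; apply: mulr_ge0; [apply: mulr_ge0; [exact: sqr_ge0|by []]|exact: sqr_ge0].
have W0 r : 0 < r -> 0 <= c * (r * (1 + r) ^+ 2)^-1.
  by move=> r0; rewrite mulr_ge0// invr_ge0 mulr_ge0 ?sqr_ge0// ltW.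
have key r : 0 < r -> (z r * f r) ^+ 2 <= dens r * (c * (r * (1 + r) ^+ 2)^-1).
  move=> r0; have [Lr|rL] := leP L r.
    by rewrite z0// mul0r expr0n mulr_ge0 ?d0 ?W0.
  rewrite (_ : (z r * f r) ^+ 2 = (f r / r ^+ m) ^+ 2 * (z r ^+ 2 * r ^+ (2 * m))); last first.
    rewrite mulnC exprM; field; rewrite expf_neq0// gt_eqF//.
  have rm : 0 <= r ^+ (2 * m) by rewrite exprn_ge0// ltW.
  have rm1 : 0 <= r ^+ (2 * m).+1 by rewrite exprn_ge0// ltW.
  apply: ler_pM; [exact: sqr_ge0|by rewrite mulr_ge0 ?sqr_ge0|exact: fd|].
  rewrite ler_pdivlMr ?mulr_gt0 ?exprn_gt0 ?addr_gt0//.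
  rewrite [leLHS](_ : _ = z r ^+ 2 * (r ^+ (2 * m).+1) * (1 + r) ^+ 2); last first.
    by rewrite [r ^+ (2 * m).+1]exprS; move: (r ^+ (2 * m)) => X; ring.
  rewrite /c; apply: ler_pM; [by rewrite mulr_ge0 ?sqr_ge0|exact: sqr_ge0| |].
    apply: ler_pM; [exact: sqr_ge0|by []|exact: norm_sqr_le (zA _ r0)|].
    by rewrite lerXn2r ?nnegrE//; exact: ltW.
  by rewrite lerXn2r ?nnegrE ?lerD2l ?addr_ge0//; exact: ltW.
have zi : rintegrable (fun r => z r * f r).
  apply: (rintegrable_dom _ _ (rintegrableD di wi')); first exact: pos_measurableM.
  move=> r r0; have := amgm_param (d0 _ r0) (W0 _ r0) ltr01 (key _ r0).
  by rewrite invr1 !mul1r.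
split => //; apply: (le_trans (rint_cauchy_schwarz zi di wi' d0 W0 key)).
by rewrite rintZ// wE invr1 mulr1 -mulrA [rint dens * _]mulrC.
Qed.

End Extension.

(** * Single-bubble forms on test functions *)

Section IntegrationByParts.
Variable R : realType.
Implicit Types (P S v : R -> R) (r : R).

(* The two integrands differ by the derivative of
   [P r v'^2 / 2 + S r v v'], divided by [r]. *)
Lemma rint_ibp P S v : smooth_pos P -> smooth_pos S -> test_fun v ->
  let v1 := derive1 v in let v2 := derive1 v1 in
  let D r := v1 r ^+ 2 * (2^-1 * (P r / r) - 2^-1 * derive1 P r - S r)
             - derive1 S r * (v r * v1 r) in
  rintegrable D /\
  rint (fun r => (v2 r + v1 r / r) * (P r * v1 r + S r * v r)) = rint D.
Proof.
move=> Ps Ss vt v1 v2 D.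
have v1t : test_fun v1 := test_fun_derive1 vt.
have v2t : test_fun v2 := test_fun_derive1 v1t.
have sV : smooth_pos (fun r : R => r^-1) := @smooth_pos_inv R.
have sI := @smooth_pos_id R.
have P's := smooth_pos_derive1 Ps; have S's := smooth_pos_derive1 Ss.
have Dt : test_fun D.
  apply: test_funD.
    apply: test_funMr (test_funX2 v1t) _; apply: smooth_posD; first apply: smooth_posD.
    - by apply: smooth_posM; [exact: smooth_pos_cst|exact: smooth_posM].
    - by apply: smooth_posN; apply: smooth_posM => //; exact: smooth_pos_cst.
    - exact: smooth_posN.
  apply: test_funN; apply: test_funMl S's _; exact: test_funMr vt v1t.1.
pose F r := 2^-1 * (P r * r * v1 r ^+ 2) + S r * r * (v r * v1 r).
have Ft : test_fun F.
  apply: test_funD.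
    apply: test_funMl; first exact: smooth_pos_cst.
    by apply: test_funMl (test_funX2 v1t); exact: smooth_posM.
  apply: test_funMl; first exact: smooth_posM.
  exact: test_funMr vt v1t.1.
have F't : test_fun (fun r => derive1 F r / r).
  exact: test_funMr (test_fun_derive1 Ft) sV.
split; first exact: test_fun_rintegrable.
rewrite -[RHS]addr0 -(test_fun_rint_derive1 Ft).
rewrite -(rintD (test_fun_rintegrable Dt) (test_fun_rintegrable F't)).
apply: rint_eq => r r0.
have dP := smooth_pos_is_derive Ps r0; have dS := smooth_pos_is_derive Ss r0.
have dv := test_fun_is_derive vt r0; have dv1 := test_fun_is_derive v1t r0.
have dF := drD (drM (drC 2^-1 r) (drM (drM dP (drI r)) (drX2 dv1)))
  (drM (drM dS (drI r)) (drM dv dv1)).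
by rewrite (is_derive1E dF) /D -/v1 -/v2; field; rewrite gt_eqF.
Qed.

(** The integrand is the derivative of [P r v^2 / 2], divided by [r]; this is the anti-symmetry of
    [Lambda_psi] for a general weight. *)
Lemma rint_ibp_antisymmetric P v : smooth_pos P -> test_fun v ->
  rint (fun r => v r * (P r * derive1 v r + 2^-1 * (derive1 P r + r^-1 * P r) * v r)) = 0.
Proof.
move=> Ps vt.
pose F r := 2^-1 * (P r * r * v r ^+ 2).
have sI := @smooth_pos_id R.
have Ft : test_fun F.
  apply: test_funMl; first exact: smooth_pos_cst.
  by apply: test_funMl (test_funX2 vt); exact: smooth_posM.
rewrite -(test_fun_rint_derive1 Ft); apply: rint_eq => r r0.
have dP := smooth_pos_is_derive Ps r0; have dv := test_fun_is_derive vt r0.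
have dF := drM (drC 2^-1 r) (drM (drM dP (drI r)) (drX2 dv)).
by rewrite (is_derive1E dF); field; rewrite gt_eqF.
Qed.

End IntegrationByParts.

Section SingleBubble.
Variables (R : realType) (k : nat) (psi : R -> R) (delta K : R).
Hypotheses (hk : (2 <= k)%N) (psi_smooth : smooth_pos psi) (K0 : 0 < K)
  (hK : weight_bound psi K) (delta0 : 0 < delta).
Local Notation pair := ((R -> R) * (R -> R))%type.
Implicit Types (f df : R -> R) (phi h : pair) (r lam : R).

Local Notation k' := (k%:R : R).
Local Notation Xop := (multiplier k psi delta).

Lemma test_fun_Aop lam f : 0 < lam -> test_fun f -> test_fun (Aop k lam f).
Proof.
move=> l0 ft; apply: test_funD; first exact: test_funN (test_fun_derive1 ft).
apply: test_funMl ft; apply: smooth_posM (@smooth_pos_inv R).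
by apply: smooth_posM (smooth_pos_cosQ hk l0); exact: smooth_pos_cst.
Qed.

Lemma derive1_Aop_test lam f r : 0 < lam -> 0 < r -> test_fun f ->
  derive1 (Aop k lam f) r = dAop k lam f r.
Proof.
move=> l0 r0 [fs _]; apply: is_derive1E; apply: (is_derive_Aop hk) => //.
  exact: (fs 0%N).
exact: (fs 1%N).
Qed.

Lemma test_fun_Hop U f : smooth_pos U -> test_fun f -> test_fun (Hop k U f).
Proof.
move=> Us ft; have f1 := test_fun_derive1 ft.
have sV : smooth_pos (fun r : R => r^-1) := @smooth_pos_inv R.
apply: test_funD; first apply: test_funD.
- exact: test_funN (test_fun_derive1 f1).
- exact: test_funN (test_funMl sV f1).
apply: test_funMl ft; apply: smooth_posM; first exact: smooth_pos_cst.
apply: smooth_posM.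
  by apply: smooth_pos_cos; apply: smooth_posM Us; exact: smooth_pos_cst.
apply: smooth_posV; first by move=> r r0; rewrite expf_neq0// gt_eqF.
by apply: smooth_posX; exact: smooth_pos_id.
Qed.

Lemma M0_test lam f df : 0 < lam -> test_fun f -> test_fun df ->
  rintegrable (fun r => Aop k lam df r * Xop lam f r) /\
  M0 k psi delta lam f df = rint (fun r => Aop k lam df r * Xop lam f r).
Proof.
move=> l0 ft dft; have At := test_fun_Aop l0 dft.
apply: (M0E hk psi_smooth K0 hK delta0) => //.
- exact: smooth_pos_loc_abs_continuous ft.1.
- exact: smooth_pos_loc_abs_continuous (smooth_pos_derive1 ft.1).
- exact: smooth_pos_measurable At.1.
have i1 := test_fun_rintegrable (test_funX2 At).
have i2 := test_fun_rintegrable (test_fun_jet2 ft).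
apply: (rintegrable_dom _ _ (rintegrableD i1 i2)).
  apply: pos_measurableM; first exact: pos_measurable_norm (smooth_pos_measurable At.1).
  apply: pos_measurable_jet2; first exact: smooth_pos_loc_abs_continuous ft.1.
  exact: smooth_pos_loc_abs_continuous (smooth_pos_derive1 ft.1).
move=> r r0; rewrite normrM normr_id [`|jet _ _ _|]ger0_norm ?jet_ge0//.
rewrite -jet_sqr -[X in _ <= X + _]real_normK ?num_real//.
set a := `|_|; set b := jet _ _ _.
have a0 : 0 <= a := normr_ge0 _. have b0 : 0 <= b := jet_ge0 _ _ _.
have := sqr_ge0 (a - b); have := mulr_ge0 a0 b0; rewrite sqrrB -mulr_natl; lra.
Qed.

Definition potV lam r : R := 1 + k' ^+ 2 + 2 * k' * cosQ k lam r.

(* [H = A' A] with [A'] the adjoint of [A], hence [A H = (A A') A]; the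
   potential of [A A'] is [potV / r^2]. *)
Lemma Aop_Hop lam f r : 0 < lam -> 0 < r -> test_fun f ->
  Aop k lam (\- Hop k (scale lam (Q k)) f) r =
  derive1 (derive1 (Aop k lam f)) r + derive1 (Aop k lam f) r / r
  - potV lam r / r ^+ 2 * Aop k lam f r.
Proof.
move=> l0 r0 ft; have f1t := test_fun_derive1 ft; have f2t := test_fun_derive1 f1t.
set C := cosQ k lam.
have rn : r != 0 by rewrite gt_eqF.
have rn2 : r ^+ 2 != 0 by rewrite expf_neq0.
(* With the sine eliminated, every derivative is a polynomial in [C r], the jet of [f] and [r^-1],
   and the identity becomes algebraic. *)
have dC : is_derive r (1 : R) C (- (k' * (1 - C r ^+ 2) / r)).
  apply: is_derive_eq (is_derive_cosQ hk l0 r0) _.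
  by rewrite /C cosQ_sqr; ring.
have d0 := test_fun_is_derive ft r0; have d1 := test_fun_is_derive f1t r0.
have d2 := test_fun_is_derive f2t r0.
have dV := drV rn (drI r).
have dV2 := drV (f := fun s => s ^+ 2) rn2 (drX2 (drI r)).
have E s : 0 < s -> derive1 (Aop k lam f) s = - derive1 (derive1 f) s +
    k' * C s * s^-1 * derive1 f s - k' * (k' * (1 - C s ^+ 2) + C s) * (s ^+ 2)^-1 * f s.
  by move=> s0; rewrite derive1_Aop_test// /dAop /C cosQ_sqr; ring.
have dA := drB (drD (drN d2) (drM (drM (drM (drC k' r) dC) dV) d1))
  (drM (drM (drM (drC k' r) (drD (drM (drC k' r) (drB (drC 1 r) (drX2 dC))) dC)) dV2) d0).
have -> := derive1_pos r0 E; rewrite (is_derive1E dA) (E r r0).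
have EH s : 0 < s -> - Hop k (scale lam (Q k)) f s = derive1 (derive1 f) s +
    s^-1 * derive1 f s - k' ^+ 2 * ((2 * C s ^+ 2 - 1) * (s ^+ 2)^-1) * f s.
  move=> s0; rewrite /Hop (_ : cos (2 * scale lam (Q k) s) = 2 * C s ^+ 2 - 1); last first.
    by rewrite mulr_natl cos_mulr2n -mulr_natl.
  by rewrite /derive1n /=; ring.
have dH := drB (drD d2 (drM dV d1))
  (drM (drM (drC (k' ^+ 2) r) (drM (drB (drM (drC 2 r) (drX2 dC)) (drC 1 r)) dV2)) d0).
rewrite {1}/Aop [derive1 (\- _) r](derive1_pos r0 EH) (is_derive1E dH) /= (EH r r0).
rewrite /Aop /potV -/(cosQ k lam r) -/(C r) /scale; field.
by rewrite gt_eqF.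
Qed.

End SingleBubble.

(** * Single-bubble forms as integrals of quadratic densities *)

Section SingleBubbleForms.
Variables (R : realType) (k : nat) (psi : R -> R) (delta K : R).
Hypotheses (hk : (2 <= k)%N) (psi_smooth : smooth_pos psi) (K0 : 0 < K)
  (hK : weight_bound psi K) (delta0 : 0 < delta).
Local Notation pair := ((R -> R) * (R -> R))%type.
Implicit Types (f e : R -> R) (phi h g : pair) (r lam : R).

Local Notation k' := (k%:R : R).
Local Notation Xop := (multiplier k psi delta).
Local Notation wt0 := (psi_weight psi). Local Notation wt1 := (psi_weight1 psi).
Local Notation wt2 := (psi_weight2 psi). Local Notation sig := (zeroth_weight psi delta).

Lemma derive1_test_sub f e r : test_fun f -> test_fun e -> 0 < r ->
  derive1 (f \- e) r = derive1 f r - derive1 e r.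
Proof. by move=> [fs _] [es _] r0; exact: (derive1_sub (fs 0%N r r0) (es 0%N r r0)). Qed.

Lemma derive2_test_sub f e r : test_fun f -> test_fun e -> 0 < r ->
  derive1 (derive1 (f \- e)) r = derive1 (derive1 f) r - derive1 (derive1 e) r.
Proof.
move=> ft et r0; rewrite -derive1_test_sub//; [|exact: test_fun_derive1..].
by apply: derive1_pos => // s s0; rewrite derive1_test_sub.
Qed.

Lemma Aop_sub lam f e r : test_fun f -> test_fun e -> 0 < r ->
  Aop k lam (f \- e) r = Aop k lam f r - Aop k lam e r.
Proof. by move=> ft et r0; rewrite /Aop derive1_test_sub//=; ring. Qed.

Lemma dAop_sub lam f e r : test_fun f -> test_fun e -> 0 < r ->
  dAop k lam (f \- e) r = dAop k lam f r - dAop k lam e r.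
Proof. by move=> ft et r0; rewrite /dAop derive1_test_sub// derive2_test_sub//=; ring. Qed.

Lemma subK x y : x = y + (x - y) :> R. Proof. by ring. Qed.

Lemma linear_density_dAop lam : linear_density (fun phi r => dAop k lam phi.1 r).
Proof.
exists ((1 + k') ^+ 2) => [|phi h r [pt _] [ht _] r0]; first exact: sqr_ge0.
split; first by rewrite /= dAop_sub//; exact: subK.
apply: (le_trans (norm_dAop k lam phi.1 r0)); apply: ler_wpM2l; first exact: sqr_ge0.
exact: jet2_jetN.
Qed.

Lemma linear_density_Aop_div lam : linear_density (fun phi r => Aop k lam phi.1 r / r).
Proof.
exists (1 + k') => [|phi h r [pt _] [ht _] r0]; first by rewrite addr_ge0.
split; first by rewrite /= Aop_sub// mulrBl; exact: subK.
apply: (le_trans (norm_Aop2 k lam phi.1 r0)); apply: ler_wpM2l; first by rewrite addr_ge0.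
exact: jet2_jetN.
Qed.

Lemma linear_density_Aop2 lam : linear_density (fun phi r => Aop k lam phi.2 r).
Proof.
exists (1 + k') => [|phi h r [_ pt] [_ ht] r0]; first by rewrite addr_ge0.
split; first by rewrite /= Aop_sub//; exact: subK.
apply: (le_trans (norm_Aop1 k lam phi.2 r0)); apply: ler_wpM2l; first by rewrite addr_ge0.
exact: jet1_jetN.
Qed.

Lemma lam_inv_le lam r : 0 < lam -> 0 < r -> (lam + r)^-1 <= lam^-1.
Proof. by move=> l0 r0; rewrite lef_pV2 ?posrE ?addr_gt0// lerDl ltW. Qed.

Lemma norm_wt0_div lam r : 0 < lam -> 0 < r -> `|wt0 lam r / r| <= K / lam.
Proof.
move=> l0 r0; rewrite normrM [`|r^-1|]gtr0_norm ?invr_gt0// ler_pdivrMr//.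
apply: (le_trans (norm_wt0 hK l0 r0)); rewrite -mulrA ler_pM2l// mulrC.
by rewrite ler_pM2r// lam_inv_le.
Qed.

Lemma norm_wt1_lam lam r : 0 < lam -> 0 < r -> `|wt1 lam r| <= K / lam.
Proof.
move=> l0 r0; apply: (le_trans (norm_wt1 hK l0 r0)); rewrite ler_pM2l//.
exact: le_trans (lam_sqr_le l0 r0) (lam_inv_le l0 r0).
Qed.

Lemma norm_sig_lam lam r : 0 < lam -> 0 < r -> `|sig lam r| <= (K + delta) / lam.
Proof.
move=> l0 r0; apply: (le_trans (norm_sig K0 hK delta0 l0 r0)).
by rewrite ler_pM2l ?addr_gt0// lam_inv_le.
Qed.

Lemma norm_potV lam r : `|potV k lam r| <= (1 + k') ^+ 2.
Proof.
rewrite /potV (_ : (1 + k') ^+ 2 = 1 + k' ^+ 2 + 2 * k' * 1); last by ring.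
apply: normD_le; first by rewrite ger0_norm// addr_ge0 ?sqr_ge0.
by apply: normM_le (norm_cosQ k lam r); rewrite ger0_norm ?mulr_ge0.
Qed.

Lemma derive1_wt0 lam r : 0 < lam -> 0 < r -> derive1 (wt0 lam) r = wt1 lam r.
Proof. by move=> l0 r0; exact: derive1_rescale. Qed.

Lemma derive1_wt1 lam r : 0 < lam -> 0 < r -> is_derive r (1 : R) (wt1 lam) (wt2 lam r).
Proof.
move=> l0 r0.
have d := is_derive_rescale (smooth_pos_is_derive (smooth_pos_derive1 psi_smooth) (divr_gt0 r0 l0)).
apply: is_derive_eq (drM d (drC lam^-1 r)) _.
by rewrite /psi_weight2; field; rewrite gt_eqF.
Qed.

Lemma norm_derive1_sig lam r : 0 < lam -> 0 < r ->
  `|r * derive1 (sig lam) r| <= (2 * K + 2 * delta) / lam.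
Proof.
move=> l0 r0; have rn : r != 0 by rewrite gt_eqF.
have s0 : 0 < lam + r by rewrite addr_gt0.
have sn : (r + lam) ^+ 2 != 0 by rewrite expf_neq0// gt_eqF// addr_gt0.
have dP : is_derive r (1 : R) (wt0 lam) (wt1 lam r).
  rewrite -derive1_wt0//; exact: smooth_pos_is_derive (smooth_pos_wt0 psi_smooth l0) r0.
have d := drB (drM (drC 2^-1 r) (drD (derive1_wt1 l0 r0) (drM (drV rn (drI r)) dP)))
  (drM (drC delta r) (drM (drC lam r) (drV (f := fun s => (s + lam) ^+ 2) sn (drX2 (drD (drI r) (drC lam r)))))).
rewrite (is_derive1E d).
rewrite [X in `|X|](_ : _ = 2^-1 * (r * wt2 lam r + wt1 lam r - wt0 lam r / r)
   + 2 * delta * (lam * r / (lam + r) ^+ 3)); last first.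
  by field; rewrite rn gt_eqF.
have w2 : `|r * wt2 lam r| <= K / lam.
  apply: (le_trans (norm_wt2 hK l0 r0)); rewrite ler_pM2l//.
  exact: le_trans (lam_sqr_le l0 r0) (lam_inv_le l0 r0).
have h1 := normB_le (normD_le w2 (norm_wt1_lam l0 r0)) (norm_wt0_div l0 r0).
have half : `|2^-1 : R| <= 2^-1 by rewrite ger0_norm.
have h2 := normM_le half h1.
have kl : 0 < K / lam by rewrite divr_gt0.
have d2 : `|2 * delta| <= 2 * delta by rewrite gtr0_norm// mulr_gt0.
have h3 : `|lam * r / (lam + r) ^+ 3| <= lam^-1.
  rewrite gtr0_norm; last by rewrite divr_gt0 ?mulr_gt0 ?exprn_gt0//.
  apply: le_trans (lam_inv_le l0 r0).
  rewrite ler_pdivrMr ?exprn_gt0// exprS mulKf ?gt_eqF// sqrrD -mulr_natl.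
  have := sqr_ge0 lam; have := sqr_ge0 r; have := mulr_gt0 l0 r0; lra.
apply: (le_trans (normD_le h2 (normM_le d2 h3))).
rewrite !mulrDl lerD2r -mulrA; lra.
Qed.

Definition M0_field lam phi : R := M0 k psi delta lam phi.1 (\- Hop k (scale lam (Q k)) phi.1).
Definition M0_velocity lam phi : R := M0 k psi delta lam phi.2 phi.2.

(** The density of [M0_field] after integration by parts: no derivative of [phi.1] above the second
    occurs. Each summand is arranged as a product of two linear densities with bounded coefficients,
    the form required by [quad_densityM]. *)
Definition D1 lam phi r : R :=
  ((2^-1 * (wt0 lam r / r) - 2^-1 * wt1 lam r - sig lam r) * dAop k lam phi.1 r) * dAop k lam phi.1 r
  + ((- (r * derive1 (sig lam) r) - potV k lam r * (wt0 lam r / r)) * (Aop k lam phi.1 r / r))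
    * dAop k lam phi.1 r
  + (- (potV k lam r * sig lam r) * (Aop k lam phi.1 r / r)) * (Aop k lam phi.1 r / r).

Lemma M0_fieldE lam phi : 0 < lam -> test_pair phi ->
  rintegrable (D1 lam phi) /\ M0_field lam phi = rint (D1 lam phi).
Proof.
move=> l0 [ft _]; set f := phi.1 in ft *.
have Hs : smooth_pos (scale lam (Q k : R -> R)) := smooth_pos_rescale l0 (@smooth_pos_Q R k hk).
have Ht : test_fun (\- Hop k (scale lam (Q k)) f) := test_funN (test_fun_Hop k Hs ft).
have [_ qE] := M0_test hk psi_smooth K0 hK delta0 l0 ft Ht.
have vt := test_fun_Aop hk l0 ft.
have sP := smooth_pos_wt0 psi_smooth l0.
have sS := @smooth_pos_sig R psi delta psi_smooth lam l0.
have [Di DE] := rint_ibp sP sS vt.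
have sV : smooth_pos (potV k lam : R -> R).
  apply: smooth_posD; first exact: smooth_pos_cst.
  by apply: smooth_posM (smooth_pos_cosQ hk l0); exact: smooth_pos_cst.
have sI2 : smooth_pos (fun r : R => (r ^+ 2)^-1).
  apply: smooth_posV; first by move=> r r0; rewrite expf_neq0// gt_eqF.
  by apply: smooth_posX; exact: smooth_pos_id.
have Xt : test_fun (fun r => wt0 lam r * derive1 (Aop k lam f) r + sig lam r * Aop k lam f r).
  by apply: test_funD; [apply: test_funMl sP (test_fun_derive1 vt)|exact: test_funMl].
(* The potential term of [A H] is already quadratic in the jet; only the radial Laplacian of
   [Aop k lam f] is integrated by parts. *)
pose T r := potV k lam r / r ^+ 2 * Aop k lam f r *
  (wt0 lam r * derive1 (Aop k lam f) r + sig lam r * Aop k lam f r).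
have Tt : test_fun T.
  by apply: test_funMl Xt; apply: smooth_posM vt.1; exact: smooth_posM.
have Ti := test_fun_rintegrable Tt.
have E (r : R) : 0 < r -> derive1 (Aop k lam f) r ^+ 2 *
      (2^-1 * (wt0 lam r / r) - 2^-1 * derive1 (wt0 lam) r - sig lam r) -
    derive1 (sig lam) r * (Aop k lam f r * derive1 (Aop k lam f) r) - T r = D1 lam phi r.
  move=> r0; rewrite /T /D1 -/f (derive1_Aop_test hk l0 r0 ft) (derive1_wt0 l0 r0).
  by field; rewrite gt_eqF.
split; first by apply: rintegrable_eq E _; exact: rintegrableB.
rewrite /M0_field -/f qE -(rint_eq E) rintB// -DE -rintB//.
  apply: rint_eq => r r0; rewrite (Aop_Hop hk l0 r0 ft) /Xop /T (derive1_Aop_test hk l0 r0 ft).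
  by ring.
apply: test_fun_rintegrable; apply: test_funMr Xt.1.
apply: test_funD; first exact: test_fun_derive1 (test_fun_derive1 vt).
exact: test_funMr (test_fun_derive1 vt) (@smooth_pos_inv R).
Qed.

Lemma M0_field_cauchy lam g : 0 < lam -> in_H2 g -> quad_cauchy (M0_field lam) g.
Proof.
move=> l0 gH; apply: (quad_density_cauchy gH (D := D1 lam)); last by move=> phi; exact: M0_fieldE.
have lp := linear_density_dAop lam; have lq := linear_density_Aop_div lam.
have h2 : `|2^-1 : R| <= 2^-1 by rewrite ger0_norm.
apply: quad_densityD; first apply: quad_densityD; apply: quad_densityM => //.
- apply: linear_densityZ lp => r r0.
  exact: normB_le (normB_le (normM_le h2 (norm_wt0_div l0 r0))
    (normM_le h2 (norm_wt1_lam l0 r0))) (norm_sig_lam l0 r0).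
- apply: linear_densityZ lq => r r0.
  exact: normB_le (normN_le (norm_derive1_sig l0 r0))
    (normM_le (norm_potV lam r) (norm_wt0_div l0 r0)).
- apply: linear_densityZ lq => r r0.
  exact: normN_le (normM_le (norm_potV lam r) (norm_sig_lam l0 r0)).
Qed.

(** Anti-symmetry removes the part with second derivatives of the velocity, which the norm does not
    control; only the [delta]-term survives. *)
Lemma M0_velocity_cauchy lam g : 0 < lam -> in_H2 g -> quad_cauchy (M0_velocity lam) g.
Proof.
move=> l0 gH.
pose D phi r := (- (delta * wtd lam r) * Aop k lam phi.2 r) * Aop k lam phi.2 r.
apply: (quad_density_cauchy gH (D := D)).
  have l2 := linear_density_Aop2 lam; apply: quad_densityM => //.
  apply: (linear_densityZ (B := delta * lam^-1)) l2 => r r0; apply: normN_le; apply: normM_le.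
    by rewrite gtr0_norm.
  exact: le_trans (norm_wtd l0 r0) (lam_inv_le l0 r0).
move=> phi [_ ft]; have vt := test_fun_Aop hk l0 ft.
have Dt : test_fun (D phi).
  apply: test_funMr vt.1; apply: test_funMl vt; apply: smooth_posN.
  by apply: smooth_posM (smooth_pos_wtd l0); exact: smooth_pos_cst.
have Di := test_fun_rintegrable Dt; split => //.
have [Ni qE] := M0_test hk psi_smooth K0 hK delta0 l0 ft ft.
rewrite /M0_velocity qE; apply/eqP; rewrite -subr_eq0 -rintB//; apply/eqP.
rewrite -[RHS](rint_ibp_antisymmetric (smooth_pos_wt0 psi_smooth l0) vt).
apply: rint_eq => r r0.
rewrite /Xop /D (derive1_Aop_test hk l0 r0 ft) (derive1_wt0 l0 r0) /zeroth_weight.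
by ring.
Qed.

End SingleBubbleForms.

(** * Interaction of bubbles *)

Section Trigonometry.
Variable R : realType.
Implicit Types a t : R.

(** The difference is [- 2 sin t sin (2 a + t)]. The bound must be by the sine of [t] and not by
    [t]: far outside its scale a bubble contributes an angle close to [pi], where only the sine is
    small. *)
Lemma norm_cos_shift a t : `|cos (2 * (a + t)) - cos (2 * a)| <= 2 * `|sin t|.
Proof.
rewrite (_ : 2 * (a + t) = 2 * a + (t + t)); last by ring.
rewrite cosD cosD sinD.
have h : cos t ^+ 2 = 1 - sin t ^+ 2 by exact: cos2sin2.
rewrite (_ : _ - _ = - (2 * sin t * (sin (2 * a) * cos t + cos (2 * a) * sin t))); last first.
  rewrite (_ : cos t * cos t = 1 - sin t ^+ 2); last by rewrite -h expr2.
  by ring.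
rewrite -sinD normrN normrM -[leRHS]mulr1; apply: ler_pM => //.
  by rewrite normrM ger0_norm.
by rewrite ler_norml sin_geN1 sin_le1.
Qed.

Lemma norm_sin_shift a t : `|sin (2 * (a + t)) - sin (2 * a)| <= 2 * `|sin t|.
Proof.
rewrite (_ : 2 * (a + t) = 2 * a + (t + t)); last by ring.
rewrite sinD cosD sinD.
have h : cos t ^+ 2 = 1 - sin t ^+ 2 by exact: cos2sin2.
rewrite (_ : _ - _ = 2 * sin t * (cos (2 * a) * cos t - sin (2 * a) * sin t)); last first.
  rewrite (_ : cos t * cos t = 1 - sin t ^+ 2); last by rewrite -h expr2.
  by ring.
rewrite -cosD normrM -[leRHS]mulr1; apply: ler_pM => //.
  by rewrite normrM ger0_norm.
by rewrite ler_norml cos_geN1 cos_le1.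
Qed.

Lemma norm_sin_sum (I : Type) (s : seq I) (P : pred I) (x : I -> R) :
  `|sin (\sum_(i <- s | P i) x i)| <= \sum_(i <- s | P i) `|sin (x i)|.
Proof.
elim: s => [|i s ih]; first by rewrite !big_nil sin0 normr0.
rewrite !big_cons; case: (P i) => //.
rewrite sinD; apply: normD_le; last first.
  rewrite normrM -[leRHS]mul1r; apply: ler_pM => //.
  by rewrite ler_norml cos_geN1 cos_le1.
rewrite normrM ler_piMr//; by rewrite ler_norml cos_geN1 cos_le1.
Qed.

Lemma dr_sum (I : Type) (s : seq I) (F : I -> R -> R) (dF : I -> R) (r : R) :
  (forall i, is_derive r (1 : R) (F i) (dF i)) ->
  is_derive r (1 : R) (fun x => \sum_(i <- s) F i x) (\sum_(i <- s) dF i).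
Proof.
move=> h; elim: s => [|i s ih].
  rewrite big_nil (_ : (fun x => _) = (fun=> 0)); first exact: drC.
  by apply/funext => x; rewrite big_nil.
rewrite big_cons (_ : (fun x => _) = (fun x => F i x + \sum_(j <- s) F j x)); first exact: drD.
by apply/funext => x; rewrite big_cons.
Qed.

End Trigonometry.

(** * The interaction potential seen from the j-th bubble *)

Section Interaction.
Variables (R : realType) (k : nat) (psi : R -> R) (delta K : R).
Hypotheses (hk : (2 <= k)%N) (psi_smooth : smooth_pos psi) (K0 : 0 < K)
  (hK : weight_bound psi K) (delta0 : 0 < delta).
Variables (J : nat) (iota lam : 'I_J -> R) (j : 'I_J).
Hypotheses (iota1 : forall i, iota i = 1 \/ iota i = -1) (lam0 : forall i, 0 < lam i).
Local Notation pair := ((R -> R) * (R -> R))%type.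
Implicit Types (f e : R -> R) (phi h g : pair) (r : R).

Local Notation k' := (k%:R : R).
Local Notation Xop := (multiplier k psi delta).
Local Notation U := (multiQ k iota lam).
Local Notation Qj := (fun r : R => Q k (r / lam j)).

Definition ovl r : R := \sum_(i | i != j) sinQ k (lam i) r.
Definition pot r : R := k' ^+ 2 * ((cos (2 * U r) - cos (2 * Qj r)) / r ^+ 2).
Definition dpot r : R := k' ^+ 2 *
  ((- (2 * k' * (sin (2 * U r) * (\sum_i iota i * sinQ k (lam i) r) - sin (2 * Qj r) * sinQ k (lam j) r)))
   - 2 * (cos (2 * U r) - cos (2 * Qj r))) / r ^+ 3.

Lemma ovl_ge0 r : 0 < r -> 0 <= ovl r.
Proof. by move=> r0; apply: sumr_ge0 => i _; exact: sinQ_ge0. Qed.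

Lemma ovl_le r : 0 < r -> ovl r <= J%:R.
Proof.
move=> r0; apply: (@le_trans _ _ (\sum_(i < J) 1)); last by rewrite sumr_const card_ord.
rewrite /ovl [leRHS](bigD1 j)//=; apply: ler_wpDl => //.
by apply: ler_sum => i _; exact: le_trans (ler_norm _) (norm_sinQ _ _ _).
Qed.

Lemma U_split r : U r = iota j * Qj r + \sum_(i | i != j) iota i * Q k (r / lam i).
Proof. by rewrite /multiQ (bigD1 j). Qed.

Lemma norm_iota i : `|iota i| = 1.
Proof. by case: (iota1 i) => ->; rewrite ?normrN normr1. Qed.

Lemma sin_theta_le r : 0 < r ->
  `|sin (\sum_(i | i != j) iota i * Q k (r / lam i))| <= ovl r.
Proof.
move=> r0; apply: (le_trans (norm_sin_sum _ _ _)); apply: ler_sum => i _.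
case: (iota1 i) => ->; rewrite ?mul1r ?mulN1r ?sinN ?normrN;
  by rewrite -/(sinQ k (lam i) r) ger0_norm ?sinQ_ge0.
Qed.

Lemma cos_diff_le r : 0 < r -> `|cos (2 * U r) - cos (2 * Qj r)| <= 2 * ovl r.
Proof.
move=> r0; rewrite U_split.
have -> : cos (2 * Q k (r / lam j)) = cos (2 * (iota j * Q k (r / lam j))).
  by case: (iota1 j) => ->; rewrite ?mul1r// mulN1r mulrN cosN.
apply: (le_trans (norm_cos_shift _ _)); rewrite ler_pM2l//.
exact: sin_theta_le.
Qed.

(** The bubbles other than [j] contribute [ovl] through the sum. The [j]-th one leaves a difference
    of sines, at most [2 * ovl] once its sign has been moved through the odd sine. *)
Lemma sin_diff_le r : 0 < r ->
  `|sin (2 * U r) * (\sum_i iota i * sinQ k (lam i) r) - sin (2 * Qj r) * sinQ k (lam j) r| <=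
  3 * ovl r.
Proof.
move=> r0; rewrite (bigD1 j)//=.
have h1 : `|\sum_(i | i != j) iota i * sinQ k (lam i) r| <= ovl r.
  apply: (le_trans (ler_norm_sum _ _ _)); apply: ler_sum => i _.
  by rewrite normrM norm_iota mul1r ger0_norm// sinQ_ge0.
have h2 : `|iota j * sin (2 * U r) - sin (2 * Qj r)| <= 2 * ovl r.
  have -> : sin (2 * Q k (r / lam j)) = iota j * sin (2 * (iota j * Q k (r / lam j))).
    by case: (iota1 j) => ->; rewrite ?mul1r// !mulN1r mulrN sinN opprK.
  rewrite -mulrBr normrM norm_iota mul1r U_split.
  apply: (le_trans (norm_sin_shift _ _)); rewrite ler_pM2l//; exact: sin_theta_le.
set T := \sum_(i | _) _ in h1 *.
rewrite (_ : _ - _ = sin (2 * U r) * T +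
   (iota j * sin (2 * U r) - sin (2 * Qj r)) * sinQ k (lam j) r); last by ring.
rewrite (_ : 3 * ovl r = 1 * ovl r + 2 * ovl r * 1); last by ring.
apply: normD_le; apply: normM_le => //; last exact: norm_sinQ.
by rewrite ler_norml sin_geN1 sin_le1.
Qed.

Lemma smooth_pos_U : smooth_pos U.
Proof.
apply: smooth_pos_sum => i _; apply: smooth_posM; first exact: smooth_pos_cst.
exact: smooth_pos_rescale (lam0 i) (@smooth_pos_Q R k hk).
Qed.

Lemma smooth_pos_pot : smooth_pos pot.
Proof.
have s2 : smooth_pos (fun=> 2 : R) := @smooth_pos_cst R 2.
apply: smooth_posM; first exact: smooth_pos_cst.
apply: smooth_posM.
  apply: smooth_posD; first by apply: smooth_pos_cos; exact: smooth_posM smooth_pos_U.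
  apply: smooth_posN; apply: smooth_pos_cos; apply: smooth_posM s2 _.
  exact: smooth_pos_rescale (lam0 j) (@smooth_pos_Q R k hk).
apply: smooth_posV; first by move=> r r0; rewrite expf_neq0// gt_eqF.
by apply: smooth_posX; exact: smooth_pos_id.
Qed.

Lemma is_derive_pot r : 0 < r -> is_derive r (1 : R) pot (dpot r).
Proof.
move=> r0; have rn : r ^+ 2 != 0 by rewrite expf_neq0// gt_eqF.
have dU : is_derive r (1 : R) U (\sum_i iota i * (k' * sinQ k (lam i) r / r)).
  have h i : is_derive r (1 : R) (fun x => iota i * scale (lam i) (Q k) x)
      (iota i * (k' * sinQ k (lam i) r / r)).
    apply: is_derive_eq (drM (drC (iota i) r) (is_derive_Q_rescale hk (lam0 i) r0)) _.
    by rewrite mul0r add0r.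
  exact: dr_sum h.
rewrite (_ : \sum_i _ = k' / r * (\sum_i iota i * sinQ k (lam i) r)) in dU; last first.
  by rewrite mulr_sumr; apply: eq_bigr => i _; ring.
have dQ := is_derive_Q_rescale hk (lam0 j) r0.
have dc := drB (is_derive_cos_comp (drM (drC 2 r) dU)) (is_derive_cos_comp (drM (drC 2 r) dQ)).
have dV := drV (f := fun s => s ^+ 2) rn (drX2 (drI r)).
apply: is_derive_eq (drM (drC (k' ^+ 2) r) (drM dc dV)) _.
by rewrite /dpot; field; rewrite gt_eqF.
Qed.

(** [6 k + 4] comes from the derivative of the potential, 2 from the potential times the derivative
    of [f], and [2 k] from the zeroth-order term of [A]. *)
Definition Cpot : R := k' ^+ 2 * (8 * k' + 6).

Lemma Cpot_ge0 : 0 <= Cpot. Proof. by rewrite mulr_ge0 ?sqr_ge0// addr_ge0// mulr_ge0. Qed.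

Definition Apot f r : R := Aop k (lam j) (fun s => pot s * f s) r.

Lemma ApotE f r : test_fun f -> 0 < r ->
  Apot f r = - (dpot r * f r + pot r * derive1 f r) + k' * cosQ k (lam j) r / r * (pot r * f r).
Proof.
move=> ft r0; rewrite /Apot /Aop.
by rewrite (is_derive1E (drM (is_derive_pot r0) (test_fun_is_derive ft r0))).
Qed.

Lemma norm_Apot f r : test_fun f -> 0 < r ->
  `|r ^+ 2 * Apot f r| <= Cpot * ovl r * jet 1 f r.
Proof.
move=> ft r0; rewrite ApotE//.
have rn : r != 0 by rewrite gt_eqF.
rewrite [X in `|X|](_ : _ = - ((r ^+ 3 * dpot r) * (f r / r)) - (r ^+ 2 * pot r) * derive1 f r +
  (k' * cosQ k (lam j) r) * (r ^+ 2 * pot r) * (f r / r)); last by field.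
have k2 : `|k' ^+ 2| <= k' ^+ 2 by rewrite ger0_norm ?sqr_ge0.
have hp : `|r ^+ 2 * pot r| <= k' ^+ 2 * (2 * ovl r).
  rewrite (_ : _ * _ = k' ^+ 2 * (cos (2 * U r) - cos (2 * Qj r))); last by rewrite /pot; field.
  by apply: normM_le => //; exact: cos_diff_le.
have hd : `|r ^+ 3 * dpot r| <= k' ^+ 2 * (2 * k' * (3 * ovl r) + 2 * (2 * ovl r)).
  rewrite (_ : _ * _ = k' ^+ 2 * (- (2 * k' * (sin (2 * U r) * (\sum_i iota i * sinQ k (lam i) r) -
     sin (2 * Qj r) * sinQ k (lam j) r)) - 2 * (cos (2 * U r) - cos (2 * Qj r)))); last first.
    by rewrite /dpot; field.
  apply: normM_le => //; apply: normB_le.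
    by apply: normN_le; apply: normM_le (sin_diff_le r0); rewrite ger0_norm// mulr_ge0.
  by apply: normM_le (cos_diff_le r0); rewrite ger0_norm.
have h := normD_le (normB_le (normN_le (normM_le hd (jet1_id f r))) (normM_le hp (jet1_derive1 f r)))
  (normM_le (normM_le (norm_kcos k (lam j) r) hp) (jet1_id f r)).
apply: (le_trans h); rewrite /Cpot; apply: eq_ge; ring.
Qed.

Lemma jet1_le_jet2 f r : 0 < r -> jet 1 f r <= r * jet 2 f r.
Proof.
move=> r0; rewrite -(ler_sqr (jet_ge0 1 f r)); last by rewrite nnegrE mulr_ge0 ?jet_ge0// ltW.
rewrite exprMn !jet_sqr jet_sq21//.
rewrite [leRHS](_ : _ = r ^+ 2 * derive1 (derive1 f) r ^+ 2 + jet_sq 1 f r); last first.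
  by field; rewrite gt_eqF.
by rewrite lerDr mulr_ge0 ?sqr_ge0.
Qed.

Definition M0_pot phi : R := M0 k psi delta (lam j) phi.1 (fun r => - (pot r * phi.1 r)).
(** One power of [r] is moved across the product: [r * Apot] is then bounded by the jet, and the
    quotient of the multiplier by [r] by the jet over [lam j], so both factors are linear
    densities. *)
Definition Db phi r : R := (- (r * Apot phi.1 r)) * (Xop (lam j) phi.1 r / r).

Lemma test_fun_pot f : test_fun f -> test_fun (fun r => - (pot r * f r)).
Proof. by move=> ft; exact: test_funN (test_funMl smooth_pos_pot ft). Qed.

Lemma Aop_potN f r : test_fun f -> 0 < r ->
  Aop k (lam j) (fun s => - (pot s * f s)) r = - Apot f r.
Proof.
move=> ft r0; rewrite /Apot /Aop.
have d := drM (is_derive_pot r0) (test_fun_is_derive ft r0).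
by rewrite (is_derive1E (drN d)) (is_derive1E d); ring.
Qed.

Lemma M0_potE phi : test_pair phi -> rintegrable (Db phi) /\ M0_pot phi = rint (Db phi).
Proof.
move=> [ft _]; have [Ni qE] := M0_test hk psi_smooth K0 hK delta0 (lam0 j) ft (test_fun_pot ft).
have E (r : R) : 0 < r -> Aop k (lam j) (fun s => - (pot s * phi.1 s)) r * Xop (lam j) phi.1 r = Db phi r.
  by move=> r0; rewrite (Aop_potN ft r0) /Db; field; rewrite gt_eqF.
by split; [exact: rintegrable_eq E Ni|rewrite /M0_pot qE; exact: rint_eq].
Qed.

Lemma M0_pot_cauchy g : in_H2 g -> quad_cauchy M0_pot g.
Proof.
move=> gH; apply: (quad_density_cauchy gH (D := Db)); last exact: M0_potE.
apply: quad_densityM.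
  exists (Cpot * J%:R) => [|phi h r [ft _] [et _] r0]; first by rewrite mulr_ge0 ?Cpot_ge0.
  split.
    rewrite !ApotE//=; last exact: test_funD ft (test_funN et).
    by rewrite derive1_test_sub//; ring.
  rewrite normrN -(ler_pM2l r0) (_ : r * `|r * Apot phi.1 r| = `|r ^+ 2 * Apot phi.1 r|); last first.
    by rewrite !normrM gtr0_norm//; ring.
  apply: (le_trans (norm_Apot ft r0)).
  have h1 : Cpot * ovl r * jet 1 phi.1 r <= Cpot * J%:R * (r * jet 2 phi.1 r).
    apply: ler_pM; rewrite ?jet_ge0//; first by rewrite mulr_ge0 ?Cpot_ge0 ?ovl_ge0.
      by rewrite ler_wpM2l ?Cpot_ge0 ?ovl_le.
    exact: jet1_le_jet2.
  apply: (le_trans h1); rewrite mulrCA ler_pM2l//; apply: ler_wpM2l.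
    by rewrite mulr_ge0 ?Cpot_ge0.
  exact: jet2_jetN.
exists (Cmult k delta K / lam j) => [|phi h r [ft _] [et _] r0].
  by rewrite divr_ge0// ltW// Cmult_gt0.
split.
  rewrite /multiplier (dAop_sub _ _ ft et r0) (Aop_sub _ _ ft et r0); ring.
rewrite normrM [`|r^-1|]gtr0_norm ?invr_gt0// ler_pdivrMr//.
apply: (le_trans (norm_Xop k K0 hK delta0 phi.1 (lam0 j) r0)).
have CX0 := Cmult_gt0 k K0 delta0.
rewrite [leRHS](_ : _ = Cmult k delta K * (r / lam j) * jetN phi r); last by ring.
apply: ler_pM; [|exact: jet_ge0| |exact: jet2_jetN].
  apply: mulr_ge0; first exact: ltW.
  by apply: divr_ge0; [exact: ltW|apply: addr_ge0; exact: ltW].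
by rewrite ler_pM2l// ler_pM2l// lam_inv_le.
Qed.

(** Converts the tail of the [i]-th bubble into the Morawetz weight of scale [i]. A gain is
    available only if [lam i] is the smaller scale, since [lam i] is then replaced by
    [kappa * lam j <= kappa * (lam j + r)]. *)
Lemma sinQ_interaction i (kappa : R) r : 0 < r -> kappa = 1 \/ lam i <= kappa * lam j ->
  0 < kappa ->
  sinQ k (lam i) r * (r^-1 * (r / (lam j + r))) <= 32 * kappa * (lam i / (lam i + r) ^+ 2).
Proof.
move=> r0 hkap kap0; have li := lam0 i; have lj := lam0 j.
have si : 0 < lam i + r by rewrite addr_gt0.
have sj : 0 < lam j + r by rewrite addr_gt0.
have w0 : 0 <= r^-1 * (r / (lam j + r)).
  by apply: mulr_ge0; [rewrite invr_ge0 ltW|apply: divr_ge0; exact: ltW].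
apply: (le_trans (ler_wpM2r w0 (sinQ_le hk li r0))).
rewrite -!mulrA ler_pM2l//.
have key : lam i * r ^+ 2 <= kappa * ((lam i + r) ^+ 2 * (lam j + r)).
  case: hkap => [->|hl].
    rewrite mul1r (_ : _ * _ = r ^+ 2 * lam i * 1) ?mulr1; last by ring.
    have h1 : lam i * r <= (lam i + r) ^+ 2.
      by rewrite sqrrD -mulr_natl; have := sqr_ge0 (lam i); have := sqr_ge0 r; have := mulr_gt0 li r0; lra.
    rewrite (_ : r ^+ 2 * lam i = lam i * r * r); last by ring.
    apply: ler_pM => //; [by rewrite mulr_ge0// ltW|exact: ltW|by rewrite lerDr ltW].
  apply: (@le_trans _ _ (kappa * lam j * r ^+ 2)); first by rewrite ler_pM2r ?exprn_gt0.
  rewrite -mulrA ler_pM2l// mulrC; apply: ler_pM; rewrite ?exprn_ge0//; try exact: ltW.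
    by rewrite lerXn2r ?nnegrE ?lerDr//; exact: ltW.
  by rewrite lerDl ltW.
pose P := lam i / ((lam i + r) ^+ 4 * (lam j + r)).
have P0 : 0 <= P by apply: divr_ge0; [exact: ltW|rewrite mulr_ge0 ?exprn_ge0//; exact: ltW].
have := ler_wpM2l P0 key; rewrite /P => h.
rewrite [leLHS](_ : _ = lam i / ((lam i + r) ^+ 4 * (lam j + r)) * (lam i * r ^+ 2)); last first.
  by field; rewrite !gt_eqF.
apply: (le_trans h); apply: eq_ge.
by field; rewrite !gt_eqF.
Qed.

(** Each interaction is charged to the Morawetz norm at the scale of the interfering bubble, never
    at scale [j]; this is what makes the weights [delta0 ^+ j] and [delta0 ^+ i] comparable
    afterwards. *)
Lemma M0_pot_le phi (kappa : 'I_J -> R) : test_pair phi -> (forall i, 0 < kappa i) ->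
  (forall i, kappa i = 1 \/ lam i <= kappa i * lam j) ->
  `|M0_pot phi| <= 32 * Cpot * Cmult k delta K * \sum_(i | i != j) kappa i * Mor_sq (lam i) phi.
Proof.
move=> pt kap0 hkap; have [Di ->] := M0_potE pt; have [ft _] := pt.
have gH := test_pair_in_H2 pt.
have CX0 := ltW (Cmult_gt0 k K0 delta0); have CB0 := Cpot_ge0.
have mi i := rintegrable_mor_density gH (lam0 i).
have si : rintegrable (fun r => \sum_(i | i != j) kappa i * mor_density (lam i) phi r).
  by apply: rintegrable_sum => i _; exact: rintegrableZ.
have -> : \sum_(i | i != j) kappa i * Mor_sq (lam i) phi =
    rint (fun r => \sum_(i | i != j) kappa i * mor_density (lam i) phi r).
  rewrite rint_sum; last by move=> i _; exact: rintegrableZ.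
  by apply: eq_bigr => i _; rewrite rintZ.
rewrite -rintZ//; apply: rint_norm_le => //; first exact: rintegrableZ.
move=> r r0; have rn : r != 0 by rewrite gt_eqF.
have hA := norm_Apot ft r0.
have hX := norm_Xop k K0 hK delta0 phi.1 (lam0 j) r0.
have r2 : `|r ^- 2| <= r ^- 2 by rewrite ger0_norm// invr_ge0 sqr_ge0.
rewrite [X in `|X|](_ : _ = - (r ^- 2 * (r ^+ 2 * Apot phi.1 r) * Xop (lam j) phi.1 r)); last first.
  by rewrite /Db; field.
apply: (le_trans (normN_le (normM_le (normM_le r2 hA) hX))).
have w0 : 0 <= r^-1 * (r / (lam j + r)).
  apply: mulr_ge0; first by rewrite invr_ge0 ltW.
  by apply: divr_ge0; [exact: ltW|apply: addr_ge0; exact: ltW].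
have o0 := ovl_ge0 r0.
apply: (@le_trans _ _ (Cpot * Cmult k delta K * (ovl r * (r^-1 * (r / (lam j + r)))) * jet_sq 2 phi.1 r)).
  rewrite [leLHS](_ : _ = Cpot * Cmult k delta K * (ovl r * (r^-1 * (r / (lam j + r)))) *
    (jet 1 phi.1 r / r * jet 2 phi.1 r)); last by field; rewrite rn gt_eqF// addr_gt0.
  apply: ler_wpM2l; first by apply: mulr_ge0; apply: mulr_ge0.
  rewrite -jet_sqr expr2; apply: ler_wpM2r; first exact: jet_ge0.
  by rewrite ler_pdivrMr// mulrC jet1_le_jet2.
have key : ovl r * (r^-1 * (r / (lam j + r))) * jet_sq 2 phi.1 r <=
    32 * \sum_(i | i != j) kappa i * mor_density (lam i) phi r.
  rewrite /ovl mulr_suml mulr_suml mulr_sumr; apply: ler_sum => i _.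
  have h := sinQ_interaction r0 (hkap i) (kap0 i).
  apply: (le_trans (ler_wpM2r (jet_sq_ge0 2 phi.1 r) h)).
  rewrite [leLHS](_ : _ = 32 * (kappa i * (jet_sq 2 phi.1 r * (lam i / (lam i + r) ^+ 2)))); last by ring.
  rewrite ler_pM2l// ler_pM2l//.
  exact: mor_density_ge2.
have := ler_wpM2l (mulr_ge0 CB0 CX0) key; set Sg := \sum_(i | _) _; set A := ovl r * _; clearbody Sg A.
move=> h; rewrite -[leLHS]mulrA; apply: (le_trans h); apply: eq_ge; ring.
Qed.

End Interaction.

(** * Multi-bubble forms *)

Section MultiBubble.
Variables (R : realType) (k : nat) (psi : R -> R) (delta K : R).
Hypotheses (hk : (2 <= k)%N) (psi_smooth : smooth_pos psi) (K0 : 0 < K)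
  (hK : weight_bound psi K) (deltap : 0 < delta).
Variables (J : nat) (delta0 : R).
Hypotheses (d0 : 0 < delta0) (d1 : delta0 <= 1).
Local Notation pair := ((R -> R) * (R -> R))%type.
Implicit Types (lam iota : 'I_J -> R) (g : pair).

Local Notation M := (@Mform R k J psi delta delta0).

Lemma norm_le_of_sqr (x y : R) : 0 <= y -> x ^+ 2 <= y ^+ 2 -> `|x| <= y.
Proof. by move=> y0 xy; rewrite -ler_sqr ?nnegrE// real_normK ?num_real. Qed.

Lemma dpow_ge0 n : 0 <= delta0 ^+ n. Proof. by apply: exprn_ge0; exact: ltW. Qed.

Lemma dpow_le1 n : delta0 ^+ n <= 1. Proof. by apply: exprn_ile1 => //; exact: ltW. Qed.

Lemma dpow_mono (m n : nat) : (m <= n)%N -> delta0 ^+ n <= delta0 ^+ m.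
Proof. by move=> mn; rewrite -(subnK mn) exprD ler_piMl ?dpow_ge0 ?dpow_le1. Qed.

Lemma Mor_multi_ge lam g (j : 'I_J) : (forall i, 0 < lam i) ->
  delta0 ^+ j * Mor_sq (lam j) g <= Mor_multi_sq delta0 lam g.
Proof.
move=> l0; rewrite /Mor_multi_sq (bigD1 j)//= lerDl; apply: sumr_ge0 => i _.
by apply: mulr_ge0; [exact: dpow_ge0|exact: (Mor_sq_ge0 g (l0 _))].
Qed.

Lemma Mor_multi_ge0 lam g : (forall i, 0 < lam i) -> 0 <= Mor_multi_sq delta0 lam g.
Proof.
by move=> l0; apply: sumr_ge0 => i _; apply: mulr_ge0; [exact: dpow_ge0|exact: (Mor_sq_ge0 g (l0 _))].
Qed.

Lemma Mor_norm_sqr lam g : (forall i, 0 < lam i) ->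
  Mor_norm delta0 lam g ^+ 2 = Mor_multi_sq delta0 lam g.
Proof. by move=> l0; rewrite sqr_sqrtr// Mor_multi_ge0. Qed.

(** The hypothesis concerns consecutive scales only. Along a chain of indices one factor [alpha] is
    kept and the others are dropped, being at most 1. *)
Lemma scales_lt (alpha : R) lam : alpha <= 1 -> scales alpha lam ->
  forall i j : 'I_J, (i < j)%N -> lam j <= alpha * lam i.
Proof.
move=> a1 [l0 hl] i.
have step (a b : 'I_J) : b = a.+1 :> nat -> lam b <= alpha * lam a.
  by move=> e; have := hl a b e; rewrite ltr_pdivrMr// => /ltW.
have main n : forall j : 'I_J, j = (i + n.+1)%N :> nat -> lam j <= alpha * lam i.
  elim: n => [|n ih] j e; first by apply: step; rewrite e addn1.
  have lt : (i + n.+1 < J)%N by rewrite (leq_trans _ (ltn_ord j))// e !addnS.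
  have := ih (Ordinal lt) erefl; have := step (Ordinal lt) j; rewrite /= e addnS => /(_ erefl).
  move=> h1 h2; apply: (le_trans h1); apply: le_trans h2.
  by rewrite ler_piMl// ltW.
move=> j ij; apply: (main (j - i.+1)%N); rewrite -addSnnS subnKC//.
Qed.

Lemma multi_bounded lam g : in_H2 g -> (forall i, 0 < lam i) ->
  `|M lam g.1 g.2| <= J%:R * ((1 + k%:R) * Cmult k delta K) *
    rint (fun r => jet 2 g.1 r * jet 1 g.2 r).
Proof.
move=> gH l0; apply: (le_trans (ler_norm_sum _ _ _)).
apply: (@le_trans _ _ (\sum_(j < J) (1 + k%:R) * Cmult k delta K * rint (fun r => jet 2 g.1 r * jet 1 g.2 r))).
  apply: ler_sum => j _; rewrite normrM ger0_norm ?dpow_ge0//.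
  rewrite -[leRHS]mul1r; apply: ler_pM; [exact: dpow_ge0|exact: normr_ge0|exact: dpow_le1|].
  exact: (M0_bounded hk psi_smooth K0 hK deltap gH).
rewrite sumr_const card_ord -mulr_natl; apply: eq_ge; ring.
Qed.

(** A single summand depends on the varied scale. In the squared estimate it carries [delta0] to the
    power [2 j], which is at most the weight [delta0 ^+ j] of the Morawetz norm. *)
Lemma multi_scale_derivative lam g (j : 'I_J) : in_H2 g -> (forall i, 0 < lam i) ->
  let M_j := fun l : R => M (@dfwith 'I_J (fun=> R) lam j l) g.1 g.2 in
  derivable M_j (lam j) 1 /\
  `|lam j * derive1 M_j (lam j)| <=
    2 * Cscale k delta K * (Num.sqrt (lam j) * H2norm g * Mor_norm delta0 lam g).
Proof.
move=> gH l0 M_j.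
pose D := rint (fun r => dN k psi delta g (lam j) r / lam j).
have hD : is_derive (lam j) (1 : R) M_j (delta0 ^+ j * D).
  have -> : M_j = fun l => delta0 ^+ j * M0 k psi delta l g.1 g.2 +
      \sum_(i < J | i != j) delta0 ^+ i * M0 k psi delta (lam i) g.1 g.2.
    apply/funext => l; rewrite /M_j /Mform (bigD1 j)//= dfwithin; congr (_ + _).
    by apply: eq_bigr => i ij; rewrite dfwithout// eq_sym.
  have h := M0_scale_derivative hk psi_smooth K0 hK deltap gH (l0 j).
  apply: is_derive_eq (drD (drM (drC (delta0 ^+ j) (lam j)) h) (drC _ (lam j))) _.
  by rewrite mul0r add0r addr0.
split; first exact: is_derive_derivable hD.
rewrite (is_derive1E hD); have C0 := Cscale_ge0 k K0 deltap.
have N0 : 0 <= Mor_norm delta0 lam g := sqrtr_ge0 _.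
apply: norm_le_of_sqr.
  apply: mulr_ge0; first exact: mulr_ge0.
  apply: mulr_ge0 => //; apply: mulr_ge0; exact: sqrtr_ge0.
have h := M0_scale_derivative_le hk psi_smooth K0 hK deltap gH (l0 j).
rewrite mulrCA exprMn; have p0 : 0 <= (delta0 ^+ j) ^+ 2 := sqr_ge0 _.
apply: (le_trans (ler_wpM2l p0 h)).
rewrite !exprMn (sqr_sqrtr (ltW (l0 j))) Mor_norm_sqr//.
have key : (delta0 ^+ j) ^+ 2 * Mor_sq (lam j) g <= Mor_multi_sq delta0 lam g.
  apply: le_trans (Mor_multi_ge g j l0); rewrite expr2 -mulrA ler_piMl ?dpow_le1//.
  by apply: mulr_ge0; [exact: dpow_ge0|exact: (Mor_sq_ge0 g (l0 _))].
have c0 : 0 <= 4 * Cscale k delta K ^+ 2 * lam j * H2norm g ^+ 2.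
  apply: mulr_ge0; last exact: sqr_ge0.
  by apply: mulr_ge0; [rewrite mulr_ge0 ?sqr_ge0|exact: ltW].
have := ler_wpM2l c0 key.
set a := Cscale k delta K; set b := H2norm g; set c := Mor_sq _ _; set d := Mor_multi_sq _ _ _.
set e := delta0 ^+ j; rewrite (_ : _ * (e ^+ 2 * c) = e ^+ 2 * (4 * a ^+ 2 * (lam j * b ^+ 2 * c))).
  by rewrite (_ : 4 * a ^+ 2 * lam j * b ^+ 2 * d = 2 ^+ 2 * a ^+ 2 * (lam j * b ^+ 2 * d)) //; ring.
by ring.
Qed.

Lemma M0_LQ_same (c : R) (l : R) g : 0 < l -> M0 k psi delta l g.1 (LQ k c l) = 0.
Proof.
move=> l0; have z r : 0 < r -> Aop k l (LQ k c l) r = 0.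
  by move=> r0; rewrite (Aop_LQ hk)// subrr mulr0 mul0r.
have aux f : rdot (Aop k l (LQ k c l)) f = 0.
  by rewrite -[RHS](rint0 R); apply: rint_eq => r r0; rewrite z// mul0r.
by rewrite /M0 !aux mulr0 subrr.
Qed.

Lemma modulation_term (alpha : R) lam g (c : R) (i j : 'I_J) : in_H2 g ->
  0 < alpha -> alpha <= 1 -> scales alpha lam -> `|c| = (lam j)^-1 -> i != j ->
  delta0 ^+ i * `|M0 k psi delta (lam i) g.1 (LQ k c (lam j))| <=
  2 * Cmod k delta K * (delta0 + Num.sqrt alpha * delta0 ^- J) *
    ((Num.sqrt (lam j))^-1 * Num.sqrt delta0 ^+ j * Mor_norm delta0 lam g).
Proof.
move=> gH a0 a1 sc hc ij; have [l0 _] := sc.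
have C40 : 0 <= Cmod k delta K.
  by rewrite /Cmod; apply: mulr_ge0; [rewrite mulr_ge0 ?sqr_ge0|exact: ltW (Cmult_gt0 k K0 deltap)].
pose eta := delta0 + Num.sqrt alpha * delta0 ^- J.
have sa := sqrtr_ge0 alpha.
have dJ : 0 <= delta0 ^- J by rewrite invr_ge0 dpow_ge0.
(* For [i < j] the separation allows [kappa = alpha], and [delta0 ^- J] compensates for the missing
   powers of [delta0]. For [i > j] there is no gain, [kappa = 1], but
   [delta0 ^+ i <= delta0 ^+ j.+1]. *)
have [kappa [kap0 hkap hsm]] : exists kappa : R, [/\ 0 < kappa,
    kappa = 1 \/ lam j <= kappa * lam i &
    delta0 ^+ i * Num.sqrt kappa <= eta * delta0 ^+ j].
  have [lt|gt|e] := ltngtP i j; last by rewrite (val_inj e) eqxx in ij.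
    exists alpha; split => //; first by right; exact: scales_lt a1 sc _ _ lt.
    apply: (@le_trans _ _ (Num.sqrt alpha * delta0 ^- J * delta0 ^+ j)); last first.
      by rewrite ler_wpM2r ?dpow_ge0// lerDr ltW.
    rewrite mulrC -mulrA ler_wpM2l//; apply: (le_trans (dpow_le1 i)).
    rewrite mulrC ler_pdivlMr ?exprn_gt0// mul1r.
    exact: dpow_mono (ltnW (ltn_ord j)).
  exists 1; split => //; first by left.
  rewrite sqrtr1 mulr1; apply: (@le_trans _ _ (delta0 * delta0 ^+ j)); last first.
    by rewrite ler_wpM2r ?dpow_ge0// lerDl mulr_ge0.
  by rewrite -exprS; exact: dpow_mono.
have h := M0_LQ hk psi_smooth K0 hK deltap gH (l0 i) (l0 j) hc hkap kap0.
set m := M0 _ _ _ _ _ _ in h *.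
have Mj0 := Mor_sq_ge0 g (l0 j).
have h2 : `|m| <= 2 * Cmod k delta K * Num.sqrt kappa * ((Num.sqrt (lam j))^-1 * Num.sqrt (Mor_sq (lam j) g)).
  apply: norm_le_of_sqr.
    have ? : 0 <= (Num.sqrt (lam j))^-1 by rewrite invr_ge0 sqrtr_ge0.
    have ? : 0 <= Num.sqrt (Mor_sq (lam j) g) := sqrtr_ge0 _.
    have ? : 0 <= Num.sqrt kappa := sqrtr_ge0 _.
    apply: mulr_ge0; last exact: mulr_ge0.
    apply: mulr_ge0 => //; exact: mulr_ge0.
  apply: (le_trans h); rewrite !exprMn exprVn !sqr_sqrtr ?(ltW kap0) ?(ltW (l0 j))//.
  by apply: eq_ge; ring.
have h3 : Num.sqrt delta0 ^+ j * Num.sqrt (Mor_sq (lam j) g) <= Mor_norm delta0 lam g.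
  have s0 : 0 <= Num.sqrt delta0 ^+ j by rewrite exprn_ge0 ?sqrtr_ge0.
  rewrite -(ger0_norm s0) -sqrtr_sqr -sqrtrM ?sqr_ge0//; apply: ler_wsqrtr.
  by rewrite exprAC (sqr_sqrtr (ltW d0)); exact: Mor_multi_ge.
apply: (le_trans (ler_wpM2l (dpow_ge0 i) h2)).
set s := Num.sqrt (Mor_sq _ _) in h3 *; set p := (Num.sqrt (lam j))^-1.
have p0 : 0 <= p by rewrite invr_ge0 sqrtr_ge0.
have s0 : 0 <= s := sqrtr_ge0 _.
rewrite [leLHS](_ : _ = 2 * Cmod k delta K * (p * s) * (delta0 ^+ i * Num.sqrt kappa)); last by ring.
have q0 : 0 <= 2 * Cmod k delta K * (p * s).
  by apply: mulr_ge0; apply: mulr_ge0.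
apply: (le_trans (ler_wpM2l q0 hsm)).
(* One square root of [delta0 ^+ j] stays in the bound; the other completes [s] to a term of the
   Morawetz norm. *)
have dj : delta0 ^+ j = Num.sqrt delta0 ^+ j * Num.sqrt delta0 ^+ j.
  by rewrite -exprMn -expr2 sqr_sqrtr// ltW.
rewrite dj [leLHS](_ : _ = 2 * Cmod k delta K * eta * (p * Num.sqrt delta0 ^+ j *
  (Num.sqrt delta0 ^+ j * s))); last by ring.
apply: ler_wpM2l.
  apply: mulr_ge0; first exact: mulr_ge0.
  by apply: addr_ge0; [exact: ltW|exact: mulr_ge0].
by apply: ler_wpM2l => //; rewrite mulr_ge0 ?exprn_ge0 ?sqrtr_ge0.
Qed.

Lemma multi_modulation (alpha : R) iota lam g (j : 'I_J) : in_H2 g ->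
  0 < alpha -> alpha <= 1 -> P_J alpha iota lam ->
  `|M lam g.1 (bubble_underline iota lam (LambdaQ k) j)| <=
  J%:R * (2 * Cmod k delta K) * (delta0 + Num.sqrt alpha * delta0 ^- J) *
    ((Num.sqrt (lam j))^-1 * Num.sqrt delta0 ^+ j * Mor_norm delta0 lam g).
Proof.
move=> gH a0 a1 [hi sc]; have [l0 _] := sc.
pose c := (lam j)^-1 * iota j.
have hc : `|c| = (lam j)^-1.
  rewrite normrM ger0_norm ?invr_ge0 ?ltW//.
  by case: (hi j) => ->; rewrite ?normrN normr1 mulr1.
have -> : bubble_underline iota lam (LambdaQ k) j = LQ k c (lam j).
  by apply/funext => r; rewrite /bubble_underline /bubble /LQ mulrA.
apply: (le_trans (ler_norm_sum _ _ _)).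
pose T := 2 * Cmod k delta K * (delta0 + Num.sqrt alpha * delta0 ^- J) *
  ((Num.sqrt (lam j))^-1 * Num.sqrt delta0 ^+ j * Mor_norm delta0 lam g).
apply: (@le_trans _ _ (\sum_(i < J) T)); last first.
  by rewrite sumr_const card_ord -mulr_natl /T; apply: eq_ge; ring.
apply: ler_sum => i _; rewrite normrM ger0_norm ?dpow_ge0//.
have C40 : 0 <= Cmod k delta K.
  by rewrite /Cmod; apply: mulr_ge0; [rewrite mulr_ge0 ?sqr_ge0|exact: ltW (Cmult_gt0 k K0 deltap)].
have [->|ij] := eqVneq i j.
  rewrite (M0_LQ_same c g (l0 j)) normr0 mulr0 /T.
  have ? : 0 <= delta0 + Num.sqrt alpha * delta0 ^- J.
    apply: addr_ge0; first exact: ltW.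
    by apply: mulr_ge0; rewrite ?sqrtr_ge0// invr_ge0 dpow_ge0.
  have ? : 0 <= (Num.sqrt (lam j))^-1 by rewrite invr_ge0 sqrtr_ge0.
  have ? : 0 <= Mor_norm delta0 lam g := sqrtr_ge0 _.
  have ? : 0 <= Num.sqrt delta0 ^+ j by rewrite exprn_ge0 ?sqrtr_ge0.
  apply: mulr_ge0; last by apply: mulr_ge0 => //; exact: mulr_ge0.
  by apply: mulr_ge0 => //; exact: mulr_ge0.
exact: modulation_term gH a0 a1 sc hc ij.
Qed.

End MultiBubble.

Section Monotonicity.
Variables (R : realType) (k : nat) (chi psi : R -> R) (delta K : R).
Hypotheses (hk : (2 <= k)%N) (psi_smooth : smooth_pos psi) (K0 : 0 < K)
  (hK : weight_bound psi K) (deltap : 0 < delta) (hchi : is_cutoff chi).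
Local Notation pair := ((R -> R) * (R -> R))%type.
Implicit Types (g h phi : pair) (r l : R).

Local Notation Z := (Zprofile k chi).

Lemma smooth_pos_Z l : 0 < l -> smooth_pos (scale l Z).
Proof.
move=> l0; apply: (smooth_pos_rescale l0); case: hchi => cs _ _ _.
apply: smooth_posM; last exact: smooth_pos_cst.
apply: smooth_posM => //; apply: smooth_posM; first exact: smooth_pos_id.
exact: smooth_pos_derive1 (@smooth_pos_Q R k hk).
Qed.

Lemma Z_bounded l : 0 < l -> exists A : R, forall r, 0 < r -> `|scale l Z r| <= A.
Proof.
move=> l0; pose c := (rint (fun s => chi s * LambdaQ k s ^+ 2))^-1.
exists (1 * (k%:R * 1) * `|c|) => r r0; have y0 : 0 < r / l by rewrite divr_gt0.
case: hchi => _ /(_ _ y0)/andP[h0 h1] _ _.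
apply: normM_le => //; apply: normM_le; first by rewrite ger0_norm.
by rewrite LambdaQE//; apply: normM_le (norm_sinQ _ _ _); rewrite ger0_norm.
Qed.

Lemma Z_support l r : 0 < l -> 2 * l <= r -> scale l Z r = 0.
Proof.
move=> l0 lr; case: hchi => _ _ _ h; rewrite /scale /Zprofile h ?mul0r//.
by rewrite ler_pdivlMr.
Qed.

Definition pairing_sq l phi : R :=
  l ^- 7 * rdot (scale l Z) phi.1 ^+ 2 + l ^- 5 * rdot (scale l Z) phi.2 ^+ 2.

(** By orthogonality the pairing of [phi] is that of [phi - g], hence of the order of their
    distance. Written for an arbitrary component [u] so as to serve both the field and the velocity,
    with the sign [s] of the bubble. *)
Lemma pairing_component (u : pair -> R -> R) (m : nat) (s l : R) g : 0 < l ->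
  s = 1 \/ s = -1 -> in_H2 g -> pos_measurable (u g) ->
  (forall phi, test_pair phi -> test_fun (u phi)) ->
  (forall phi r, 0 < r -> ((u phi r - u g r) / r ^+ m) ^+ 2 <= dist_density phi g r) ->
  rdot (fun r => s * scale l Z r) (u g) = 0 ->
  exists2 B : R, 0 <= B & forall phi, test_pair phi ->
    rdot (scale l Z) (u phi) ^+ 2 <= B * H2norm (subp phi g) ^+ 2.
Proof.
move=> l0 hs gH mg ut ud zg; have [A hA] := Z_bounded l0.
have zs := smooth_pos_Z l0; have L0 : 0 < 2 * l by rewrite mulr_gt0.
exists (4 * (A ^+ 2 * (2 * l) ^+ (2 * m).+1 * (1 + 2 * l) ^+ 2)).
  apply: mulr_ge0 => //; apply: mulr_ge0; last exact: sqr_ge0.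
  by apply: mulr_ge0; [exact: sqr_ge0|rewrite exprn_ge0// ltW].
move=> phi pt; have ft := ut _ pt.
have mf : pos_measurable (fun r => u phi r - u g r).
  by apply: pos_measurableD; [exact: smooth_pos_measurable ft.1|exact: pos_measurableN].
have [zi] := rint_pairing (smooth_pos_measurable zs) mf (rintegrable_dist gH pt) L0
  (fun r _ => dist_density_ge0 phi g r) hA (fun r => @Z_support l r l0) (ud phi).
rewrite -H2norm_sub//; suff -> : rint (fun r => scale l Z r * (u phi r - u g r)) =
  rdot (scale l Z) (u phi) by [].
have zp := test_fun_rintegrable (test_funMl zs ft).
(* The zero is the pairing of [g], expressed through the two integrable products at hand; the sign
   is then divided out. *)
rewrite -[RHS]subr0; have -> : (0 : R) = rint (fun r => scale l Z r * u phi r - scale l Z r * (u phi r - u g r)).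
  have di := rintegrableB zp zi.
  have e : rint (fun r => s * (scale l Z r * u phi r - scale l Z r * (u phi r - u g r))) = 0.
    by rewrite -[RHS]zg; apply: rint_eq => r _; ring.
  rewrite rintZ// in e; case: hs e => ->; first by rewrite mul1r.
  by rewrite mulN1r => /eqP; rewrite oppr_eq0 => /eqP.
by rewrite rintB// opprB addrC subrK.
Qed.

Lemma pairing_bounded (s l : R) g : 0 < l -> s = 1 \/ s = -1 -> in_H2 g ->
  rdot (fun r => s * scale l Z r) g.1 = 0 -> rdot (fun r => s * scale l Z r) g.2 = 0 ->
  exists2 B : R, 0 <= B & forall phi, test_pair phi ->
    pairing_sq l phi <= B * H2norm (subp phi g) ^+ 2.
Proof.
move=> l0 hs gH z1 z2; case: (gH) => a1 _ a2 _.
have [||phi r r0|B1 B10 h1] := pairing_component (u := fun p => p.1) (m := 2) l0 hs gH _ _ _ z1.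
- exact: lac_measurable.
- by move=> phi [].
- by rewrite /dist_density -[leLHS]addr0 -[X in X + 0]add0r !lerD ?addr_ge0 ?sqr_ge0.
have [||phi r r0|B2 B20 h2] := pairing_component (u := fun p => p.2) (m := 1) l0 hs gH _ _ _ z2.
- exact: lac_measurable.
- by move=> phi [].
- by rewrite /dist_density expr1 -[leLHS]add0r lerD ?addr_ge0 ?sqr_ge0// lerDr sqr_ge0.
have l7 : 0 <= l ^- 7 by rewrite invr_ge0 exprn_ge0// ltW.
have l5 : 0 <= l ^- 5 by rewrite invr_ge0 exprn_ge0// ltW.
exists (l ^- 7 * B1 + l ^- 5 * B2) => [|phi pt].
  by apply: addr_ge0; exact: mulr_ge0.
rewrite mulrDl -!mulrA; apply: lerD; apply: ler_wpM2l => //; [exact: h1|exact: h2].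
Qed.

Lemma extension_limit_ge (q q' : pair -> R) g (E E' A B : R) : 0 <= B ->
  approximable g -> extension_value q g E -> extension_value q' g E' ->
  (forall phi, test_pair phi -> A <= - (q phi + q' phi) + B * H2norm (subp phi g) ^+ 2) ->
  A <= - (E + E').
Proof.
move=> B0 ga qE qE' hA; apply/ler_addgt0Pr => e e0.
have e3 : 0 < e / 3 by rewrite divr_gt0.
have [d d0 hd] := qE _ e3; have [d' d'0 hd'] := qE' _ e3.
have B1 : 0 < B + 1 by rewrite ltr_wpDl.
have [|phi pt] := ga (Num.min (Num.min d d') (Num.min 1 (e / 3 / (B + 1)))).
  by rewrite !lt_min d0 d'0 ltr01 divr_gt0.
rewrite !lt_min => /andP[/andP[p1 p2] /andP[p3 p4]].
have := hA _ pt; have := hd _ pt.1 pt.2 p1; have := hd' _ pt.1 pt.2 p2.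
set N := H2norm _ in p3 p4 *; have N0 : 0 <= N := sqrtr_ge0 _.
have : B * N ^+ 2 <= e / 3.
  rewrite ltr_pdivlMr// in p4; apply: le_trans (ltW p4); rewrite mulrC.
  by apply: ler_pM; rewrite ?sqr_ge0 ?lerDl// expr2 ler_piMr// ltW.
rewrite !ltr_norml; move: (B * _) (q phi) (q' phi) => x y z h /andP[h1 h2] /andP[h3 h4] h5.
lra.
Qed.

(* Spares us the density of test functions. *)
Lemma extension_value_vacuous (q : pair -> R) g (E : R) :
  ~ approximable g -> extension_value q g E.
Proof.
move=> ga e e0; apply: contrapT => h; apply: ga => d d0; apply: contrapT => h2.
by apply: h; exists d => // phi p1 p2 pd; case: h2; exists phi.
Qed.

Section Multi.
Variables (J : nat) (delta0 c0 C0 : R).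
Hypotheses (d0 : 0 < delta0) (d1 : delta0 <= 1) (c00 : 0 < c0) (C00 : 0 < C0).
Variables (iota lam : 'I_J -> R) (alpha : R).
Hypotheses (alpha0 : 0 < alpha) (alpha1 : alpha <= 1) (hP : P_J alpha iota lam).
Hypothesis coercive : forall (l : R) g, 0 < l -> in_H2 g -> forall E1 E2 : R,
  extension_value (M0_field k psi delta l) g E1 -> extension_value (M0_velocity k psi delta l) g E2 ->
  c0 * Mor_sq l g - C0 * pairing_sq l g <= - (E1 + E2).

Local Notation M := (@Mform R k J psi delta delta0).
Local Notation U := (multiQ k iota lam).
Local Notation qbj j := (M0_pot k psi delta iota lam j).

Let lam0 i : 0 < lam i. Proof. by case: hP => _ []. Qed.
Let iota1 i : iota i = 1 \/ iota i = -1. Proof. by case: hP. Qed.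

Lemma M0_Hop_multi (j : 'I_J) phi : test_pair phi ->
  M0 k psi delta (lam j) phi.1 (\- Hop k U phi.1) = M0_field k psi delta (lam j) phi + qbj j phi.
Proof.
move=> [ft _]; set f := phi.1 in ft *.
have Qs : smooth_pos (scale (lam j) (Q k)) := smooth_pos_rescale (lam0 j) (@smooth_pos_Q R k hk).
have t0 := test_funN (test_fun_Hop k (@smooth_pos_U R k hk J iota lam lam0) ft).
have t1 := test_funN (test_fun_Hop k Qs ft).
have t2 := test_fun_pot hk iota j lam0 ft.
have [_ ->] := M0_test hk psi_smooth K0 hK deltap (lam0 j) ft t0.
have [i1 E1] := M0_test hk psi_smooth K0 hK deltap (lam0 j) ft t1.
have [i2 E2] := M0_test hk psi_smooth K0 hK deltap (lam0 j) ft t2.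
rewrite [M0_field _ _ _ _ _]E1 [M0_pot _ _ _ _ _ _ _]E2 -rintD//; apply: rint_eq => r r0.
rewrite -mulrDl; congr (_ * _).
have HE s : 0 < s -> - Hop k U f s = - Hop k (scale (lam j) (Q k)) f s - pot k iota lam j s * f s.
  by move=> s0; rewrite /Hop /pot /scale; field; rewrite gt_eqF.
have d : derive1 (fun s => - Hop k U f s) r =
    derive1 (fun s => - Hop k (scale (lam j) (Q k)) f s) r + derive1 (fun s => - (pot k iota lam j s * f s)) r.
  rewrite (derive1_pos r0 HE).
  exact: (is_derive1E (drD (test_fun_is_derive t1 r0) (test_fun_is_derive t2 r0))).
by rewrite /Aop [derive1 _ r]d /= HE//; ring.
Qed.

Lemma multi1_cauchy g : in_H2 g ->
  quad_cauchy (fun h => M lam h.1 (\- Hop k U h.1)) g.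
Proof.
move=> gH.
apply: (quad_cauchy_eq (q := fun h => \sum_(j < J) delta0 ^+ j * (M0_field k psi delta (lam j) h + qbj j h))).
  by move=> phi pt; apply: eq_bigr => j _; rewrite M0_Hop_multi.
apply: quad_cauchy_sum => j; apply: quad_cauchyZ; apply: quad_cauchyD.
  exact: (M0_field_cauchy hk psi_smooth K0 hK deltap).
exact: (M0_pot_cauchy hk psi_smooth K0 hK deltap).
Qed.

Lemma multi2_cauchy g : in_H2 g -> quad_cauchy (fun h => M lam h.2 h.2) g.
Proof.
move=> gH; apply: quad_cauchy_sum => j; apply: quad_cauchyZ.
exact: (M0_velocity_cauchy hk psi_smooth K0 hK deltap).
Qed.

Definition Cint : R := 32 * Cpot R k * Cmult k delta K.

Lemma Cint_ge0 : 0 <= Cint.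
Proof.
apply: mulr_ge0; last exact: ltW (Cmult_gt0 k K0 deltap).
by apply: mulr_ge0 => //; exact: Cpot_ge0.
Qed.

Lemma interaction_le (j : 'I_J) phi : test_pair phi ->
  delta0 ^+ j * `|qbj j phi| <=
  Cint * ((delta0 + alpha * delta0 ^- J) * Mor_multi_sq delta0 lam phi).
Proof.
move=> pt; have [_ sc] := hP.
(* Opposite to the modulation estimate: the gain [alpha] occurs for the interfering bubbles of
   smaller scale, [i > j]. For [i < j] one has [delta0 ^+ j <= delta0 * delta0 ^+ i] instead. *)
pose kappa (i : 'I_J) : R := if (j < i)%N then alpha else 1.
have kap0 i : 0 < kappa i by rewrite /kappa; case: ifP.
have hkap i : kappa i = 1 \/ lam i <= kappa i * lam j.
  by rewrite /kappa; case: ifP => ij; [right; exact: scales_lt ij|left].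
have := ler_wpM2l (dpow_ge0 d0 j) (M0_pot_le hk psi_smooth K0 hK deltap iota1 lam0 pt kap0 hkap).
move=> /le_trans; apply; rewrite mulrCA -/Cint; apply: ler_wpM2l; first exact: Cint_ge0.
rewrite /Mor_multi_sq !mulr_sumr [leRHS](bigD1 j)//=.
have eta0 : 0 <= alpha * delta0 ^- J.
  by apply: mulr_ge0; [exact: ltW|rewrite invr_ge0; exact: dpow_ge0].
have m0 (i : 'I_J) : 0 <= delta0 ^+ i * Mor_sq (lam i) phi.
  by apply: mulr_ge0; [exact: dpow_ge0|exact: Mor_sq_ge0].
apply: ler_wpDl.
  by apply: mulr_ge0 => //; apply: addr_ge0 => //; exact: ltW.
apply: ler_sum => i ij; rewrite !mulrA; apply: ler_wpM2r; first exact: Mor_sq_ge0.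
rewrite /kappa mulrDl; case: ltngtP => [lt|gt|e].
- apply: ler_wpDl; first by apply: mulr_ge0; [exact: ltW|exact: dpow_ge0].
  rewrite mulrC -mulrA; apply: ler_wpM2l; first exact: ltW.
  apply: (le_trans (dpow_le1 d0 d1 j)).
  rewrite mulrC ler_pdivlMr ?exprn_gt0// mul1r.
  exact: dpow_mono (ltnW (ltn_ord i)).
- rewrite mulr1; apply: ler_wpDr; first by apply: mulr_ge0 => //; exact: dpow_ge0.
  by rewrite -exprS; exact: dpow_mono.
- by rewrite (val_inj e) eqxx in ij.
Qed.

(** The interactions in all [J] forms together consume at most half of the coercivity constant. *)
Hypothesis small : J%:R * Cint * (delta0 + alpha * delta0 ^- J) <= c0 / 2.

Lemma test_coercive phi : test_pair phi ->
  c0 / 2 * Mor_multi_sq delta0 lam phi <=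
  - (M lam phi.1 (\- Hop k U phi.1) + M lam phi.2 phi.2) +
  C0 * \sum_(j < J) delta0 ^+ j * pairing_sq (lam j) phi.
Proof.
move=> pt; have gH := test_pair_in_H2 pt.
pose q j : R := M0_field k psi delta (lam j) phi + M0_velocity k psi delta (lam j) phi.
have hj (j : 'I_J) : c0 * Mor_sq (lam j) phi - C0 * pairing_sq (lam j) phi <= - q j.
  apply: coercive => //; apply: extension_test => //.
    exact: (M0_field_cauchy hk psi_smooth K0 hK deltap).
  exact: (M0_velocity_cauchy hk psi_smooth K0 hK deltap).
have -> : M lam phi.1 (\- Hop k U phi.1) + M lam phi.2 phi.2 =
    \sum_(j < J) delta0 ^+ j * q j + \sum_(j < J) delta0 ^+ j * qbj j phi.
  rewrite /Mform -!big_split/=; apply: eq_bigr => j _.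
  by rewrite M0_Hop_multi// /q /M0_velocity; ring.
have h1 : c0 * Mor_multi_sq delta0 lam phi - C0 * (\sum_(j < J) delta0 ^+ j * pairing_sq (lam j) phi) <=
    - (\sum_(j < J) delta0 ^+ j * q j).
  rewrite /Mor_multi_sq !mulr_sumr -sumrB -sumrN; apply: ler_sum => j _.
  have := ler_wpM2l (dpow_ge0 d0 j) (hj j); rewrite mulrN; apply: le_trans.
  by apply: eq_ge; ring.
have h2 : `|\sum_(j < J) delta0 ^+ j * qbj j phi| <= c0 / 2 * Mor_multi_sq delta0 lam phi.
  apply: (le_trans (ler_norm_sum _ _ _)).
  apply: (@le_trans _ _ (\sum_(j < J) Cint * ((delta0 + alpha * delta0 ^- J) * Mor_multi_sq delta0 lam phi))).
    by apply: ler_sum => j _; rewrite normrM ger0_norm ?dpow_ge0//; exact: interaction_le.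
  rewrite sumr_const card_ord -[leLHS]mulr_natl.
  have := ler_wpM2r (Mor_multi_ge0 d0 phi lam0) small; apply: le_trans.
  by apply: eq_ge; ring.
move: h1 h2; rewrite ler_norml => h1 /andP[h2 h3].
set A := Mor_multi_sq _ _ _ in h1 h2 h3 *; set B := \sum_(j < J) _ in h1 *.
lra.
Qed.

Lemma multi_monotonicity g : in_H2 g ->
  (forall i : 'I_J, rdot (bubble iota lam Z i) g.1 = 0 /\ rdot (bubble iota lam Z i) g.2 = 0) ->
  exists E1 E2 : R,
    [/\ extension_value (fun h => M lam h.1 (\- Hop k U h.1)) g E1,
        extension_value (fun h => M lam h.2 h.2) g E2 &
        c0 / 4 * Mor_multi_sq delta0 lam g <= - (E1 + E2)].
Proof.
move=> gH orth; have [ga|ga] := pselect (approximable g); last first.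
  (* If test pairs do not approach [g], every number is an extended value, and this choice makes the
     inequality an equality. *)
  exists (- (c0 / 4 * Mor_multi_sq delta0 lam g)), 0; split.
  - exact: extension_value_vacuous.
  - exact: extension_value_vacuous.
  - by rewrite addr0 opprK.
have [E1 hE1] := extension_exists (multi1_cauchy gH) ga.
have [E2 hE2] := extension_exists (multi2_cauchy gH) ga.
exists E1, E2; split => //.
have /choice[B hB] (j : 'I_J) : exists B : R, 0 <= B /\ forall phi, test_pair phi ->
    pairing_sq (lam j) phi <= B * H2norm (subp phi g) ^+ 2.
  have [z1 z2] := orth j.
  by have [B B0 h] := pairing_bounded (lam0 j) (iota1 j) gH z1 z2; exists B.
(* [B'] bounds the pairings with the profiles and [L] the change of the Morawetz norm, both relative
   to the squared distance of [phi] from [g]. They may depend on [g] and the scales, since that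
   distance tends to 0. *)
pose B' := C0 * \sum_(j < J) delta0 ^+ j * B j.
pose L := \sum_(j < J) delta0 ^+ j * (lam j)^-1.
have B'0 : 0 <= B'.
  apply: mulr_ge0; first exact: ltW.
  by apply: sumr_ge0 => j _; apply: mulr_ge0; [exact: dpow_ge0|case: (hB j)].
have L0 : 0 <= L.
  by apply: sumr_ge0 => j _; apply: mulr_ge0; [exact: dpow_ge0|rewrite invr_ge0 ltW].
apply: (extension_limit_ge (B := B' + c0 / 2 * L) _ ga hE1 hE2) => [|phi pt].
  by apply: addr_ge0 => //; apply: mulr_ge0 => //; apply: divr_ge0 => //; exact: ltW.
set N := H2norm _ ^+ 2.
have h1 : Mor_multi_sq delta0 lam g <= 2 * (Mor_multi_sq delta0 lam phi + L * N).
  rewrite /Mor_multi_sq /L mulr_suml -big_split/= mulr_sumr; apply: ler_sum => j _.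
  have := ler_wpM2l (dpow_ge0 d0 j) (Mor_sq_test_le gH (lam0 j) pt); rewrite -/N.
  by move=> /le_trans; apply; apply: eq_ge; ring.
have h2 : C0 * (\sum_(j < J) delta0 ^+ j * pairing_sq (lam j) phi) <= B' * N.
  rewrite /B' -mulrA; apply: ler_wpM2l; first exact: ltW.
  rewrite mulr_suml; apply: ler_sum => j _; rewrite -mulrA; apply: ler_wpM2l; first exact: dpow_ge0.
  by case: (hB j) => _; exact.
have h3 := test_coercive pt.
have c40 : 0 <= c0 / 4 by rewrite divr_ge0// ltW.
have h4 := ler_wpM2l c40 h1.
set X := _ + M lam _ _ in h3 *.
move: h2 h3 h4; rewrite !mulrDl !mulrDr; set T := L * N; set S := _ * \sum_(j < J) _.
rewrite (_ : c0 / 2 * L * N = c0 / 2 * T); last by rewrite /T; ring.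
move: (Mor_multi_sq _ _ _) (Mor_multi_sq _ _ _) (B' * N) S => a b u v h2 h3 h4.
apply: (le_trans h4); lra.
Qed.

End Multi.
End Monotonicity.

Lemma sqrt_cvg0 (R : realType) : Num.sqrt x @[x --> 0^'+] --> (0 : R).
Proof.
rewrite -[X in _ --> X](sqrtr0 R); apply: cvg_at_right_filter.
exact: sqrt_continuous.
Qed.

Theorem proposition3p3 (R : realType) (k J : nat) (hk : (2 <= k)%N) (hJ : (1 <= J)%N)
    (chi psi : R -> R) (delta : R)
    (hchi : is_cutoff chi)
    (hpsi : is_morawetz_weight k psi)
    (hdelta : is_morawetz_constant k chi psi delta) :
  exists (C c delta0_max : R) (o : R -> R),
    [/\ 0 < C, 0 < c, 0 < delta0_max & o x @[x --> 0^'+] --> (0 : R)] /\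
    forall delta0 : R, 0 < delta0 -> delta0 < delta0_max ->
    let M := @Mform R k J psi delta delta0 in
    exists alpha_star : R, [/\ 0 < alpha_star < 1,
    (* boundedness *)
    (forall (g : (R -> R) * (R -> R)) (lam : 'I_J -> R),
       in_H2 g -> scales 1 lam ->
       let L1 := rL1norm (fun r => jet 2 g.1 r * jet 1 g.2 r) in
       (`|M lam g.1 g.2|%:E <= C%:E * L1)%E /\
       (L1 <= (C * H2norm g ^+ 2)%:E)%E),
    (* monotonicity *)
    (forall (iota lam : 'I_J -> R) (g : (R -> R) * (R -> R)),
       P_J alpha_star iota lam -> in_H2 g ->
       (forall i : 'I_J,
          rdot (bubble iota lam (Zprofile k chi) i) g.1 = 0 /\
          rdot (bubble iota lam (Zprofile k chi) i) g.2 = 0) ->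
       exists E1 E2 : R,
         [/\ extension_value (fun h =>
               M lam h.1 (\- Hop k (multiQ k iota lam) h.1)) g E1,
             extension_value (fun h => M lam h.2 h.2) g E2 &
             c * Mor_multi_sq delta0 lam g <= - (E1 + E2)]),
    (* lambda d/dlambda estimates *)
    (forall (g : (R -> R) * (R -> R)) (lam : 'I_J -> R) (j : 'I_J),
       in_H2 g -> scales 1 lam ->
       let M_j := fun l : R => M (@dfwith 'I_J (fun=> R) lam j l) g.1 g.2 in
       derivable M_j (lam j) 1 /\
       `|lam j * derive1 M_j (lam j)|
         <= C * (Num.sqrt (lam j) * H2norm g * Mor_norm delta0 lam g)) &
    (* smallness for modulation vectors *)
    (forall (alpha : R) (iota lam : 'I_J -> R) (g : (R -> R) * (R -> R)) (j : 'I_J),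
       0 < alpha <= alpha_star -> P_J alpha iota lam -> in_H2 g ->
       `|M lam g.1 (bubble_underline iota lam (LambdaQ k) j)|
         <= C * (delta0 + o alpha * delta0 ^- J)
              * ((Num.sqrt (lam j))^-1 * Num.sqrt delta0 ^+ j
                 * Mor_norm delta0 lam g))].
Proof.
have ps : smooth_pos psi := hpsi.1.
have [K K0 hK] := weight_bounds hpsi.
have [deltap [c0 [C0 [c00 C00 coer]]]] := hdelta.
have X0 := ltW (Cmult_gt0 k K0 deltap).
have D0 := Cscale_ge0 k K0 deltap.
have F0 : 0 <= Cmod k delta K.
  by rewrite /Cmod; apply: mulr_ge0 => //; apply: mulr_ge0 => //; exact: sqr_ge0.
have I0 := Cint_ge0 k K0 deltap.
pose a1 : R := J%:R * ((1 + k%:R) * Cmult k delta K).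
pose a4 : R := J%:R * (2 * Cmod k delta K).
have a10 : 0 <= a1 by apply: mulr_ge0 => //; apply: mulr_ge0 => //; exact: addr_ge0.
have a40 : 0 <= a4 by apply: mulr_ge0 => //; exact: mulr_ge0.
(* One summand for each estimate; the 1 is for the second inequality of the boundedness, whose
   constant is 1. *)
pose C := a1 + 1 + 2 * Cscale k delta K + a4.
pose W : R := J%:R * (Cint k delta K + 1).
have W0 : 0 < W by apply: mulr_gt0; [rewrite ltr0n|exact: ltr_wpDl].
(* The threshold gives [W * delta0 <= c0 / 4], and [al] below gives
   [W * al * delta0 ^- J <= c0 / 4]; together they are the smallness required for the absorption.
   Only [al] depends on [delta0]. *)
exists C, (c0 / 4), (Num.min (1 / 2) (c0 / (4 * W))), Num.sqrt; split.
  split; [|exact: divr_gt0| |exact: sqrt_cvg0].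
    by rewrite /C; lra.
  by rewrite lt_min !divr_gt0// mulr_gt0.
move=> delta0 d0; rewrite lt_min => /andP[d2 dW] M.
have d1 : delta0 <= 1 by lra.
have dJ : 0 < delta0 ^+ J := exprn_gt0 _ d0.
pose al := Num.min (1 / 2) (c0 * delta0 ^+ J / (4 * W)).
have W40 : 0 < 4 * W by exact: mulr_gt0.
have al0 : 0 < al by rewrite lt_min divr_gt0// divr_gt0// mulr_gt0.
have al2 : al <= 1 / 2 by rewrite /al ge_min lexx.
have al1 : al <= 1 by lra.
exists al; split.
- by rewrite al0; lra.
- move=> g lam gH [l0 _] L1; rewrite /L1 (rL1norm_jet_prod gH) -EFinM !lee_fin.
  have N0 : 0 <= rint (fun r => jet 2 g.1 r * jet 1 g.2 r).
    by apply: rint_ge0 => r _; apply: mulr_ge0; exact: jet_ge0.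
  split.
    apply: (le_trans (multi_bounded hk ps K0 hK deltap d0 d1 gH l0)).
    by apply: ler_wpM2r => //; rewrite -/a1 /C; lra.
  apply: (le_trans (rint_jet_prod_le gH)).
  by apply: ler_peMl; [exact: sqr_ge0|rewrite /C; lra].
- move=> iota lam g hP gH orth.
  apply: (multi_monotonicity hk ps K0 hK deltap hchi d0 d1 c00 C00 al0 al1 hP coer _ gH orth).
  have CW : J%:R * Cint k delta K <= W by apply: ler_wpM2l => //; rewrite lerDl.
  have s0 : 0 <= delta0 + al * delta0 ^- J.
    by apply: addr_ge0; [exact: ltW|rewrite mulr_ge0 ?invr_ge0// ltW].
  apply: (le_trans (ler_wpM2r s0 CW)).
  have h1 : W * delta0 <= c0 / 4.
    move: dW; rewrite (ltr_pdivlMr _ _ W40) => /ltW; lra.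
  have h2 : W * (al * delta0 ^- J) <= c0 / 4.
    have : al <= c0 * delta0 ^+ J / (4 * W) by rewrite ge_min lexx orbT.
    rewrite (ler_pdivlMr _ _ W40) => h2; rewrite [leLHS]mulrA ler_pdivrMr//; lra.
  by rewrite mulrDr; lra.
- move=> g lam j gH [l0 _] M_j.
  have [h1 h2] := multi_scale_derivative hk ps K0 hK deltap d0 d1 j gH l0.
  split => //; apply: (le_trans h2); apply: ler_wpM2r; last by rewrite /C; lra.
  apply: mulr_ge0; last exact: sqrtr_ge0.
  by apply: mulr_ge0; exact: sqrtr_ge0.
- move=> alpha iota lam g j /andP[alpha0 alle] hP gH.
  apply: (le_trans (multi_modulation hk ps K0 hK deltap d0 d1 j gH alpha0 (le_trans alle al1) hP)).
  rewrite -/a4; have s0 : 0 <= delta0 + Num.sqrt alpha * delta0 ^- J.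
    by apply: addr_ge0; [exact: ltW|rewrite mulr_ge0 ?invr_ge0 ?sqrtr_ge0// ltW].
  apply: ler_wpM2r.
    apply: mulr_ge0; last exact: sqrtr_ge0.
    by apply: mulr_ge0; rewrite ?invr_ge0 ?exprn_ge0 ?sqrtr_ge0.
  by apply: ler_wpM2r => //; rewrite /C; lra.
Qed.
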